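(* Let $\mathbf{X}=\{X(t)\}_{t\ge0}$ be a full operator stable Lévy process in $\mathbb{R}^2$ with exponent $B$ and no Gaussian component, and let $\mu=\mathcal{L}(X(1))$, with Lévy measure $\nu$. Suppose that $B$ is in one of the Jordan forms $B_0,B_1,B_2,B_3$ listed in the context and that the spectral measure $\lambda$ is the finite Borel measure on the Euclidean unit circle $S^1\subset\mathbb{R}^2$ determined by $$\lambda(F)=\nu(\{x: x=t^Bu\text{ for some }(t,u)\in[1,\infty)\times F\}),\qquad F\in\mathcal{B}(S^1).$$ Let $\mathcal{S}_0(\lambda)=\{A\in\mathrm{GL}(\mathbb{R}^2):A\lambda=\lambda\}$ denote the strict symmetry group of $\lambda$, and $\mathcal{S}(\mu)$ the symmetry group of $\mu$. (a) If $B=B_1$, then $\mathcal{S}(\mu)=\mathcal{S}_0(\lambda)\cap\mathcal{D}_2$. (b) If $B=B_2$, then either $\mathcal{S}(\mu)=\mathcal{S}_0(\lambda)\cap\mathcal{O}_2^+=\mathcal{C}_n$ for some $n\ge1$, or $\mathcal{S}(\mu)=\mathcal{S}_0(\lambda)=\mathcal{O}_2$. (c) If $B=B_3$, then $\mathcal{S}(\mu)=\mathcal{S}_0(\lambda)\cap\mathcal{C}_2$.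
   Context: For $t>0$ and a real matrix $B$, $t^B:=\exp(B\log t)$. A Lévy process $\mathbf{X}$ in $\mathbb{R}^d$ is operator stable with exponent $B\in\mathrm{GL}(\mathbb{R}^d)$ if for every $t>0$ there is $b(t)\in\mathbb{R}^d$ with $X(t)\stackrel{d}{=}t^BX(1)+b(t)$. It is full if $\mu=\mathcal{L}(X(1))$ is not supported on a lower dimensional hyperplane. The symmetry group is $$\mathcal{S}(\mu)=\{A\in\mathrm{GL}(\mathbb{R}^d): A\mu=\mu*\delta_x\text{ for some }x\in\mathbb{R}^d\}.$$ Here $A\mu$, $A\lambda$ denote image measures under $A$, with $\lambda$ regarded as a measure on $\mathbb{R}^2$ carried by $S^1$. Jordan forms: $$B_0=bI,\quad B_1=\begin{bmatrix}b_1&0\\0&b_2\end{bmatrix},\quad B_2=\begin{bmatrix}b&-c\\c&b\end{bmatrix},\quad B_3=\begin{bmatrix}b&0\\1&b\end{bmatrix},$$ where $b,b_1,b_2>1/2$, $b_1\neq b_2$, and $c\neq0$. For these $B$ the Euclidean norm satisfies: $t\mapsto\|t^Bx\|$ is strictly increasing for $x\ne0$ and $(t,u)\mapsto t^Bu$ is a homeomorphism of $(0,\infty)\times S^1$ onto $\mathbb{R}^2\setminus\{0\}$; correspondingly the Lévy measure has the polar decomposition $\nu(E)=\int_{S^1}\int_0^\infty\mathbf{1}_E(s^Bu)s^{-2}\,ds\,\lambda(du)$ for $E\in\mathcal{B}(\mathbb{R}^2)$. $\mathcal{O}_2=\{R_\theta,F_\theta:\theta\in[0,2\pi)\}$ is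 the orthogonal group of $\mathbb{R}^2$, where $$R_\theta=\begin{bmatrix}\cos\theta&-\sin\theta\\ \sin\theta&\cos\theta\end{bmatrix},\qquad F_\theta=\begin{bmatrix}\cos\theta&\sin\theta\\ \sin\theta&-\cos\theta\end{bmatrix};$$ $\mathcal{O}_2^+=\{R_\theta:\theta\in[0,2\pi)\}$. For $n\ge1$, $\mathcal{C}_n=\{R_{2\pi k/n}:k=0,\dots,n-1\}$, so $\mathcal{C}_2=\{I,-I\}$; and $\mathcal{D}_2=\{I,F_0,-I,-F_0\}$ with $F_0=\mathrm{diag}(1,-1)$. *)

(* Defs.v *)
From HB Require Import structures.
From mathcomp Require Import all_boot all_order all_algebra.
From mathcomp Require Import all_classical all_reals all_analysis.
From mathcomp Require Import complex.

Set Implicit Arguments.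
Unset Strict Implicit.
Unset Printing Implicit Defensive.

Import Order.TTheory GRing.Theory Num.Theory.
Import numFieldNormedType.Exports.

Local Open Scope classical_set_scope.
Local Open Scope ring_scope.

HB.instance Definition _ (R : realType) (m n : nat) :=
  Measurable.copy 'M[R]_(m, n) (g_sigma_algebraType (@open 'M[R]_(m, n))).

Section euclidean.
Context {R : realType} {d : nat}.
Implicit Types x y : 'cV[R]_d.

Definition dotv x y : R := \sum_i x i 0 * y i 0.

(* The library norm on matrices is the sup norm; this is the Euclidean one. *)
Definition enorm x : R := Num.sqrt (dotv x x).

Definition sphere : set 'cV[R]_d := [set x | enorm x = 1].

End euclidean.
Arguments sphere : clear implicits.

Definition expmx {R : realType} {d : nat} (A : 'M[R]_d.+1) : 'M[R]_d.+1 :=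
  limn (series (fun k => (k`!%:R)^-1 *: A ^+ k)).

(* t^B, meant for 0 < t *)
Definition powmx {R : realType} {d : nat} (t : R) (B : 'M[R]_d.+1) :
  'M[R]_d.+1 := expmx (ln t *: B).

Section measures.
Context {R : realType} {d : nat}.
Local Notation V := 'cV[R]_d.
Implicit Types (mu nu : set V -> \bar R) (A : 'M[R]_d).

Definition meas_eq mu nu := forall E : set V, measurable E -> mu E = nu E.

Definition image_meas A mu : set V -> \bar R :=
  pushforward mu (fun x : V => A *m x).

Definition convolution mu nu : set V -> \bar R :=
  pushforward (mu \x nu)%E (fun z : V * V => z.1 + z.2).

Definition symmetry_group mu : set 'M[R]_d :=
  [set A | A \in unitmx /\
     exists x : V, meas_eq (image_meas A mu) (convolution mu \d_x)].

Definition strict_symmetry_group mu : set 'M[R]_d :=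
  [set A | A \in unitmx /\ meas_eq (image_meas A mu) mu].

(* Hyperplanes are affine: they need not pass through the origin. *)
Definition full mu := forall (a : V) (c : R), a != 0 ->
  mu (~` [set x | dotv a x = c]) <> 0%E.

End measures.

Section levy_khintchine.
Context {R : realType}.
Local Open Scope complex_scope.

Definition cexp (z : R[i]) : R[i] :=
  let: a +i* b := z in (expR a * cos b) +i* (expR a * sin b).

Definition cintegral {disp} {T : measurableType disp} (mu : {measure set T -> \bar R})
    (f : T -> R[i]) : R[i] :=
  (\int[mu]_x complex.Re (f x)) +i* (\int[mu]_x complex.Im (f x)).

Context {d : nat}.
Local Notation V := 'cV[R]_d.

Definition charfun (mu : {measure set V -> \bar R}) (z : V) : R[i] :=
  cintegral mu (fun x => cexp ('i%C * (dotv z x)%:C)).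

Definition levy_measure (nu : {measure set V -> \bar R}) :=
  nu [set 0] = 0%E /\
  (\int[nu]_x (Num.min 1 (enorm x ^+ 2))%:E < +oo)%E.

(* The Lévy-Khintchine exponent for the truncation function given by the
   indicator of the closed Euclidean unit ball. *)
Definition levy_exponent (gamma : V) (Sigma : 'M[R]_d) (nu : {measure set V -> \bar R})
    (z : V) : R[i] :=
  - (2^-1 * dotv z (Sigma *m z))%:C + 'i%C * (dotv gamma z)%:C
  + cintegral nu (fun x => cexp ('i%C * (dotv z x)%:C) - 1
      - 'i%C * (dotv z x * (enorm x <= 1)%R%:R)%:C).

Definition levy_triplet (mu : {measure set V -> \bar R})
    (gamma : V) (Sigma : 'M[R]_d) (nu : {measure set V -> \bar R}) :=
  [/\ Sigma^T = Sigma,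
      forall z, 0 <= dotv z (Sigma *m z),
      levy_measure nu &
      forall z, charfun mu z = cexp (levy_exponent gamma Sigma nu z)].

End levy_khintchine.

Section processes.
Context {R : realType} {disp : measure_display} {Omega : measurableType disp}.
Variable P : probability Omega R.
Context {d : nat}.
Local Notation V := 'cV[R]_d.

Definition eq_dist (Y Z : Omega -> V) :=
  forall E : set V, measurable E -> P (Y @^-1` E) = P (Z @^-1` E).

(* Allowing E i = setT, this yields the product rule for all subfamilies. *)
Definition independent_family (n : nat) (Y : 'I_n -> Omega -> V) :=
  forall E : 'I_n -> set V, (forall i, measurable (E i)) ->
    fine (P [set w | forall i, E i (Y i w)]) =
    \prod_(i < n) fine (P (Y i @^-1` E i)).

(* Only the values X t with 0 <= t are relevant. *)
Variable X : R -> {RV P >-> V}.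

Definition starts_at_zero := {ae P, forall w, X 0 w = 0}.

Definition independent_increments := forall (n : nat) (t : nat -> R),
  0 <= t 0%N -> (forall k, (k < n)%N -> t k < t k.+1) ->
  independent_family (fun (k : 'I_n) w => X (t k.+1) w - X (t k) w).

Definition stationary_increments := forall s t : R, 0 <= s -> 0 <= t ->
  eq_dist (fun w => X (s + t) w - X s w) (fun w => X t w - X 0 w).

Definition stochastically_continuous := forall t eps : R, 0 <= t -> 0 < eps ->
  (fun s => P [set w | eps < enorm (X s w - X t w)])
    @ within [set s | 0 <= s] (nbhs t) --> 0%E.

Definition cadlag_paths := {ae P, forall w, forall t : R, 0 <= t ->
  ((fun s => X s w) @ t^'+ --> X t w) /\
  (0 < t -> cvg ((fun s => X s w) @ t^'-))}.

Definition levy_process :=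
  [/\ starts_at_zero, independent_increments, stationary_increments,
      stochastically_continuous & cadlag_paths].

End processes.

Definition operator_stable {R : realType} {disp : measure_display}
    {Omega : measurableType disp} (P : probability Omega R) {d : nat}
    (X : R -> {RV P >-> 'cV[R]_d.+1}) (B : 'M[R]_d.+1) :=
  B \in unitmx /\
  forall t : R, 0 < t -> exists b : 'cV[R]_d.+1,
    eq_dist P (X t) (fun w => powmx t B *m X 1 w + b).

(* lambda is regarded as a measure on R^d carried by the unit sphere. *)
Definition spectral_measure {R : realType} {d : nat} (B : 'M[R]_d.+1)
    (nu lambda : set 'cV[R]_d.+1 -> \bar R) :=
  lambda (~` sphere R d.+1) = 0%E /\
  forall F : set 'cV[R]_d.+1, measurable F -> F `<=` sphere R d.+1 ->
    lambda F =
    nu [set x | exists t u, [/\ 1 <= t, F u & x = powmx t B *m u]].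

Section plane.
Context {R : realType}.

Definition mx2 (a b c d : R) : 'M[R]_2 :=
  \matrix_(i, j) nth 0 (nth [::] [:: [:: a; b]; [:: c; d]] i) j.

Definition jordan0 (B : 'M[R]_2) := exists b : R, 2^-1 < b /\ B = b%:M.

Definition jordan1 (B : 'M[R]_2) := exists b1 b2 : R,
  [/\ 2^-1 < b1, 2^-1 < b2, b1 != b2 & B = mx2 b1 0 0 b2].

Definition jordan2 (B : 'M[R]_2) := exists b c : R,
  [/\ 2^-1 < b, c != 0 & B = mx2 b (- c) c b].

Definition jordan3 (B : 'M[R]_2) := exists b : R,
  2^-1 < b /\ B = mx2 b 0 1 b.

Definition jordan_form (B : 'M[R]_2) :=
  [\/ jordan0 B, jordan1 B, jordan2 B | jordan3 B].

Definition rotmx (theta : R) : 'M[R]_2 :=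
  mx2 (cos theta) (- sin theta) (sin theta) (cos theta).

Definition reflmx (theta : R) : 'M[R]_2 :=
  mx2 (cos theta) (sin theta) (sin theta) (- cos theta).

Definition SO2 : set 'M[R]_2 :=
  [set rotmx theta | theta in [set theta | 0 <= theta < 2 * pi]].

Definition O2 : set 'M[R]_2 :=
  SO2 `|` [set reflmx theta | theta in [set theta | 0 <= theta < 2 * pi]].

(* meant for 1 <= n *)
Definition cyclic_rot (n : nat) : set 'M[R]_2 :=
  [set rotmx (2 * pi * k%:R / n%:R) | k in [set k | (k < n)%N]].

Definition dihedral2 : set 'M[R]_2 :=
  [set A | [\/ A = 1%:M, A = reflmx 0, A = - 1%:M | A = - reflmx 0]].

End plane.

(* Main.v *)
Require Import Defs.
From mathcomp Require Import all_boot all_order all_algebra.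
From mathcomp Require Import all_classical all_reals all_analysis.
From mathcomp Require Import complex ring lra.
From mathcomp Require Import measurable_realfun lebesgue_integral_under.

(** Writing the Lévy-Khintchine exponent as psi, its second differences
    psi(z) - (psi(z + w) + psi(z - w)) / 2 are Fourier transforms of the finite
    measures (1 - cos <w, x>) nu(dx); hence mu determines nu, an isometry is a
    symmetry of mu exactly when it preserves nu, and operator stability of the
    n-th convolution power gives n nu = n^B nu. In the coordinates x = t^B u,
    nu({t >= r, u in F}) = lambda(F) / r, so nu scales under every t^B, and an
    isometry commuting with B preserves nu exactly when it preserves lambda.

    Fullness bounds the group of matrices preserving nu, and this group is
    normalized by all t^B. Boundedness of the conjugates t^(-B) A t^B forces A to
    be diagonal with entries +-1 for B_1 and A = +-I for B_3. For B_2 the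
    rotational part of t^B makes the group normalized by all rotations, which
    forces A to be an isometry; one reflection in the group then yields all
    rotations, and without reflections the group is a closed subgroup of the
    circle, finite cyclic or everything. In the last case lambda is rotation
    invariant, so that every reflection is a symmetry too. *)

Import Order.TTheory GRing.Theory Num.Theory.
Import numFieldNormedType.Exports.

Local Open Scope classical_set_scope.
Local Open Scope ring_scope.
Set Implicit Arguments.
Unset Strict Implicit.
Unset Printing Implicit Defensive.

(** * Borel sets of vectors *)

Section borel_vectors.
Context {R : realType}.

Lemma open_measurable_mx m n (U : set 'M[R]_(m, n)) : open U -> measurable U.
Proof. by move=> oU; apply: sub_sigma_algebra. Qed.

Lemma measurable_coord m n i j :
  measurable_fun setT (fun M : 'M[R]_(m, n) => M i j).
Proof.
apply: (measurability _ (RGenOpens.measurableE R)).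
move=> _ [_ [a [b ->] <-]]; rewrite setTI; apply: open_measurable_mx.
apply: open_comp; last exact: interval_open.
by move=> x _; exact: coord_continuous.
Qed.

Lemma measurable_fun_cV d disp (T : measurableType disp) (f : T -> 'cV[R]_d) :
  (forall i, measurable_fun setT (fun x => f x i 0)) -> measurable_fun setT f.
Proof.
have mE : @measurable _ 'cV[R]_d = <<s @open 'cV[R]_d >> by [].
move=> mf; apply: (measurability _ mE).
move=> _ [U oU <-]; rewrite setTI.
pose box (q : 'cV[rat]_d) (k : nat) : set 'cV[R]_d :=
  [set v | forall i, `|v i 0 - ratr (q i 0)| < k.+1%:R^-1].
pose J := [set p : 'cV[rat]_d * nat | box p.1 p.2 `<=` U].
have -> : f @^-1` U = \bigcup_(p in J) (f @^-1` box p.1 p.2).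
  rewrite -preimage_bigcup; congr (_ @^-1` _).
  rewrite eqEsubset; split => [v Uv|v [p Jp]]; last exact: Jp.
  have /nbhs_ballP[e /= e0 eU] : nbhs v U by exact: open_nbhs_nbhs.
  have [k ke] : exists k : nat, k.+1%:R^-1 < e / 2.
    have [k _ /(_ k (leqnn _))] := near_infty_natSinv_lt (PosNum (divr_gt0 e0 (ltr0n _ 2))).
    by move=> ?; exists k.
  have k0 : 0 < k.+1%:R^-1 :> R by rewrite invr_gt0.
  have /choice[q qv] : forall i : 'I_d, exists q : rat, `|v i 0 - ratr q| < k.+1%:R^-1.
    move=> i; have [] := @rat_in_itvoo R (v i 0 - k.+1%:R^-1) (v i 0 + k.+1%:R^-1).
      by rewrite ltrBlDr -addrA ltrDl addr_gt0.
    move=> q; rewrite in_itv/= => /andP[q1 q2]; exists q.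
    by rewrite distrC ltr_distl q1 q2.
  exists (\col_i q i, k); last by move=> i; rewrite mxE.
  move=> w wb; apply: eU; split => // i j; rewrite ord1.
  have := wb i; have := qv i; rewrite /= mxE => h1 h2.
  rewrite /ball /= (_ : v i 0 - w i 0 = (v i 0 - ratr (q i)) - (w i 0 - ratr (q i))); last by ring.
  rewrite (le_lt_trans (ler_normB _ _))//.
  by rewrite (splitr e) ltrD// (lt_trans _ ke).
rewrite (_ : \bigcup_(p in J) _ = \bigcup_p (if `[< J p >] then f @^-1` box p.1 p.2 else set0)); last first.
  rewrite eqEsubset; split => x [p].
    by move=> Jp bx; exists p => //; case: asboolP.
  by move=> _; case: asboolP => // Jp bx; exists p.
apply: countable_bigcupT_measurable => [|p]; first exact: countableP.
case: ifP => // _.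
rewrite (_ : _ @^-1` _ = \bigcap_(i in [set: 'I_d]) [set x | `|f x i 0 - ratr (p.1 i 0)| < p.2.+1%:R^-1]); last first.
  by rewrite eqEsubset; split => x /= h i; [move=> _; exact: h|exact: h].
apply: fin_bigcap_measurable => // i _.
under eq_set => x do rewrite -lte_fin.
rewrite -[X in measurable X]setTI; apply: measurable_lte => //.
by apply/measurable_EFinP; apply: measurableT_comp => //; apply: measurable_funB.

Qed.

Context {d : nat}.
Implicit Types (x y z : 'cV[R]_d) (A : 'M[R]_d).

Lemma dotvC x y : dotv x y = dotv y x.
Proof. by apply: eq_bigr => i _; rewrite mulrC. Qed.

Lemma dotvDl x y z : dotv (x + y) z = dotv x z + dotv y z.
Proof. by rewrite -big_split; apply: eq_bigr => i _; rewrite mxE mulrDl. Qed.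

Lemma dotvZl c x y : dotv (c *: x) y = c * dotv x y.
Proof. by rewrite mulr_sumr; apply: eq_bigr => i _; rewrite mxE mulrA. Qed.

Lemma dotvNl x y : dotv (- x) y = - dotv x y.
Proof. by rewrite -scaleN1r dotvZl mulN1r. Qed.

Lemma dotvBl x y z : dotv (x - y) z = dotv x z - dotv y z.
Proof. by rewrite dotvDl dotvNl. Qed.

Lemma dotv0l x : dotv 0 x = 0.
Proof. by rewrite -(scale0r 0) dotvZl mul0r. Qed.

Lemma dotvDr z x y : dotv z (x + y) = dotv z x + dotv z y.
Proof. by rewrite dotvC dotvDl !(dotvC _ z). Qed.

Lemma dotvZr c x y : dotv x (c *: y) = c * dotv x y.
Proof. by rewrite dotvC dotvZl dotvC. Qed.

Lemma dotv0r x : dotv x 0 = 0.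
Proof. by rewrite dotvC dotv0l. Qed.

Lemma dotv_mulmx A z x : dotv z (A *m x) = dotv (A^T *m z) x.
Proof.
have dotE u v : dotv u v = (u^T *m v) 0 0.
  by rewrite mxE; apply: eq_bigr => i _; rewrite mxE.
by rewrite !dotE mulmxA trmx_mul trmxK.
Qed.

Lemma dotv_ge0 x : 0 <= dotv x x.
Proof. by apply: sumr_ge0 => i _; rewrite -expr2 sqr_ge0. Qed.

Lemma dotv_eq0 x : (dotv x x == 0) = (x == 0).
Proof.
apply/idP/eqP => [|->]; last by rewrite dotv0l.
rewrite psumr_eq0 => [/allP h|i _]; last by rewrite -expr2 sqr_ge0.
apply/colP => i; rewrite mxE; apply/eqP.
by have := h i (mem_index_enum _); rewrite mulf_eq0 orbb.
Qed.

Lemma enorm_ge0 x : 0 <= enorm x. Proof. exact: sqrtr_ge0. Qed.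

Lemma sqr_enorm x : enorm x ^+ 2 = dotv x x.
Proof. by rewrite sqr_sqrtr// dotv_ge0. Qed.

Lemma enorm0 : enorm (0 : 'cV[R]_d) = 0.
Proof. by rewrite /enorm dotv0l sqrtr0. Qed.

Lemma enorm_eq0 x : (enorm x == 0) = (x == 0).
Proof. by rewrite -dotv_eq0 -sqr_enorm sqrf_eq0. Qed.

Lemma enorm_gt0 x : (0 < enorm x) = (x != 0).
Proof. by rewrite lt_neqAle enorm_ge0 andbT eq_sym enorm_eq0. Qed.

Lemma enormZ c x : enorm (c *: x) = `|c| * enorm x.
Proof. by rewrite /enorm dotvZl dotvZr mulrA -expr2 sqrtrM ?sqr_ge0// sqrtr_sqr. Qed.

Lemma CauchySchwarz_dotv x y : `|dotv x y| <= enorm x * enorm y.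
Proof.
have [->|x0] := eqVneq x 0; first by rewrite dotv0l normr0 mulr_ge0 ?enorm_ge0.
have xx : 0 < dotv x x by rewrite lt_neqAle eq_sym dotv_eq0 x0 dotv_ge0.
rewrite -(ler_pXn2r (_ : 0 < 2)%N) ?nnegrE ?mulr_ge0 ?enorm_ge0//.
rewrite real_normK ?num_real// exprMn !sqr_enorm.
have := dotv_ge0 (dotv x x *: y - dotv x y *: x).
rewrite -scaleNr !(dotvDl, dotvDr, dotvZl, dotvZr) (dotvC y x) => h.
suff : 0 <= dotv x x * (dotv x x * dotv y y - dotv x y ^+ 2).
  by rewrite pmulr_rge0// subr_ge0.
by apply: le_trans h _; rewrite le_eqVlt; apply/orP; left; apply/eqP; ring.
Qed.

Lemma measurable_dotv z : measurable_fun setT (dotv z).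
Proof.
apply: measurable_sum => i; apply: measurable_funM => //.
exact: measurable_coord.
Qed.

Lemma measurable_enorm : measurable_fun setT (@enorm R d).
Proof.
rewrite /enorm; apply: measurableT_comp => //.
  by apply: continuous_measurable_fun => x; exact: sqrt_continuous.
by apply: measurable_sum => i; apply: measurable_funM; exact: measurable_coord.
Qed.

Lemma measurable_mulmx A : measurable_fun setT (fun x => A *m x).
Proof.
apply: measurable_fun_cV => i; under eq_fun do rewrite mxE.
apply: measurable_sum => j; apply: measurable_funM => //.
exact: measurable_coord.
Qed.

Lemma measurable_addr z : measurable_fun setT (fun x => x + z).
Proof.
apply: measurable_fun_cV => i; under eq_fun do rewrite mxE.
by apply: measurable_funD => //; exact: measurable_coord.
Qed.

Lemma measurable_sphere : measurable (sphere R d).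
Proof.
rewrite (_ : sphere R d = setT `&` enorm @^-1` [set 1]); last by rewrite setTI.
exact: measurable_enorm.
Qed.

Lemma measurable_set0v : measurable [set 0 : 'cV[R]_d].
Proof.
rewrite (_ : [set 0] = setT `&` enorm @^-1` [set 0]).
  exact: measurable_enorm.
rewrite setTI; apply/seteqP; split => x /=; first by move=> ->; exact: enorm0.
by move/eqP; rewrite enorm_eq0 => /eqP.
Qed.

End borel_vectors.

(** * Uniqueness of characteristic functions *)

Section trigonometric_class.
Context {R : realType} {d : nat}.
Local Notation V := 'cV[R]_d.

(* This closure is an algebra by the product formula for cosines, and contains
   the indicators of open boxes, hence of all Borel sets. *)
Inductive trig_class : (V -> R) -> Prop :=
| trig_cos z t : trig_class (fun x => cos (dotv z x + t))
| trig_add f g : trig_class f -> trig_class g -> trig_class (fun x => f x + g x)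
| trig_scale c f : trig_class f -> trig_class (fun x => c * f x)
| trig_lim (F : nat -> V -> R) f M : (forall n, trig_class (F n)) ->
    (forall n x, `|F n x| <= M) -> (forall x, F n x @[n --> \oo] --> f x) ->
    trig_class f.

Lemma trig_class_bounded f : trig_class f -> exists M, forall x, `|f x| <= M.
Proof.
elim=> [z t|{}f g _ [M fM] _ [N gN]|c {}f _ [M fM]|F {}f M _ _ FM Ff].
- by exists 1 => x; rewrite ler_norml cos_geN1 cos_le1.
- by exists (M + N) => x; rewrite (le_trans (ler_normD _ _))// lerD.
- by exists (`|c| * M) => x; rewrite normrM ler_wpM2l.
- exists M => x; rewrite -(cvg_lim _ (cvg_norm (Ff x)))//.
  apply: limr_le; first exact: cvgP (cvg_norm (Ff x)).
  by apply: nearW => n; exact: FM.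
Qed.

Lemma trig_class_measurable f : trig_class f -> measurable_fun setT f.
Proof.
elim=> [z t|{}f g _ mf _ mg|c {}f _ mf|F {}f M _ mF _ Ff].
- apply: (@measurableT_comp _ _ _ _ _ _ cos).
    by apply: continuous_measurable_fun; exact: continuous_cos.
  by apply: measurable_funD => //; exact: measurable_dotv.
- exact: measurable_funD.
- exact: measurable_funM.
- by apply: (measurable_fun_cvg mF) => x _; exact: Ff.
Qed.

Lemma trig_cst c : trig_class (fun=> c).
Proof.
rewrite (_ : (fun=> c) = fun x => c * cos (dotv 0 x + 0)).
  exact/trig_scale/trig_cos.
by apply/funext => x; rewrite dotv0l addr0 cos0 mulr1.
Qed.

Lemma trig_opp f : trig_class f -> trig_class (fun x => - f x).
Proof.
move=> hf; rewrite (_ : (fun x => - f x) = fun x => -1 * f x).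
  exact: trig_scale.
by apply/funext => x; rewrite mulN1r.
Qed.

Lemma trig_mul f g : trig_class f -> trig_class g ->
  trig_class (fun x => f x * g x).
Proof.
move=> hf hg; elim: hf => [z t|{}f f' _ hf _ hf'|c {}f _ hf|F {}f M _ hF FM Ff].
- elim: hg => [w s|{}g g' _ hg _ hg'|c {}g _ hg|G {}g M _ hG GM Gg].
  + rewrite (_ : (fun x => _ * _) = fun x =>
      2^-1 * (cos (dotv (z + w) x + (t + s)) + cos (dotv (z - w) x + (t - s)))).
      by apply/trig_scale/trig_add; exact: trig_cos.
    apply/funext => x; rewrite dotvDl dotvBl.
    rewrite (_ : _ + _ + (t + s) = (dotv z x + t) + (dotv w x + s)); last by ring.
    rewrite (_ : _ - _ + (t - s) = (dotv z x + t) - (dotv w x + s)); last by ring.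
    by rewrite (cosD (_ + t) (_ + s)) (cosB (_ + t) (_ + s)); field.
  + under eq_fun do rewrite mulrDr; exact: trig_add.
  + under eq_fun do rewrite mulrCA; exact: trig_scale.
  + apply: (@trig_lim (fun n x => cos (dotv z x + t) * G n x) _ M) => //.
      move=> n x; rewrite normrM -[leRHS]mul1r ler_pM//.
      by rewrite ler_norml cos_geN1 cos_le1.
    by move=> x; apply: cvgMr; exact: Gg.
- under eq_fun do rewrite mulrDl; exact: trig_add.
- under eq_fun do rewrite -mulrA; exact: trig_scale.
- have [N gN] := trig_class_bounded hg.
  apply: (@trig_lim (fun n x => F n x * g x) _ (M * N)) => //.
    by move=> n x; rewrite normrM ler_pM.
  by move=> x; apply: cvgMl; exact: Ff.
Qed.

Lemma trig_exp f n : trig_class f -> trig_class (fun x => f x ^+ n).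
Proof.
move=> hf; elim: n => [|n ih].
  by under eq_fun do rewrite expr0; exact: trig_cst.
by under eq_fun do rewrite exprS; exact: trig_mul.
Qed.

(* The smoothstep map fixes -1, 0 and 1, and attracts the rest of [-1, 1] to
   -1 and 1. *)
Definition smoothstep (y : R) : R := (3 * y - y ^+ 3) / 2.

Lemma smoothstepN y : smoothstep (- y) = - smoothstep y.
Proof. by rewrite /smoothstep; field. Qed.

Lemma iter_smoothstepN n y :
  iter n smoothstep (- y) = - iter n smoothstep y.
Proof. by elim: n => // n ih; rewrite !iterS ih smoothstepN. Qed.

Lemma iter_smoothstep_bound n y : 0 < y <= 1 ->
  [/\ y <= iter n smoothstep y <= 1 &
      1 - iter n smoothstep y <= (1 - y / 2) ^+ n].
Proof.
move=> /andP[y0 y1]; elim: n => [|n [/andP[ih1 ih2] ih3]].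
  by rewrite /= lexx y1 expr0 gerBl ltW.
rewrite iterS; set u := iter n smoothstep y in ih1 ih2 ih3 *.
have u0 : 0 < u by exact: lt_le_trans ih1.
have e : 1 - smoothstep u = (1 - u) * (1 - u / 2 - u ^+ 2 / 2).
  by rewrite /smoothstep; field.
have e2 : smoothstep u = u + u * (1 - u) * (1 + u) / 2.
  by rewrite /smoothstep; field.
have u1 : 0 <= 1 - u by rewrite subr_ge0.
split.
  apply/andP; split.
    rewrite e2 (le_trans ih1)// lerDl divr_ge0// !mulr_ge0//; first exact: ltW.
    by rewrite addr_ge0// ltW.
  rewrite -subr_ge0 e mulr_ge0//.
  have -> : 1 - u / 2 - u ^+ 2 / 2 = (1 - u) * (2 + u) / 2 by field.
  by rewrite divr_ge0// mulr_ge0// addr_ge0// ltW.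
rewrite e [leRHS]exprSr ler_pM//.
  have -> : 1 - u / 2 - u ^+ 2 / 2 = (1 - u) * (2 + u) / 2 by field.
  by rewrite divr_ge0// mulr_ge0// addr_ge0// ltW.
have : 0 <= u ^+ 2 by exact: sqr_ge0.
move: ih1; lra.
Qed.

Lemma cvg_iter_smoothstep y : `|y| <= 1 ->
  iter n smoothstep y @[n --> \oo] --> Num.sg y.
Proof.
have pos x : 0 < x <= 1 -> iter n smoothstep x @[n --> \oo] --> (1 : R).
  move=> x01; have /andP[x0 x1] := x01.
  apply: (@squeeze_cvgr _ _ _ _ (fun n => 1 - (1 - x / 2) ^+ n) (fun=> 1)).
  - apply: nearW => n; have [/andP[_ ->] h] := iter_smoothstep_bound n x01.
    by rewrite andbT; move: h; set a := iter _ _ _; set b := _ ^+ _; lra.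
  - rewrite -[X in _ --> X]subr0; apply: cvgB; first exact: cvg_cst.
    by apply: cvg_expr; rewrite ger0_norm; lra.
  - exact: cvg_cst.
move=> y1; have [y0|y0|->] := ltrgt0P y.
- by rewrite gtr0_sg//; apply: pos; rewrite y0 (le_trans (ler_norm _)).
- rewrite ltr0_sg// -[y]opprK; under eq_cvg do rewrite iter_smoothstepN.
  apply: cvgN; apply: pos; rewrite oppr_gt0 y0/=.
  by rewrite (le_trans _ y1)// -normrN ler_norm.
- rewrite sgr0 (_ : (fun n => _) = fun=> 0); first exact: cvg_cst.
  apply/funext => n; elim: n => // n ih.
  by rewrite iterS ih /smoothstep; field.
Qed.

Lemma iter_smoothstep_le1 n y : `|y| <= 1 -> `|iter n smoothstep y| <= 1.
Proof.
have pos x : 0 < x <= 1 -> `|iter n smoothstep x| <= 1.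
  move=> x01; have [/andP[h1 h2] _] := iter_smoothstep_bound n x01.
  by rewrite ger0_norm// (le_trans _ h1)//; case/andP: x01 => /ltW.
move=> y1; have [y0|y0|->] := ltrgt0P y.
- by apply: pos; rewrite y0 (le_trans (ler_norm _)).
- rewrite -normrN -iter_smoothstepN; apply: pos; rewrite oppr_gt0 y0/=.
  by rewrite (le_trans _ y1)// -normrN ler_norm.
- rewrite (_ : iter n _ _ = 0) ?normr0//.
  by elim: (n) => // m ih; rewrite iterS ih /smoothstep; field.
Qed.

Lemma trig_sin_gt0 z t : trig_class (fun x => (0 < sin (dotv z x + t))%R%:R).
Proof.
set s := fun x => sin (dotv z x + t).
have s1 x : `|s x| <= 1 by rewrite ler_norml sin_geN1 sin_le1.
have hs : trig_class s.
  rewrite (_ : s = fun x => cos (dotv z x + (t - pi / 2))); first exact: trig_cos.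
  by apply/funext => x; rewrite addrA cosBpihalf.
have hiter n : trig_class (fun x => iter n smoothstep (s x)).
  elim: n => // n ih.
  rewrite (_ : (fun x => _) = fun x => 2^-1 * (3 * iter n smoothstep (s x) +
      - iter n smoothstep (s x) ^+ 3)).
    apply/trig_scale/trig_add; first exact: trig_scale.
    exact/trig_opp/trig_exp.
  by apply/funext => x; rewrite iterS {1}/smoothstep mulrC.
have hsg : trig_class (fun x => Num.sg (s x)).
  apply: (@trig_lim (fun n x => iter n smoothstep (s x)) _ 1) => //.
    by move=> n x; exact: iter_smoothstep_le1.
  by move=> x; exact: cvg_iter_smoothstep.
apply: (@trig_lim (fun n x => (2^-1 * (1 + Num.sg (s x))) ^+ n) _ 1) => //.
- by move=> n; apply/trig_exp/trig_scale/trig_add => //; exact: trig_cst.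
- move=> n x; rewrite normrX exprn_ile1//.
  by case: sgrP => _; rewrite ger0_norm; lra.
- move=> x; rewrite -/(s x); case: sgrP => sx.
  + by apply: cvg_expr; rewrite ger0_norm; lra.
  + rewrite (_ : 2^-1 * (1 + 1) = 1 :> R); last by field.
    by under eq_cvg do rewrite expr1n; exact: cvg_cst.
  + by rewrite addrN mulr0; apply: cvg_expr; rewrite normr0.
Qed.

Lemma trig_coord_gt i (a : R) : trig_class (fun x => (a < x i 0)%R%:R).
Proof.
pose e : V := \col_j (j == i)%:R.
have eE x : dotv e x = x i 0.
  rewrite /dotv (bigD1 i)//= mxE eqxx mul1r big1 ?addr0// => j ji.
  by rewrite mxE (negbTE ji) mul0r.
apply: (@trig_lim (fun n x =>
  (0 < sin (dotv (n.+1%:R^-1 *: e) x + - a / n.+1%:R))%R%:R) _ 1).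
- by move=> n; exact: trig_sin_gt0.
- by move=> n x; case: (0 < _)%R; rewrite ?normr0 ?normr1.
move=> x; apply: cvg_near_cst.
set b := x i 0 - a; have bE n : dotv (n.+1%:R^-1 *: e) x + - a / n.+1%:R = b / n.+1%:R.
  by rewrite dotvZl eE /b mulrC -mulrDl.
have /cvgrPdist_lt/(_ _ (@pi_gt0 R)) : b / n.+1%:R @[n --> \oo] --> 0.
  rewrite -[X in _ --> X](mulr0 b); apply: cvgMr; exact: cvg_harmonic.
apply: filterS => n; rewrite sub0r normrN bE => /ltr_normlP[h1 h2].
rewrite -[(a < _)%R]subr_gt0 -/b; have [b0|b0|b0] := ltrgt0P b.
- by rewrite sin_gt0_pi// h2 divr_gt0.
- suff : sin (b / n.+1%:R) < 0 by move=> /ltW; rewrite leNgt => /negbTE ->.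
  rewrite -oppr_gt0 -sinN sin_gt0_pi// h1 oppr_gt0 andbT.
  by rewrite pmulr_llt0// invr_gt0.
- by rewrite b0 mul0r sin0 ltxx.
Qed.

Lemma trig_indic (E : set V) : measurable E -> trig_class \1_E.
Proof.
pose S := [set A : set V | trig_class \1_A].
have SS : sigma_algebra setT S.
  split => [|A|F] /=.
  - by rewrite /S/= indic0; exact: trig_cst.
  - rewrite /S/= => hA; rewrite (_ : \1_ _ = fun x => 1 + - \1_A x).
      by apply: trig_add; [exact: trig_cst|exact: trig_opp].
    apply/funext => x; rewrite !indicE setTD in_setC.
    by case: (x \in A); rewrite ?subrr ?subr0.
  - rewrite /S/= => hF.
    have hN n : trig_class (fun x => \prod_(k < n) (1 + - \1_(F k) x)).
      elim: n => [|n ih]; first by under eq_fun do rewrite big_ord0; exact: trig_cst.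
      under eq_fun do rewrite big_ord_recr/=; apply: trig_mul => //.
      by apply: trig_add; [exact: trig_cst|exact: trig_opp].
    have h01 n x : \prod_(k < n) (1 + - \1_(F k) x) = (~~ [exists k : 'I_n, x \in F k])%:R :> R.
      case: (boolP [exists _, _]) => /= [/existsP[k xk]|/existsPn h].
        by rewrite (bigD1 k)//= indicE xk subrr mul0r.
      by rewrite big1// => k _; rewrite indicE (negbTE (h k)) subr0.
    apply: (@trig_lim (fun n x => 1 + - \prod_(k < n) (1 + - \1_(F k) x)) _ 1).
    + by move=> n; apply: trig_add; [exact: trig_cst|exact/trig_opp].
    + move=> n x; rewrite h01; case: [exists _, _] => /=.
        by rewrite subr0 normr1.
      by rewrite subrr normr0.
    + move=> x; apply: cvg_near_cst; rewrite indicE.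
      have [[m _ Fm]|nF] := pselect ((\bigcup_i F i) x).
        rewrite mem_set; last by exists m.
        near=> n; rewrite h01.
        have mn : (m < n)%N by near: n; exact: nbhs_infty_gt.
        rewrite (_ : [exists _, _] = true) ?subr0//.
        by apply/existsP; exists (Ordinal mn); exact/mem_set.
      rewrite memNset//; apply: nearW => n; rewrite h01.
      rewrite (_ : [exists _, _] = false) ?subrr//.
      apply/negbTE/existsPn => k; apply/negP => /set_mem Fk.
      by apply: nF; exists k.
move=> mE.
have mid : measurable_fun setT (id : g_sigma_algebraType S -> 'cV[R]_d).
  apply: measurable_fun_cV => i.
  apply: (measurability _ (RGenOInfty.measurableE R)).
  move=> _ [_ [a ->] <-]; rewrite setTI; apply: sub_sigma_algebra.
  rewrite /S/= (_ : \1_ _ = fun x : V => (a < x i 0)%R%:R); first exact: trig_coord_gt.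
  apply/funext => x; rewrite indicE; congr (_%:R); congr nat_of_bool.
  by apply/idP/idP; rewrite inE/= in_itv/= andbT.
have := mid measurableT _ mE; rewrite setTI preimage_id.
by rewrite /measurable/= sigma_algebra_id.
Unshelve. all: by end_near. Qed.

End trigonometric_class.

Section real_integrals.
Context {disp} {T : measurableType disp} {R : realType}.
Variable m : {measure set T -> \bar R}.
Implicit Types (f g h : T -> R).
Local Notation integ f := (m.-integrable setT (EFin \o f)).

Lemma integ_measurable f : integ f -> measurable_fun setT f.
Proof. by move=> /measurable_int/measurable_EFinP. Qed.

Lemma integ_le f g : measurable_fun setT f -> (forall x, `|f x| <= g x) ->
  integ g -> integ f.
Proof.
move=> mf fg; apply: le_integrable => //; first exact/measurable_EFinP.
by move=> x _ /=; rewrite lee_fin (le_trans (fg x))// ler_norm.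
Qed.

Lemma integD f g : integ f -> integ g -> integ (fun x => f x + g x).
Proof. by move=> hf hg; exact: (integrableD measurableT hf hg). Qed.

Lemma integZ c f : integ f -> integ (fun x => c * f x).
Proof. by move=> hf; exact: (integrableZl measurableT c hf). Qed.

Lemma integM_bounded f g M : measurable_fun setT f -> (forall x, `|f x| <= M) ->
  integ g -> integ (fun x => f x * g x).
Proof.
move=> mf fM hg; apply: (@integ_le _ (fun x => M * `|g x|)).
- by apply: measurable_funM => //; exact: integ_measurable.
- by move=> x; rewrite normrM ler_wpM2r.
- by apply: integZ; exact: integrable_norm.
Qed.

Lemma cvg_Rintegral (F : nat -> T -> R) f g :
  (forall n, measurable_fun setT (F n)) ->
  (forall x, F n x @[n --> \oo] --> f x) -> integ g ->
  (forall n x, `|F n x| <= g x) ->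
  \int[m]_x F n x @[n --> \oo] --> \int[m]_x f x.
Proof.
move=> mF Ff hg Fg.
have mf : measurable_fun setT f by apply: (measurable_fun_cvg mF) => x _.
have fg x : `|f x| <= g x.
  rewrite -(cvg_lim _ (cvg_norm (Ff x)))//.
  apply: limr_le; first exact: cvgP (cvg_norm (Ff x)).
  by apply: nearW => n; exact: Fg.
have [|||||_ _ h] := @dominated_convergence _ T R m setT measurableT
  (fun n x => (F n x)%:E) (EFin \o f) (EFin \o g).
- by move=> n; exact/measurable_EFinP.
- exact/measurable_EFinP.
- by apply: aeW => x _; apply/fine_cvgP; split; [exact: nearW|exact: Ff].
- exact: hg.
- by apply: aeW => x n _; rewrite lee_fin.
apply: fine_cvg; rewrite fineK//.
by apply: integrable_fin_num => //; exact: integ_le hg.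
Qed.

Lemma integ_cst (c : R) : (m setT < +oo)%E -> integ (fun=> c).
Proof.
move=> mT; apply: measurable_bounded_integrable => //.
exact: bounded_cst.
Qed.

Lemma integ_indic E : measurable E -> (m E < +oo)%E -> integ \1_E.
Proof.
move=> mE Eoo; apply/integrableP; split; first exact/measurable_EFinP.
under eq_integral do rewrite /= ger0_norm//.
by rewrite integral_indic// setIT.
Qed.

Lemma Rintegral_indic E : measurable E -> \int[m]_x \1_E x = fine (m E).
Proof. by move=> mE; rewrite /Rintegral integral_indic// setIT. Qed.

End real_integrals.

Lemma measurable_cosR {R : realType} : measurable_fun setT (@cos R).
Proof. by apply: continuous_measurable_fun; exact: continuous_cos. Qed.

Lemma measurable_sinR {R : realType} : measurable_fun setT (@sin R).
Proof. by apply: continuous_measurable_fun; exact: continuous_sin. Qed.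

Section trig_class_integral.
Context {R : realType} {d : nat}.
Local Notation V := 'cV[R]_d.
Context {disp1 disp2} {T1 : measurableType disp1} {T2 : measurableType disp2}.
Variables (m1 : {measure set T1 -> \bar R}) (m2 : {measure set T2 -> \bar R}).
Variables (Y1 : T1 -> V) (Y2 : T2 -> V) (g1 : T1 -> R) (g2 : T2 -> R).
Hypotheses (mY1 : measurable_fun setT Y1) (mY2 : measurable_fun setT Y2).
Hypotheses (ig1 : m1.-integrable setT (EFin \o g1))
           (ig2 : m2.-integrable setT (EFin \o g2)).
Hypothesis eq_cos : forall z t,
  \int[m1]_x (cos (dotv z (Y1 x) + t) * g1 x) =
  \int[m2]_x (cos (dotv z (Y2 x) + t) * g2 x).

Lemma trig_class_integral f : trig_class f ->
  \int[m1]_x (f (Y1 x) * g1 x) = \int[m2]_x (f (Y2 x) * g2 x).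
Proof.
have int1 h : trig_class h -> m1.-integrable setT (EFin \o (fun x => h (Y1 x) * g1 x)).
  move=> hh; have [M hM] := trig_class_bounded hh.
  apply: (@integM_bounded _ _ _ _ (h \o Y1) _ M) => //=.
  by apply: measurableT_comp => //; exact: trig_class_measurable.
have int2 h : trig_class h -> m2.-integrable setT (EFin \o (fun x => h (Y2 x) * g2 x)).
  move=> hh; have [M hM] := trig_class_bounded hh.
  apply: (@integM_bounded _ _ _ _ (h \o Y2) _ M) => //=.
  by apply: measurableT_comp => //; exact: trig_class_measurable.
elim=> [z t|{}f h hf ihf hh ihh|c {}f hf ihf|F {}f M hF ihF FM Ff].
- exact: eq_cos.
- under eq_Rintegral do rewrite mulrDl.
  under [RHS]eq_Rintegral do rewrite mulrDl.
  by rewrite !RintegralD//; [rewrite ihf ihh|exact: int2..|exact: int1|exact: int1].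
- under eq_Rintegral do rewrite -mulrA.
  under [RHS]eq_Rintegral do rewrite -mulrA.
  by rewrite !RintegralZl// ?ihf//; [exact: int2|exact: int1].
- have c1 : \int[m1]_x (F n (Y1 x) * g1 x) @[n --> \oo] --> \int[m1]_x (f (Y1 x) * g1 x).
    apply: (@cvg_Rintegral _ _ _ _ _ _ (fun x => M * `|g1 x|)).
    + by move=> n; exact/integ_measurable/int1.
    + by move=> x; apply: cvgMl; exact: Ff.
    + by apply: integZ; exact: integrable_norm.
    + by move=> n x; rewrite normrM ler_wpM2r.
  have c2 : \int[m2]_x (F n (Y2 x) * g2 x) @[n --> \oo] --> \int[m2]_x (f (Y2 x) * g2 x).
    apply: (@cvg_Rintegral _ _ _ _ _ _ (fun x => M * `|g2 x|)).
    + by move=> n; exact/integ_measurable/int2.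
    + by move=> x; apply: cvgMl; exact: Ff.
    + by apply: integZ; exact: integrable_norm.
    + by move=> n x; rewrite normrM ler_wpM2r.
  move: c1; rewrite (funext ihF) => c1.
  exact: cvg_unique c1 c2.
Qed.

End trig_class_integral.

Section fourier_uniqueness.
Context {R : realType} {d : nat}.
Local Notation V := 'cV[R]_d.
Context {disp1 disp2} {T1 : measurableType disp1} {T2 : measurableType disp2}.
Variables (m1 : {measure set T1 -> \bar R}) (m2 : {measure set T2 -> \bar R}).
Variables (Y1 : T1 -> V) (Y2 : T2 -> V).
Hypotheses (mY1 : measurable_fun setT Y1) (mY2 : measurable_fun setT Y2).

Lemma fourier_unique : (m1 setT < +oo)%E -> (m2 setT < +oo)%E ->
  (forall z, \int[m1]_x cos (dotv z (Y1 x)) = \int[m2]_x cos (dotv z (Y2 x))) ->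
  (forall z, \int[m1]_x sin (dotv z (Y1 x)) = \int[m2]_x sin (dotv z (Y2 x))) ->
  forall E, measurable E -> m1 (Y1 @^-1` E) = m2 (Y2 @^-1` E).
Proof.
move=> m1T m2T hc hs E mE.
have i1 (c : R) : m1.-integrable setT (EFin \o (fun=> c)) by exact: integ_cst.
have i2 (c : R) : m2.-integrable setT (EFin \o (fun=> c)) by exact: integ_cst.
have ib1 (f : V -> R) : measurable_fun setT f -> (forall x, `|f x| <= 1) ->
    m1.-integrable setT (EFin \o (fun x => f (Y1 x))).
  by move=> mf f1; exact: (@integ_le _ _ _ _ (f \o Y1) (fun=> 1) (measurableT_comp mf mY1) (fun x => f1 _) (i1 1)).
have ib2 (f : V -> R) : measurable_fun setT f -> (forall x, `|f x| <= 1) ->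
    m2.-integrable setT (EFin \o (fun x => f (Y2 x))).
  by move=> mf f1; exact: (@integ_le _ _ _ _ (f \o Y2) (fun=> 1) (measurableT_comp mf mY2) (fun x => f1 _) (i2 1)).
have mcos z : measurable_fun setT (fun x : V => cos (dotv z x)).
  exact: (measurableT_comp measurable_cosR (measurable_dotv z)).
have msin z : measurable_fun setT (fun x : V => sin (dotv z x)).
  exact: (measurableT_comp measurable_sinR (measurable_dotv z)).
have cos1 (y : R) : `|cos y| <= 1 by rewrite ler_norml cos_geN1 cos_le1.
have sin1 (y : R) : `|sin y| <= 1 by rewrite ler_norml sin_geN1 sin_le1.
have ic1 z : m1.-integrable setT (EFin \o (fun x => cos (dotv z (Y1 x)))).
  exact: (ib1 _ (mcos z) (fun=> cos1 _)).
have ic2 z : m2.-integrable setT (EFin \o (fun x => cos (dotv z (Y2 x)))).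
  exact: (ib2 _ (mcos z) (fun=> cos1 _)).
have is1 z : m1.-integrable setT (EFin \o (fun x => sin (dotv z (Y1 x)))).
  exact: (ib1 _ (msin z) (fun=> sin1 _)).
have is2 z : m2.-integrable setT (EFin \o (fun x => sin (dotv z (Y2 x)))).
  exact: (ib2 _ (msin z) (fun=> sin1 _)).
have h z t : \int[m1]_x (cos (dotv z (Y1 x) + t) * 1) =
             \int[m2]_x (cos (dotv z (Y2 x) + t) * 1).
  under eq_Rintegral do rewrite mulr1 cosD mulrC (mulrC (sin _)).
  under [RHS]eq_Rintegral do rewrite mulr1 cosD mulrC (mulrC (sin _)).
  rewrite !RintegralB// ?RintegralZl// ?hc ?hs//.
  all: try apply: integZ.
  all: try (first [exact: ic1|exact: is1|exact: ic2|exact: is2]).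
have := trig_class_integral mY1 mY2 (i1 1) (i2 1) h (trig_indic mE).
under eq_Rintegral do rewrite mulr1.
under [RHS]eq_Rintegral do rewrite mulr1.
have mE1 : measurable (Y1 @^-1` E) by rewrite -[X in measurable X]setTI; exact: mY1.
have mE2 : measurable (Y2 @^-1` E) by rewrite -[X in measurable X]setTI; exact: mY2.
have -> : (fun x => \1_E (Y1 x)) = \1_(Y1 @^-1` E) :> (T1 -> R) by [].
have -> : (fun x => \1_E (Y2 x)) = \1_(Y2 @^-1` E) :> (T2 -> R) by [].
rewrite !Rintegral_indic// => h1.
have f1 : m1 (Y1 @^-1` E) \is a fin_num.
  by rewrite ge0_fin_numE// (le_lt_trans _ m1T)// le_measure ?inE.
have f2 : m2 (Y2 @^-1` E) \is a fin_num.
  by rewrite ge0_fin_numE// (le_lt_trans _ m2T)// le_measure ?inE.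
by rewrite -(fineK f1) -(fineK f2) h1.
Qed.
End fourier_uniqueness.

(** * Uniqueness of the Lévy measure *)

Section levy_uniqueness.
Context {R : realType} {d : nat}.
Local Notation V := 'cV[R]_d.
Context {disp} {T : measurableType disp}.
Variables (nu : {measure set V -> \bar R}) (m : {measure set T -> \bar R}).
Variables (Y : T -> V) (c : R).
Hypothesis mY : measurable_fun setT Y.
Hypothesis inu : forall w,
  nu.-integrable setT (EFin \o (fun x => 1 - cos (dotv w x))).
Hypothesis im : forall w,
  m.-integrable setT (EFin \o (fun x => 1 - cos (dotv w (Y x)))).
Hypothesis eq_cos : forall z w,
  c * \int[nu]_x (cos (dotv z x) * (1 - cos (dotv w x))) =
  \int[m]_x (cos (dotv z (Y x)) * (1 - cos (dotv w (Y x)))).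
Hypothesis eq_sin : forall z w,
  c * \int[nu]_x (sin (dotv z x) * (1 - cos (dotv w x))) =
  \int[m]_x (sin (dotv z (Y x)) * (1 - cos (dotv w (Y x)))).

Let mcos z : measurable_fun setT (fun x : V => cos (dotv z x)).
Proof. exact: (measurableT_comp measurable_cosR (measurable_dotv z)). Qed.
Let msin z : measurable_fun setT (fun x : V => sin (dotv z x)).
Proof. exact: (measurableT_comp measurable_sinR (measurable_dotv z)). Qed.
Let cos1 (y : R) : `|cos y| <= 1. Proof. by rewrite ler_norml cos_geN1 cos_le1. Qed.
Let sin1 (y : R) : `|sin y| <= 1. Proof. by rewrite ler_norml sin_geN1 sin_le1. Qed.

Let h w (x : V) : R := 2^-1 * (1 - cos (dotv w x)).

Let h01 w x : 0 <= h w x <= 1.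
Proof. by have := cos_geN1 (dotv w x); have := cos_le1 (dotv w x); rewrite /h; lra. Qed.

Let mh w : measurable_fun setT (h w).
Proof. by apply: measurable_funM => //; apply: measurable_funB. Qed.

Let eq_trig w f : trig_class f ->
  \int[nu]_x (f x * (c * h w x)) = \int[m]_x (f (Y x) * h w (Y x)).
Proof.
move=> hf; apply: (@trig_class_integral _ _ _ _ _ _ nu m id Y) hf => //.
- by do 2 apply: integZ.
- exact: integZ.
move=> z t.
have e1 (y : V) : cos (dotv z y + t) * (c * h w y) =
    (c * 2^-1 * cos t) * (cos (dotv z y) * (1 - cos (dotv w y))) -
    (c * 2^-1 * sin t) * (sin (dotv z y) * (1 - cos (dotv w y))).
  by rewrite cosD /h; ring.
have e2 (y : V) : cos (dotv z y + t) * h w y =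
    (2^-1 * cos t) * (cos (dotv z y) * (1 - cos (dotv w y))) -
    (2^-1 * sin t) * (sin (dotv z y) * (1 - cos (dotv w y))).
  by rewrite cosD /h; ring.
have ic1 : nu.-integrable setT (EFin \o (fun x => cos (dotv z x) * (1 - cos (dotv w x)))).
  exact: (@integM_bounded _ _ _ _ _ _ 1).
have is1 : nu.-integrable setT (EFin \o (fun x => sin (dotv z x) * (1 - cos (dotv w x)))).
  exact: (@integM_bounded _ _ _ _ _ _ 1).
have ic2 : m.-integrable setT (EFin \o (fun x => cos (dotv z (Y x)) * (1 - cos (dotv w (Y x))))).
  apply: (@integM_bounded _ _ _ _ (fun x => cos (dotv z (Y x))) _ 1) => //.
  exact: (measurableT_comp (mcos z) mY).
have is2 : m.-integrable setT (EFin \o (fun x => sin (dotv z (Y x)) * (1 - cos (dotv w (Y x))))).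
  apply: (@integM_bounded _ _ _ _ (fun x => sin (dotv z (Y x))) _ 1) => //.
  exact: (measurableT_comp (msin z) mY).
under eq_Rintegral do rewrite e1.
under [RHS]eq_Rintegral do rewrite e2.
rewrite !RintegralB//; try exact: integZ.
by rewrite !RintegralZl// -eq_cos -eq_sin; ring.
Qed.

Let D w (j : nat) := [set x : V | j.+1%:R^-1 < h w x].

Let mD w j : measurable (D w j).
Proof.
rewrite (_ : D w j = setT `&` h w @^-1` `]j.+1%:R^-1, +oo[).
  exact: mh.
by rewrite setTI; apply/seteqP; split => x /=; rewrite in_itv/= andbT.
Qed.

Let D_finite w j : (nu (D w j) < +oo)%E /\ (m (Y @^-1` D w j) < +oo)%E.
Proof.
have b (x : V) : `|\1_(D w j) x| <= j.+1%:R * h w x.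
  rewrite indicE; have [/set_mem/= hx|_] := boolP (x \in D w j); last first.
    by rewrite normr0 mulr_ge0//; case/andP: (h01 w x).
  by rewrite normr1 mulrC -ler_pdivrMr// mul1r ltW.
split.
  have : nu.-integrable setT (EFin \o \1_(D w j)).
    apply: (integ_le _ b) => //.
    by do 2 apply: integZ.
  by move=> /(integrable_lty measurableT); rewrite /= integral_indic// setIT.
have mYD : measurable (Y @^-1` D w j).
  by rewrite -[X in measurable X]setTI; exact: mY.
have : m.-integrable setT (EFin \o \1_(Y @^-1` D w j)).
  apply: (@integ_le _ _ _ _ _ (fun x => j.+1%:R * h w (Y x))) => //.
  - by move=> x; exact: (b (Y x)).
  - by do 2 apply: integZ.
by move=> /(integrable_lty measurableT); rewrite /= integral_indic// setIT.
Qed.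

Let eq_D w j E : measurable E -> E `<=` D w j -> (c%:E * nu E = m (Y @^-1` E))%E.
Proof.
move=> mE ED.
have mYE : measurable (Y @^-1` E) by rewrite -[X in measurable X]setTI; exact: mY.
have [nuD mYD] := D_finite w j.
have th : trig_class (h w).
  apply/trig_scale/trig_add; first exact: trig_cst.
  apply: trig_opp; rewrite (_ : (fun x => _) = fun x => cos (dotv w x + 0)).
    exact: trig_cos.
  by apply/funext => x; rewrite addr0.
have tf : trig_class (fun x => \1_E x / h w x).
  apply: (@trig_lim _ _ (fun n x => \1_E x * \sum_(k < n) (1 + - h w x) ^+ k) _ j.+1%:R).
  - move=> n; apply: trig_mul; first exact: trig_indic.
    elim: n => [|n ih]; first by under eq_fun do rewrite big_ord0; exact: trig_cst.
    under eq_fun do rewrite big_ord_recr/=; apply: trig_add => //.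
    by apply/trig_exp/trig_add; [exact: trig_cst|exact: trig_opp].
  - move=> n x; rewrite indicE; have [/set_mem/ED/= hx|_] := boolP (x \in E); last first.
      by rewrite mul0r normr0.
    have hx0 : 0 < h w x by exact: lt_trans hx.
    have /andP[_ hx1] := h01 w x.
    rewrite mul1r ger0_norm; last by apply: sumr_ge0 => i _; rewrite exprn_ge0// subr_ge0.
    rewrite -(ler_pM2l hx0).
    have -> : h w x * \sum_(k < n) (1 - h w x) ^+ k = 1 - (1 - h w x) ^+ n.
      have := subrXX 1 (1 - h w x) n; rewrite expr1n => ->.
      congr (_ * _); first by ring.
      by apply: eq_bigr => i _; rewrite expr1n mul1r.
    rewrite (@le_trans _ _ 1)//; first by rewrite gerBl exprn_ge0// subr_ge0.
    by rewrite -ler_pdivrMr// mul1r ltW.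
  - move=> x; rewrite indicE; have [/set_mem/ED/= hx|_] := boolP (x \in E); last first.
      by under eq_cvg do rewrite mul0r; rewrite mul0r; exact: cvg_cst.
    have hx0 : 0 < h w x by exact: lt_trans hx.
    have /andP[_ hx1] := h01 w x.
    under eq_cvg do rewrite mul1r.
    rewrite mul1r (_ : (h w x)^-1 = 1 / (1 - (1 - h w x))); last first.
      by rewrite mul1r; congr (_^-1); ring.
    have := @cvg_geometric_series R 1 (1 - h w x).
    rewrite ger0_norm ?subr_ge0// gtrBl => /(_ hx0).
    apply: cvg_trans; apply: near_eq_cvg; apply: nearW => n.
    by rewrite /series/= big_mkord; apply: eq_bigr => i _; rewrite /geometric/= mul1r.
have := eq_trig w tf.
have cancel x : \1_E x / h w x * h w x = \1_E x :> R.
  rewrite indicE; have [/set_mem/ED/= hx|_] := boolP (x \in E); last by rewrite !mul0r.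
  by rewrite divfK// gt_eqF// (lt_trans _ hx).
under eq_Rintegral do rewrite mulrCA cancel.
under [RHS]eq_Rintegral do rewrite cancel.
have nuE : (nu E < +oo)%E by rewrite (le_lt_trans _ nuD)// le_measure ?inE//.
have mYE' : (m (Y @^-1` E) < +oo)%E.
  rewrite (le_lt_trans _ mYD)// le_measure ?inE//; last by move=> x; exact: ED.
  by rewrite -[X in measurable X]setTI; exact: mY.
rewrite RintegralZl//; last first.
  exact: integ_indic.
rewrite (_ : (fun x => \1_E (Y x)) = \1_(Y @^-1` E))//.
rewrite !Rintegral_indic// => e.
by rewrite -[RHS]fineK ?ge0_fin_numE// -e EFinM fineK// ge0_fin_numE.
Qed.

Lemma levy_unique (E : set V) : measurable E -> ~ E 0 ->
  (c%:E * nu E = m (Y @^-1` E))%E.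
Proof.
move=> mE E0.
pose e (i : 'I_d) : V := \col_j (j == i)%:R.
have eE i x : dotv (e i) x = x i 0.
  rewrite /dotv (bigD1 i)//= mxE eqxx mul1r big1 ?addr0// => j ji.
  by rewrite mxE (negbTE ji) mul0r.
pose B n : set V := if @unpickle ('I_d * nat * nat)%type n is Some (i, k, j)
  then E `&` D (k.+1%:R^-1 *: e i) j else set0.
have mB n : measurable (B n).
  by rewrite /B; case: unpickle => [[[i k] j]|]//; exact: measurableI.
have EB : E = \bigcup_n B n.
  apply/seteqP; split => [x Ex|x [n _]]; last first.
    by rewrite /B; case: unpickle => [[[i k] j]|]// [].
  have [i xi] : exists i, x i 0 != 0.
    apply: contrapT => /forallNP h0; apply: E0; rewrite (_ : 0 = x)//.
    by apply/colP => i; rewrite mxE; apply/esym/eqP; have := h0 i; case: eqP.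
  have xk : x i 0 / n.+1%:R @[n --> \oo] --> 0.
    by rewrite -[X in _ --> X](mulr0 (x i 0)); apply: cvgMr; exact: cvg_harmonic.
  have [k _ /(_ k (leqnn k)) hk] := (cvgrPdist_lt _ _).1 xk _ (@pi_gt0 R).
  have hpos : 0 < h (k.+1%:R^-1 *: e i) x.
    rewrite /h mulr_gt0// subr_gt0 dotvZl eE mulrC.
    move: hk; rewrite /= sub0r normrN; set y := _ / _ => hk.
    have y0 : 0 < `|y| by rewrite normr_gt0 mulf_neq0// invr_eq0.
    rewrite -[ltLHS](_ : cos `|y| = _); last by case: ger0P => _; rewrite ?cosN.
    by rewrite -[ltRHS]cos0 ltr_cos// in_itv/= ?lexx ?pi_ge0// !ltW.
  have [j hj] : exists j : nat, j.+1%:R^-1 < h (k.+1%:R^-1 *: e i) x.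
    have [j _ /(_ j (leqnn _)) ?] := near_infty_natSinv_lt (PosNum hpos).
    by exists j.
  by exists (pickle (i, k, j)) => //; rewrite /B pickleK; split.
rewrite EB seqDU_bigcup_eq preimage_bigcup.
have mS n : measurable (seqDU B n).
  by apply: measurableD => //; exact: bigsetU_measurable.
rewrite !measure_bigcup//=.
- rewrite -nneseriesZl//.
  have eqn (n : nat) : (c%:E * nu (seqDU B n) = m (Y @^-1` seqDU B n))%E.
    have : seqDU B n `<=` B n by exact: subDsetl.
    have := mS n; rewrite /B; set F := seqDU _ n => mF.
    case: unpickle => [[[i k] j] hF|].
      by apply: (@eq_D (k.+1%:R^-1 *: e i) j) => // x /hF[].
    by rewrite subset0 => ->; rewrite preimage_set0 !measure0 mule0.
  apply: congr_lim; apply/funext => n; apply: eq_bigr => i _; exact: eqn.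
- by move=> n _; rewrite -[X in measurable X]setTI; exact: mY.
- move=> i j _ _ [x [hi hj]].
  by apply: (@trivIset_seqDU _ B i j) => //; exists (Y x).
Qed.

End levy_uniqueness.

Section trigonometric_bounds.
Context {R : realType}.
Implicit Types y : R.

Lemma normr_sin_le y : `|sin y| <= `|y|.
Proof.
have pos (x : R) : 0 < x -> `|sin x| <= x.
  move=> x0; have [|c _] := @MVT R sin cos 0 x x0 (fun c _ => is_derive_sin c).
    exact: continuous_subspaceT (@continuous_sin R).
  rewrite sin0 !subr0 => ->; rewrite normrM (gtr0_norm x0) ler_piMl//; last first.
    by rewrite ler_norml cos_geN1 cos_le1.
  exact: ltW.
have [y0|y0|->] := ltrgt0P y; last by rewrite sin0 normr0.
- exact: pos.
- by rewrite -normrN -sinN; apply: pos; rewrite oppr_gt0.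
Qed.

Lemma subr_cos_ge0 y : 0 <= 1 - cos y.
Proof. by rewrite subr_ge0 cos_le1. Qed.

Lemma subr_cos_le2 y : 1 - cos y <= 2.
Proof. by have := cos_geN1 y; lra. Qed.

Lemma subr_cos_le_sqr y : 1 - cos y <= y ^+ 2 / 2.
Proof.
have -> : cos y = cos (y / 2 + y / 2) by congr cos; field.
rewrite cosD -!expr2; have := cos2Dsin2 (y / 2) => h.
have := normr_sin_le (y / 2).
rewrite -(ler_pXn2r (_ : 0 < 2)%N) ?nnegrE// !real_normK ?num_real//.
rewrite (_ : (y / 2) ^+ 2 = y ^+ 2 / 4); last by field.
have : 0 <= y ^+ 2 by exact: sqr_ge0.
move: h; set c := cos _; set s := sin _; lra.
Qed.

Lemma sinB_le_sqr y : `|sin y - y| <= y ^+ 2.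
Proof.
have pos (x : R) : 0 < x -> `|sin x - x| <= x ^+ 2.
  move=> x0; have d (c : R) : is_derive c 1 (fun t => sin t - t) (cos c - 1).
    by apply: is_deriveB.
  have [|c] := @MVT R (fun t => sin t - t) (fun c => cos c - 1) 0 x x0 (fun c _ => d c).
    by apply: continuous_subspaceT => t; apply: cvgB => //; exact: continuous_sin.
  rewrite in_itv/= => /andP[c0 cx].
  rewrite sin0 !subr0 => ->; rewrite normrM (gtr0_norm x0) expr2 ler_pM2r// distrC.
  rewrite ger0_norm ?subr_cos_ge0//.
  have := subr_cos_le_sqr c; have := subr_cos_le2 c.
  have [c2|c2] := leP c 2; last by lra.
  have : c ^+ 2 <= 2 * c by rewrite expr2 ler_pM2r.
  lra.
have [y0|y0|->] := ltrgt0P y; last by rewrite sin0 subr0 normr0 expr0n.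
- exact: pos.
- rewrite -normrN -[leRHS]sqrrN (_ : - (sin y - y) = sin (- y) - - y).
    by apply: pos; rewrite oppr_gt0.
  by rewrite sinN opprB opprK addrC.
Qed.
End trigonometric_bounds.


Section levy_integrals.
Context {R : realType} {d : nat}.
Local Notation V := 'cV[R]_d.
Implicit Types (x z w : V).

Definition levy_weight x : R := Num.min 1 (enorm x ^+ 2).

Lemma levy_weight_ge0 x : 0 <= levy_weight x.
Proof. by rewrite le_min ler01 sqr_ge0. Qed.

Lemma measurable_levy_weight : measurable_fun setT levy_weight.
Proof.
apply: measurable_minr => //; apply: measurable_funX; exact: measurable_enorm.
Qed.

Lemma sqr_dotv_le z x : dotv z x ^+ 2 <= enorm z ^+ 2 * enorm x ^+ 2.
Proof.
rewrite -exprMn -[leLHS]real_normK ?num_real//.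
by rewrite ler_pXn2r ?nnegrE ?mulr_ge0 ?enorm_ge0// CauchySchwarz_dotv.
Qed.

Lemma levy_weightP x : (enorm x <= 1 /\ levy_weight x = enorm x ^+ 2) \/
  (1 < enorm x /\ levy_weight x = 1).
Proof.
have [x1|x1] := leP (enorm x) 1; [left|right]; split=> //; rewrite /levy_weight.
  by rewrite min_r// exprn_ile1// enorm_ge0.
by rewrite min_l// exprn_ege1// ltW.
Qed.

Lemma subr_cos_le_levy_weight w x :
  1 - cos (dotv w x) <= (2 + enorm w ^+ 2) * levy_weight x.
Proof.
have := subr_cos_le_sqr (dotv w x); have := subr_cos_le2 (dotv w x).
have := sqr_dotv_le w x; have := sqr_ge0 (enorm w); have := sqr_ge0 (enorm x).
have := sqr_ge0 (dotv w x).
have [[x1 ->]|[x1 ->]] := levy_weightP x; last by lra.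
set a := dotv w x ^+ 2; set b := enorm x ^+ 2; set c := enorm w ^+ 2.
by lra.
Qed.

Definition sin_compensated z x : R :=
  sin (dotv z x) - dotv z x * (enorm x <= 1)%R%:R.

Lemma sin_compensated_le z x :
  `|sin_compensated z x| <= (1 + enorm z ^+ 2) * levy_weight x.
Proof.
rewrite /sin_compensated.
have [[x1 ->]|[x1 ->]] := levy_weightP x.
  rewrite x1/= mulr1 (le_trans (sinB_le_sqr _))// (le_trans (sqr_dotv_le _ _))//.
  by rewrite ler_wpM2r ?sqr_ge0// lerDr.
rewrite (leNgt (enorm x)) x1/= mulr0 subr0 mulr1 (@le_trans _ _ 1)//.
  by rewrite ler_norml sin_geN1 sin_le1.
by rewrite lerDl sqr_ge0.
Qed.

Lemma measurable_cos_dotv z : measurable_fun setT (fun x : V => cos (dotv z x)).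
Proof. exact: (measurableT_comp measurable_cosR (measurable_dotv z)). Qed.

Lemma measurable_sin_dotv z : measurable_fun setT (fun x : V => sin (dotv z x)).
Proof. exact: (measurableT_comp measurable_sinR (measurable_dotv z)). Qed.

Lemma measurable_unit_ball : measurable_fun setT (fun x : V => (enorm x <= 1)%R%:R : R).
Proof.
rewrite (_ : (fun _ => _) = \1_[set x : V | enorm x <= 1]).
  apply: measurable_indic; rewrite (_ : mkset _ = setT `&` enorm @^-1` `]-oo, 1]).
    exact: measurable_enorm.
  by rewrite setTI; apply/seteqP; split => x /=; rewrite in_itv.
apply/funext => x; rewrite indicE; congr (nat_of_bool _)%:R.
by apply/idP/idP; rewrite inE.
Qed.

Variable nu : {measure set V -> \bar R}.
Hypothesis levy_nu : levy_measure nu.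

Lemma integ_levy_weight : nu.-integrable setT (EFin \o levy_weight).
Proof.
apply/integrableP; split; first by apply/measurable_EFinP; exact: measurable_levy_weight.
under eq_integral do rewrite /= ger0_norm ?levy_weight_ge0//.
exact: levy_nu.2.
Qed.

Lemma integ_subr_cos w : nu.-integrable setT (EFin \o (fun x => 1 - cos (dotv w x))).
Proof.
apply: (@integ_le _ _ _ _ _ (fun x => (2 + enorm w ^+ 2) * levy_weight x)).
- by apply: measurable_funB => //; exact: measurable_cos_dotv.
- by move=> x; rewrite ger0_norm ?subr_cos_ge0// subr_cos_le_levy_weight.
- exact/integZ/integ_levy_weight.
Qed.

Lemma measurable_sin_compensated z : measurable_fun setT (sin_compensated z).
Proof.
apply: measurable_funB; first exact: measurable_sin_dotv.
by apply: measurable_funM; [exact: measurable_dotv|exact: measurable_unit_ball].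
Qed.

Lemma integ_sin_compensated z : nu.-integrable setT (EFin \o sin_compensated z).
Proof.
apply: (@integ_le _ _ _ _ _ (fun x => (1 + enorm z ^+ 2) * levy_weight x)).
- exact: measurable_sin_compensated.
- exact: sin_compensated_le.
- exact/integZ/integ_levy_weight.
Qed.

Definition levy_re z : R := \int[nu]_x (cos (dotv z x) - 1).

Definition levy_im gamma z : R := dotv gamma z + \int[nu]_x sin_compensated z x.

Lemma levy_exponentE gamma z :
  levy_exponent gamma 0 nu z = Complex (levy_re z) (levy_im gamma z).
Proof.
rewrite /levy_exponent mul0mx dotv0r mulr0 /cintegral /levy_re /levy_im /sin_compensated.
apply/eqP; rewrite eq_complex /=; apply/andP; split; apply/eqP.
- rewrite !(mul0r, mulr0, subr0, oppr0, add0r); apply: eq_Rintegral => x _.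
  by rewrite !(mul0r, mul1r, subr0, add0r, mulr0, expR0).
- rewrite !(mul0r, mul1r, mulr0, subr0, oppr0, add0r); congr (_ + _).
  apply: eq_Rintegral => x _.
  by rewrite !(mul0r, mul1r, subr0, add0r, mulr0, expR0) addr0.
Qed.

Lemma levy_im0 gamma : levy_im gamma 0 = 0.
Proof.
rewrite /levy_im dotv0r add0r /sin_compensated.
under eq_Rintegral do rewrite dotv0l sin0 mul0r subrr.
by rewrite Rintegral_cst// mul0r.
Qed.

Lemma levy_re_diff z w :
  levy_re z - (levy_re (z + w) + levy_re (z - w)) / 2 =
  \int[nu]_x (cos (dotv z x) * (1 - cos (dotv w x))).
Proof.
have i v : nu.-integrable setT (EFin \o (fun x => cos (dotv v x) - 1)).
  rewrite (_ : (fun x => _) = fun x => -1 * (1 - cos (dotv v x))).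
    exact/integZ/integ_subr_cos.
  by apply/funext => x; ring.
rewrite /levy_re -RintegralD// -RintegralZr//; last exact: integD.
rewrite -RintegralB//; last first.
  rewrite (_ : (fun x => _) = fun x =>
    2^-1 * (cos (dotv (z + w) x) - 1 + (cos (dotv (z - w) x) - 1))).
    exact/integZ/integD.
  by apply/funext => x; rewrite mulrC.
apply: eq_Rintegral => x _.
by rewrite dotvDl dotvBl cosD cosB; field.
Qed.

Lemma levy_im_diff gamma z w :
  levy_im gamma z - (levy_im gamma (z + w) + levy_im gamma (z - w)) / 2 =
  \int[nu]_x (sin (dotv z x) * (1 - cos (dotv w x))).
Proof.
have -> : levy_im gamma z - (levy_im gamma (z + w) + levy_im gamma (z - w)) / 2 =
  \int[nu]_x sin_compensated z x -
  (\int[nu]_x sin_compensated (z + w) x + \int[nu]_x sin_compensated (z - w) x) / 2.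
  by rewrite /levy_im !(dotvC gamma) dotvDl dotvBl; field.
have i v := integ_sin_compensated v.
rewrite -RintegralD// -RintegralZr//; last exact: integD.
rewrite -RintegralB//; last first.
  rewrite (_ : (fun x => _) = fun x =>
    2^-1 * (sin_compensated (z + w) x + sin_compensated (z - w) x)).
    exact/integZ/integD.
  by apply/funext => x; rewrite mulrC.
apply: eq_Rintegral => x _.
by rewrite /sin_compensated dotvDl dotvBl sinD sinB; field.
Qed.

Lemma continuous_levy_im gamma z : continuous (fun t : R => levy_im gamma (t *: z)).
Proof.
rewrite (_ : (fun t : R => _) = (fun t : R => t * dotv gamma z +
    \int[nu]_x sin_compensated (t *: z) x)); last first.
  by apply/funext => t; rewrite /levy_im dotvZr.
move=> t; apply: cvgD; first by apply: cvgM; [exact: cvg_id|exact: cvg_cst].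
pose M := `|t| + 1.
apply: (@continuity_under_integral _ _ _ nu (fun (t : R) (x : V) => sin_compensated (t *: z) x)
  setT measurableT (t - 1) (t + 1) _ _
  (fun x => (1 + M ^+ 2 * enorm z ^+ 2) * levy_weight x)).
- by move=> s _; exact: integ_sin_compensated.
- apply: aeW => x _ s _; rewrite /sin_compensated.
  rewrite (_ : (fun s : R => _) = (fun s : R => sin (s * dotv z x) -
      s * dotv z x * (enorm x <= 1)%R%:R)); last first.
    by apply/funext => u; rewrite dotvZl.
  apply: cvgB.
    apply: continuous_comp; last exact: continuous_sin.
    by apply: cvgM; [exact: cvg_id|exact: cvg_cst].
  by do 2 (apply: cvgM; last exact: cvg_cst); exact: cvg_id.
- exact/integZ/integ_levy_weight.
- move=> s; rewrite /= in_itv/= => /andP[s1 s2]; apply: aeW => x _.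
  rewrite (le_trans (sin_compensated_le _ _))// ler_wpM2r ?levy_weight_ge0//.
  rewrite lerD2l enormZ exprMn ler_wpM2r ?sqr_ge0//.
  rewrite -normrX ger0_norm ?sqr_ge0// -(real_normK (num_real s)).
  rewrite ler_pXn2r ?nnegrE ?addr_ge0// ler_norml; apply/andP.
  have := ler_norm t; have := ler_norm (- t); rewrite normrN /M; split; lra.
- by rewrite inE/= in_itv/=; apply/andP; split; lra.
Qed.

End levy_integrals.

Section charfun.
Context {R : realType} {d : nat}.
Local Notation V := 'cV[R]_d.

Lemma charfunE (mu : {measure set V -> \bar R}) z :
  charfun mu z = Complex (\int[mu]_x cos (dotv z x)) (\int[mu]_x sin (dotv z x)).
Proof.
rewrite /charfun /cintegral.
congr Complex; apply: eq_Rintegral => x _ /=.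
  by rewrite !(mul0r, mul1r, subr0, add0r, mulr0, oppr0, expR0).
by rewrite !(mul0r, mul1r, subr0, add0r, mulr0, oppr0, expR0).
Qed.

Lemma levy_khintchine (mu nu : {measure set V -> \bar R}) gamma z :
  levy_triplet mu gamma 0 nu ->
  \int[mu]_x cos (dotv z x) = expR (levy_re nu z) * cos (levy_im nu gamma z) /\
  \int[mu]_x sin (dotv z x) = expR (levy_re nu z) * sin (levy_im nu gamma z).
Proof.
by move=> [_ _ _ /(_ z)]; rewrite charfunE levy_exponentE => -[-> ->].
Qed.
End charfun.

Section logarithm.
Context {R : realType}.

Lemma expR_polar_inj (a1 b1 a2 b2 : R) :
  expR a1 * cos b1 = expR a2 * cos b2 -> expR a1 * sin b1 = expR a2 * sin b2 ->
  a1 = a2 /\ cos (b1 - b2) = 1.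
Proof.
move=> hc hs.
have e : expR a1 ^+ 2 = expR a2 ^+ 2.
  rewrite -[LHS]mulr1 -[RHS]mulr1 -{1}(cos2Dsin2 b1) -(cos2Dsin2 b2).
  by rewrite !mulrDr -!exprMn hc hs.
have {}e : expR a1 = expR a2.
  by apply/eqP; rewrite -(@eqrXn2 _ 2)// ?expR_ge0//; exact/eqP.
have a12 : a1 = a2 by exact: expR_inj.
split => //; rewrite cosB.
have e0 : expR a2 != 0 by rewrite gt_eqF// expR_gt0.
move: hc hs; rewrite e => /(mulfI e0) -> /(mulfI e0) ->.
by rewrite -!expr2 cos2Dsin2.
Qed.

Lemma cos1_continuous_eq0 (f : R -> R) : continuous f -> f 0 = 0 ->
  (forall t, cos (f t) = 1) -> f 1 = 0.
Proof.
move=> cf f0 f1.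
have pos (g : R -> R) : continuous g -> g 0 = 0 -> (forall t, cos (g t) = 1) ->
    ~ 0 < g 1.
  move=> cg g0 g1 g10.
  have m0 : 0 < Num.min (g 1) pi by rewrite lt_min g10 pi_gt0.
  have [||c _ gc] := @IVT R g 0 1 (Num.min (g 1) pi) ler01.
  - exact: continuous_subspaceT.
  - by rewrite g0 (min_l (ltW g10)) (max_r (ltW g10)) (ltW m0) ge_min lexx.
  have := g1 c; rewrite gc -[RHS]cos0; apply/eqP; rewrite lt_eqF//.
  rewrite ltr_cos// in_itv/= ?lexx ?pi_ge0//.
  by rewrite ltW// ge_min lexx orbT.
have [f10|f10|//] := ltrgt0P (f 1); first by case: (pos f).
case: (pos (fun t => - f t)); rewrite ?f0 ?oppr0 ?oppr_gt0//.
  by move=> t; apply: cvgN; exact: cf.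
by move=> t; rewrite cosN.
Qed.

End logarithm.

Section image_measures.
Context {R : realType} {disp1 disp2 disp3} {T1 : measurableType disp1}
  {T2 : measurableType disp2} {V : measurableType disp3}.
Variables (m1 : {measure set T1 -> \bar R}) (m2 : {measure set T2 -> \bar R}).
Variables (Y1 : T1 -> V) (Y2 : T2 -> V).
Hypotheses (mY1 : measurable_fun setT Y1) (mY2 : measurable_fun setT Y2).
Hypothesis eqY : forall E : set V, measurable E -> m1 (Y1 @^-1` E) = m2 (Y2 @^-1` E).

Lemma eq_dist_Rintegral (f : V -> R) : measurable_fun setT f ->
  m1.-integrable setT (EFin \o (fun x => f (Y1 x))) ->
  m2.-integrable setT (EFin \o (fun x => f (Y2 x))) ->
  \int[m1]_x f (Y1 x) = \int[m2]_x f (Y2 x).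
Proof.
move=> mf i1 i2; rewrite /Rintegral; congr fine.
have mf' : measurable_fun setT (EFin \o f) by exact/measurable_EFinP.
have e1 := integral_pushforward mY1 mf' i1 measurableT.
have e2 := integral_pushforward mY2 mf' i2 measurableT.
rewrite !preimage_setT in e1 e2.
rewrite -[LHS]e1 -[RHS]e2; apply: eq_measure_integral => E mE _; exact: eqY.
Qed.

End image_measures.

Section symmetries_levy_measure.
Context {R : realType} {d : nat}.
Local Notation V := 'cV[R]_d.

Lemma convolution_dirac (mu : {measure set V -> \bar R}) (v : V) E :
  measurable E -> convolution mu \d_v E = mu ((fun y => y + v) @^-1` E).
Proof.
move=> mE; rewrite /convolution /pushforward /product_measure1/=.
have mEv : measurable ((fun y : V => y + v) @^-1` E).
  by rewrite -[X in measurable X]setTI; exact: measurable_addr.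
have := integral_indic mu measurableT mEv; rewrite setIT => <-.
apply: eq_integral => y _ /=; rewrite diracE indicE; congr (nat_of_bool _)%:R%:E.
by rewrite /xsection; apply/idP/idP; rewrite !inE/= inE.
Qed.

Lemma charfun_integrable {disp} {T : measurableType disp} (m : {measure set T -> \bar R})
  (Y : T -> V) z : (m setT < +oo)%E -> measurable_fun setT Y ->
  m.-integrable setT (EFin \o (fun x => cos (dotv z (Y x)))) /\
  m.-integrable setT (EFin \o (fun x => sin (dotv z (Y x)))).
Proof.
move=> mT mY; split.
- apply: (@integ_le _ _ _ _ _ (fun=> 1)).
  + exact: (measurableT_comp (measurable_cos_dotv z) mY).
  + by move=> x; rewrite ler_norml cos_geN1 cos_le1.
  + exact: integ_cst.
- apply: (@integ_le _ _ _ _ _ (fun=> 1)).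
  + exact: (measurableT_comp (measurable_sin_dotv z) mY).
  + by move=> x; rewrite ler_norml sin_geN1 sin_le1.
  + exact: integ_cst.
Qed.

Variables (nu : {measure set V -> \bar R}) (gamma : V).
Hypothesis levy_nu : levy_measure nu.

Lemma levy_scaling (A : 'M[R]_d) (b : V) (c : R) : A \in unitmx ->
  (forall z, expR (c * levy_re nu z) * cos (c * levy_im nu gamma z) =
     expR (levy_re nu (A^T *m z)) * cos (levy_im nu gamma (A^T *m z) + dotv b z)) ->
  (forall z, expR (c * levy_re nu z) * sin (c * levy_im nu gamma z) =
     expR (levy_re nu (A^T *m z)) * sin (levy_im nu gamma (A^T *m z) + dotv b z)) ->
  forall E, measurable E -> (c%:E * nu E = nu ((fun x => (A *m x)%R) @^-1` E))%E.
Proof.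
move=> uA hc hs.
have re_eq z : c * levy_re nu z = levy_re nu (A^T *m z).
  by have [] := expR_polar_inj (hc z) (hs z).
have im_eq z : c * levy_im nu gamma z = levy_im nu gamma (A^T *m z) + dotv b z.
  apply/eqP; rewrite -subr_eq0; apply/eqP.
  have := @cos1_continuous_eq0 R (fun t => c * levy_im nu gamma (t *: z) -
    (levy_im nu gamma (t *: (A^T *m z)) + t * dotv b z)).
  rewrite !scale1r mul1r; apply.
  - move=> t; apply: cvgB.
      by apply: cvgM; [exact: cvg_cst|exact: continuous_levy_im].
    apply: cvgD; first exact: continuous_levy_im.
    by apply: cvgM; [exact: cvg_id|exact: cvg_cst].
  - by rewrite !scale0r !levy_im0// mul0r mulr0 addr0 subr0.
  - move=> t; have [_] := expR_polar_inj (hc (t *: z)) (hs (t *: z)).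
    by rewrite -scalemxAr dotvZr.
have tr z x : dotv z (A *m x) = dotv (A^T *m z) x by exact: dotv_mulmx.
have E0 (E : set V) : measurable E -> ~ E 0 ->
    (c%:E * nu E = nu ((fun x => (A *m x)%R) @^-1` E))%E.
  have mA : measurable_fun setT (fun x : V => A *m x) by exact: measurable_mulmx.
  have i1 w : nu.-integrable setT (EFin \o (fun x => 1 - cos (dotv w x))).
    exact: integ_subr_cos.
  have i2 w : nu.-integrable setT (EFin \o (fun x => 1 - cos (dotv w (A *m x)))).
    by under eq_fun do rewrite tr; exact: integ_subr_cos.
  move=> mE nE0; apply: (levy_unique mA i1 i2) => // z w.
  - under [RHS]eq_Rintegral do rewrite !tr.
    rewrite -!levy_re_diff// -mulmxDr -mulmxBr -!re_eq; by field.
  - under [RHS]eq_Rintegral do rewrite !tr.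
    rewrite -!(levy_im_diff levy_nu gamma) -mulmxDr -mulmxBr.
    have := im_eq z; have := im_eq (z + w); have := im_eq (z - w).
    rewrite (dotvDr b z w) (dotvC b (z - w)) dotvBl !(dotvC _ b); lra.
move=> E mE; have m0 := @measurable_set0v R d.
have nuD (F : set V) : measurable F -> nu F = nu (F `\` [set 0]).
  move=> mF; rewrite -{1}(setUIDK F [set 0]) measureU//; last first.
  - by apply/seteqP; split => x // [[_ ?] [_ ?]].
  - exact: measurableD.
  - exact: measurableI.
  rewrite [X in (X + _)%E](_ : _ = 0%E) ?add0e//.
  by apply: subset_measure0 levy_nu.1 => //; exact: measurableI.
have mAE : measurable ((fun x => A *m x) @^-1` E).
  by rewrite -[X in measurable X]setTI; exact: measurable_mulmx.
rewrite (nuD _ mE) (nuD _ mAE) E0; last first.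
- by move=> [_ /(_ erefl)].
- exact: measurableD.
congr (nu _); apply/seteqP; split => x /= [Ex x0]; split => //.
- by move=> xE; apply: x0; rewrite xE mulmx0.
- by move=> Ax0; apply: x0; rewrite -(mulKmx uA x) Ax0 mulmx0.
Qed.

End symmetries_levy_measure.

(** * Convolution powers of the law *)

Section independent_pairs.
Context {R : realType} {d : nat}.
Local Notation V := 'cV[R]_d.
Context {disp} {Omega : measurableType disp} (P : probability Omega R).

Lemma indep_integral (Y1 Y2 : {RV P >-> V}) (f g : V -> R) :
  (forall E1 E2 : set V, measurable E1 -> measurable E2 ->
     (P (Y1 @^-1` E1 `&` Y2 @^-1` E2) = P (Y1 @^-1` E1) * P (Y2 @^-1` E2))%E) ->
  measurable_fun setT f -> measurable_fun setT g ->
  (forall x, `|f x| <= 1) -> (forall x, `|g x| <= 1) ->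
  \int[P]_w (f (Y1 w) * g (Y2 w)) = \int[P]_w f (Y1 w) * \int[P]_w g (Y2 w).
Proof.
move=> ind mf mg f1 g1.
have mY1 : measurable_fun setT Y1 by exact: measurable_funPT.
have mY2 : measurable_fun setT Y2 by exact: measurable_funPT.
pose m1 := distribution P Y1; pose m2 := distribution P Y2.
have PT : (P setT < +oo)%E by rewrite probability_setT ltry.
have m1T : (distribution P Y1 setT < +oo)%E by rewrite probability_setT ltry.
have m2T : (distribution P Y2 setT < +oo)%E by rewrite probability_setT ltry.
pose Z w := (Y1 w, Y2 w).
have mZ : measurable_fun setT Z by exact: measurable_fun_pair.
have m12 E : measurable E -> (m1 \x m2)%E E = P (Z @^-1` E).
  pose Zm : {mfun Omega >-> (V * V)%type} :=
    MeasurableFun.Pack (MeasurableFun.Class (isMeasurableFun.Build _ _ _ _ Z mZ)).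
  move=> mE; have := @product_measure_unique _ _ _ _ _ m1 m2 (distribution P Zm).
  by apply => // A B mA mB; rewrite [RHS](esym (ind _ _ mA mB)).
have mfg : measurable_fun setT (fun z : V * V => f z.1 * g z.2).
  apply: measurable_funM.
    exact: (measurableT_comp mf measurable_fst).
  exact: (measurableT_comp mg measurable_snd).
have fg1 (x y : V) : `|f x * g y| <= 1.
  by rewrite normrM mulr_ile1.
have i1 : (m1 \x m2)%E.-integrable setT (EFin \o (fun z : V * V => f z.1 * g z.2)).
  have mT : ((m1 \x m2)%E setT < +oo)%E.
    by rewrite m12// preimage_setT probability_setT ltry.
  by apply: (@integ_le _ _ _ _ _ (fun=> 1)) => //; exact: integ_cst mT.
have i2 : P.-integrable setT (EFin \o (fun w => f (Y1 w) * g (Y2 w))).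
  apply: (@integ_le _ _ _ _ _ (fun=> 1)) => //.
    exact: (measurableT_comp mfg mZ).
  exact: integ_cst PT.
have ig : m2.-integrable setT (EFin \o g).
  by apply: (@integ_le _ _ _ _ _ (fun=> 1)) => //; exact: integ_cst m2T.
have if_ : m1.-integrable setT (EFin \o f).
  by apply: (@integ_le _ _ _ _ _ (fun=> 1)) => //; exact: integ_cst m1T.
have := @eq_dist_Rintegral _ _ _ _ _ _ _ (m1 \x m2)%E P id Z
  (@measurable_id _ _ setT) mZ m12 _ mfg i1 i2.
move=> <-.
have -> : \int[P]_w f (Y1 w) = \int[m1]_x f x.
  rewrite /Rintegral; congr fine; apply/esym; apply: integral_distribution => //.
    exact/measurable_EFinP.
  apply: (@integ_le _ _ _ _ _ (fun=> 1)) => //.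
    exact: (measurableT_comp mf mY1).
  exact: integ_cst PT.
have -> : \int[P]_w g (Y2 w) = \int[m2]_x g x.
  rewrite /Rintegral; congr fine; apply/esym; apply: integral_distribution => //.
    exact/measurable_EFinP.
  apply: (@integ_le _ _ _ _ _ (fun=> 1)) => //.
    exact: (measurableT_comp mg mY2).
  exact: integ_cst PT.
rewrite -RintegralZr// {1}/Rintegral -(integral12_prod_meas1 i1).
congr fine; apply: eq_integral => x _.
rewrite /fubini_F/= -RintegralZl// /Rintegral fineK//.
by apply: integrable_fin_num => //; exact: integZ.
Qed.
End independent_pairs.

Section levy_process_law.
Context {R : realType} {d : nat}.
Local Notation V := 'cV[R]_d.
Context {disp} {Omega : measurableType disp} (P : probability Omega R).
Variable X : R -> {RV P >-> V}.
Hypothesis levyX : levy_process X.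

Let incr_fun s t w := X t w - X s w.

Let mincr s t : measurable_fun setT (incr_fun s t).
Proof.
have mX u i : measurable_fun setT (fun w => X u w i 0).
  exact: (measurableT_comp (measurable_coord i 0) (measurable_funPT (X u))).
apply: measurable_fun_cV => i; under eq_fun do rewrite !mxE.
exact: measurable_funB.
Qed.

Let incr s t : {RV P >-> V} :=
  MeasurableFun.Pack (MeasurableFun.Class (isMeasurableFun.Build _ _ _ _ _ (mincr s t))).

Let PT : (P setT < +oo)%E. Proof. by rewrite probability_setT ltry. Qed.

Let bounded_integ (Y : {RV P >-> V}) (f : V -> R) : measurable_fun setT f ->
  (forall x, `|f x| <= 1) -> P.-integrable setT (EFin \o (fun w => f (Y w))).
Proof.
move=> mf f1; apply: (@integ_le _ _ _ _ _ (fun=> 1)) => //.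
  exact: (measurableT_comp mf (measurable_funPT Y)).
exact: integ_cst PT.
Qed.

Let incr0 (f : V -> R) t : measurable_fun setT f ->
  \int[P]_w f (incr 0 t w) = \int[P]_w f (X t w).
Proof.
move=> mf; rewrite /Rintegral; congr fine; apply: ae_eq_integral => //.
- apply/measurable_EFinP.
  exact: (measurableT_comp mf (measurable_funPT (incr 0 t))).
- apply/measurable_EFinP.
  exact: (measurableT_comp mf (measurable_funPT (X t))).
- have [h0 _ _ _ _] := levyX.
  by apply: filterS h0 => w Xw0 _; rewrite /= /incr_fun Xw0 subr0.
Qed.

Let incr_stationary (f : V -> R) s t : measurable_fun setT f ->
  (forall x, `|f x| <= 1) -> 0 <= s -> 0 <= t ->
  \int[P]_w f (incr s (s + t) w) = \int[P]_w f (incr 0 t w).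
Proof.
move=> mf f1 s0 t0; apply: eq_dist_Rintegral => //.
- by move=> E mE; have [_ _ + _ _] := levyX; apply.
- exact: (bounded_integ (incr s (s + t))).
- exact: (bounded_integ (incr 0 t)).
Qed.

Let incr_indep (s t : R) (E1 E2 : set V) : 0 < s -> s < t ->
  measurable E1 -> measurable E2 ->
  (P (incr 0 s @^-1` E1 `&` incr s t @^-1` E2) =
   P (incr 0 s @^-1` E1) * P (incr s t @^-1` E2))%E.
Proof.
move=> s0 st mE1 mE2; have [_ + _ _ _] := levyX.
pose u (k : nat) := if k == 0%N then 0 else if k == 1%N then s else t.
move=> /(_ 2%N u (lexx _)) => ind.
have hu k : (k < 2)%N -> u k < u k.+1 by case: k => [|[|]].
have hE (i : 'I_2) : measurable (if i == ord0 then E1 else E2) by case: ifP.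
have {ind hE} := ind hu _ hE.
rewrite !big_ord_recl big_ord0 mulr1/=.
have -> : [set w | forall i : 'I_2, (if i == ord0 then E1 else E2) (X (u i.+1) w - X (u i) w)] =
    incr 0 s @^-1` E1 `&` incr s t @^-1` E2.
  apply/seteqP; split => w /=.
    by move=> h; split; [exact: (h ord0)|exact: (h (lift ord0 ord0))].
  by move=> [h1 h2] i; case: ifPn => [/eqP ->//|]; case: i => [[|[|]]].
rewrite -[X in _ = fine (P X) * _ -> _]/(incr 0 s @^-1` E1).
rewrite -[X in _ = _ * fine (P X) -> _]/(incr s t @^-1` E2).
have mY (Y : {RV P >-> V}) E : measurable E -> measurable (Y @^-1` E).
  by move=> mE; rewrite -[X in measurable X]setTI; exact: (measurable_funPT Y).
have m1 := mY (incr 0 s) _ mE1; have m2 := mY (incr s t) _ mE2.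
have f1 := fin_num_measure P _ m1; have f2 := fin_num_measure P _ m2.
have f3 := fin_num_measure P _ (measurableI _ _ m1 m2).
by move=> h; rewrite -(fineK f1) -(fineK f2) -(fineK f3) h EFinM.
Qed.

Lemma charfun_levy_process (re im : R) z :
  \int[P]_w cos (dotv z (X 1 w)) = expR re * cos im ->
  \int[P]_w sin (dotv z (X 1 w)) = expR re * sin im ->
  forall n : nat,
  \int[P]_w cos (dotv z (X n.+1%:R w)) = expR (n.+1%:R * re) * cos (n.+1%:R * im) /\
  \int[P]_w sin (dotv z (X n.+1%:R w)) = expR (n.+1%:R * re) * sin (n.+1%:R * im).
Proof.
move=> hc hs; elim=> [|n [ihc ihs]]; first by rewrite !mul1r.
pose f := fun x : V => cos (dotv z x); pose g := fun x : V => sin (dotv z x).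
have mf : measurable_fun setT f by exact: measurable_cos_dotv.
have mg : measurable_fun setT g by exact: measurable_sin_dotv.
have f1 x : `|f x| <= 1 by rewrite ler_norml cos_geN1 cos_le1.
have g1 x : `|g x| <= 1 by rewrite ler_norml sin_geN1 sin_le1.
have dec w : incr 0 n.+2%:R w = incr 0 n.+1%:R w + incr n.+1%:R n.+2%:R w.
  by rewrite /= /incr_fun [RHS]addrC addrA subrK.
have n12 : n.+1%:R < n.+2%:R :> R by rewrite ltr_nat.
have ind E1 E2 := @incr_indep n.+1%:R n.+2%:R E1 E2 (ltr0Sn _ _) n12.
have st (h : V -> R) : measurable_fun setT h -> (forall x, `|h x| <= 1) ->
    \int[P]_w h (incr n.+1%:R n.+2%:R w) = \int[P]_w h (X 1 w).
  move=> mh h1; rewrite -(incr0 1 mh) -(incr_stationary mh h1 (ler0n _ n.+1) ler01).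
  by rewrite natr1.
have prod (h k : V -> R) : measurable_fun setT h -> measurable_fun setT k ->
    (forall x, `|h x| <= 1) -> (forall x, `|k x| <= 1) ->
    \int[P]_w (h (incr 0 n.+1%:R w) * k (incr n.+1%:R n.+2%:R w)) =
    \int[P]_w h (X n.+1%:R w) * \int[P]_w k (X 1 w).
  move=> mh mk h1 k1.
  by rewrite -(st _ mk k1) -(incr0 n.+1%:R mh); exact: indep_integral.
have ip (h k : V -> R) : measurable_fun setT h -> measurable_fun setT k ->
    (forall x, `|h x| <= 1) -> (forall x, `|k x| <= 1) ->
    P.-integrable setT (EFin \o
      (fun w => h (incr 0 n.+1%:R w) * k (incr n.+1%:R n.+2%:R w))).
  move=> mh mk h1 k1; apply: (@integM_bounded _ _ _ _ (fun w => h (incr 0 n.+1%:R w)) _ 1) => //.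
    exact: (measurableT_comp mh (measurable_funPT (incr 0 n.+1%:R))).
  exact: (bounded_integ (incr n.+1%:R n.+2%:R)).
rewrite -(incr0 n.+2%:R mf) -(incr0 n.+2%:R mg) /f /g.
have -> : n.+2%:R * re = n.+1%:R * re + re by rewrite -[n.+2%:R]natr1 mulrDl mul1r.
have -> : n.+2%:R * im = n.+1%:R * im + im by rewrite -[n.+2%:R]natr1 mulrDl mul1r.
under eq_Rintegral do rewrite dec dotvDr cosD.
under [X in _ /\ X = _]eq_Rintegral do rewrite dec dotvDr sinD.
rewrite RintegralB//; [|exact: (ip f f)|exact: (ip g g)].
rewrite RintegralD//; [|exact: (ip g f)|exact: (ip f g)].
rewrite (prod f f)// (prod g g)// (prod g f)// (prod f g)// ihc ihs hc hs.
rewrite expRD cosD sinD; split; ring.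
Qed.
End levy_process_law.

(** * Symmetries and the Lévy exponent *)

Section symmetries.
Context {R : realType} {d : nat}.
Local Notation V := 'cV[R]_d.
Variables (mu nu : {measure set V -> \bar R}) (gamma : V).
Hypothesis muT : (mu setT < +oo)%E.
Hypothesis levy_mu : levy_triplet mu gamma 0 nu.
Local Notation re := (levy_re nu).
Local Notation im := (levy_im nu gamma).

Let levy_nu : levy_measure nu. Proof. by case: levy_mu. Qed.

Let muc z : \int[mu]_x cos (dotv z x) = expR (re z) * cos (im z).
Proof. by have [] := levy_khintchine z levy_mu. Qed.

Let mus z : \int[mu]_x sin (dotv z x) = expR (re z) * sin (im z).
Proof. by have [] := levy_khintchine z levy_mu. Qed.

Let measurable_affine (A : 'M[R]_d) (b : V) : measurable_fun setT (fun x : V => A *m x + b).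
Proof. exact: (measurableT_comp (measurable_addr b) (measurable_mulmx A)). Qed.

Lemma charfun_affine (A : 'M[R]_d) (b z : V) :
  \int[mu]_x cos (dotv z (A *m x + b)) =
    expR (re (A^T *m z)) * cos (im (A^T *m z) + dotv b z) /\
  \int[mu]_x sin (dotv z (A *m x + b)) =
    expR (re (A^T *m z)) * sin (im (A^T *m z) + dotv b z).
Proof.
have [ic is_] := @charfun_integrable R d _ V mu id (A^T *m z) muT (@measurable_id _ V setT).
have e x : dotv z (A *m x + b) = dotv (A^T *m z) x + dotv b z.
  by rewrite dotvDr dotv_mulmx (dotvC z b).
split.
- under eq_Rintegral do rewrite e cosD.
  rewrite RintegralB//; try by under eq_fun do rewrite mulrC; exact: integZ.
  by rewrite !RintegralZr// muc mus cosD; ring.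
- under eq_Rintegral do rewrite e sinD.
  rewrite RintegralD//; try by under eq_fun do rewrite mulrC; exact: integZ.
  by rewrite !RintegralZr// muc mus sinD; ring.
Qed.

Lemma levy_scaling_dist {disp} {T : measurableType disp}
    (m : {measure set T -> \bar R}) (Y : T -> V) (A : 'M[R]_d) (b : V) (c : R) :
  (m setT < +oo)%E -> measurable_fun setT Y -> A \in unitmx ->
  (forall z, \int[m]_x cos (dotv z (Y x)) = expR (c * re z) * cos (c * im z)) ->
  (forall z, \int[m]_x sin (dotv z (Y x)) = expR (c * re z) * sin (c * im z)) ->
  (forall E : set V, measurable E ->
     m (Y @^-1` E) = mu ((fun x => A *m x + b) @^-1` E)) ->
  forall E, measurable E -> (c%:E * nu E = nu ((fun x => (A *m x)%R) @^-1` E))%E.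
Proof.
move=> mT mY uA hc hs hE; apply: (levy_scaling levy_nu (b := b) (gamma := gamma) uA) => z.
- have [<- _] := charfun_affine A b z; rewrite -hc.
  apply: (eq_dist_Rintegral mY (measurable_affine A b) hE (measurable_cos_dotv z)).
    by have [] := charfun_integrable z mT mY.
  by have [] := charfun_integrable z muT (measurable_affine A b).
- have [_ <-] := charfun_affine A b z; rewrite -hs.
  apply: (eq_dist_Rintegral mY (measurable_affine A b) hE (measurable_sin_dotv z)).
    by have [] := charfun_integrable z mT mY.
  by have [] := charfun_integrable z muT (measurable_affine A b).
Qed.

Lemma symmetry_levy_measure A : symmetry_group mu A ->
  meas_eq (image_meas A nu) nu.
Proof.
move=> [uA [x hx]] E mE.
rewrite /image_meas /pushforward.
rewrite -(@levy_scaling_dist _ _ mu id A (- x) 1) ?mul1e//.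
- by move=> z; rewrite !mul1r muc.
- by move=> z; rewrite !mul1r mus.
move=> F mF.
have mF' : measurable ((fun y : V => y - x) @^-1` F).
  by rewrite -[X in measurable X]setTI; exact: measurable_addr.
have := hx _ mF'; rewrite convolution_dirac// /image_meas /pushforward.
rewrite preimage_id -comp_preimage => ->.
by congr (mu _); apply/seteqP; split => y /=; rewrite addrK.
Qed.

Lemma symmetry_of_exponent A b : A \in unitmx ->
  (forall z, re (A^T *m z) = re z) ->
  (forall z, im (A^T *m z) = im z + dotv b z) -> symmetry_group mu A.
Proof.
move=> uA hre him; split => //; exists b => E mE.
rewrite convolution_dirac// /image_meas /pushforward.
apply: fourier_unique => //.
- exact: measurable_mulmx.
- exact: measurable_addr.
- move=> z; have [h _] := charfun_affine A 0 z; have [h' _] := charfun_affine 1%:M b z.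
  move: h h'; rewrite trmx1 mul1mx dotv0l addr0 hre him => h h'.
  under eq_Rintegral do rewrite -[A *m _]addr0.
  by rewrite h -h'; apply: eq_Rintegral => x _; rewrite mul1mx.
- move=> z; have [_ h] := charfun_affine A 0 z; have [_ h'] := charfun_affine 1%:M b z.
  move: h h'; rewrite trmx1 mul1mx dotv0l addr0 hre him => h h'.
  under eq_Rintegral do rewrite -[A *m _]addr0.
  by rewrite h -h'; apply: eq_Rintegral => x _; rewrite mul1mx.
Qed.

Lemma levy_re_invariant A z : meas_eq (image_meas A nu) nu ->
  re (A^T *m z) = re z.
Proof.
move=> hnu; have tr x : dotv z (A *m x) = dotv (A^T *m z) x by exact: dotv_mulmx.
have i v : nu.-integrable setT (EFin \o (fun x => cos (dotv v x) - 1)).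
  rewrite (_ : (fun x => _) = fun x => -1 * (1 - cos (dotv v x))).
    exact/integZ/integ_subr_cos.
  by apply/funext => x; ring.
rewrite /levy_re; under eq_Rintegral do rewrite -tr.
apply: (@eq_dist_Rintegral _ _ _ _ _ _ _ nu nu (fun x => A *m x) id _ _ _
  (fun x => cos (dotv z x) - 1)) => //.
- exact: measurable_mulmx.
- by apply: measurable_funB => //; exact: measurable_cos_dotv.
- by under eq_fun do rewrite tr.
Qed.

Lemma levy_im_isometry A z : (forall x, enorm (A *m x) = enorm x) ->
  meas_eq (image_meas A nu) nu ->
  im (A^T *m z) = im z + dotv (A *m gamma - gamma) z.
Proof.
move=> iA hnu; have tr x : dotv z (A *m x) = dotv (A^T *m z) x by exact: dotv_mulmx.
have -> : im (A^T *m z) = dotv gamma (A^T *m z) + \int[nu]_x sin_compensated z x.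
  rewrite /levy_im; congr (_ + _).
  have e x : sin_compensated (A^T *m z) x = sin_compensated z (A *m x).
    by rewrite /sin_compensated tr iA.
  under eq_Rintegral do rewrite e.
  apply: (@eq_dist_Rintegral _ _ _ _ _ _ _ nu nu (fun x => A *m x) id) => //.
  + exact: measurable_mulmx.
  + exact: measurable_sin_compensated.
  + by under eq_fun do rewrite -e; exact: integ_sin_compensated.
  + exact: integ_sin_compensated.
by rewrite /levy_im dotvBl (dotvC (A *m _)) tr (dotvC gamma (A^T *m z)); ring.
Qed.

Lemma levy_im_symmetric z : meas_eq (image_meas (- 1%:M) nu) nu ->
  im z = dotv gamma z.
Proof.
move=> hnu; have iN (x : V) : enorm (- 1%:M *m x) = enorm x.
  by rewrite mulNmx mul1mx -scaleN1r enormZ normrN1 mul1r.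
have := levy_im_isometry z iN hnu.
have -> : (- 1%:M)^T *m z = - z by rewrite linearN/= trmx1 mulNmx mul1mx.
have -> : - 1%:M *m gamma = - gamma by rewrite mulNmx mul1mx.
have o x : sin_compensated (- z) x = -1 * sin_compensated z x.
  by rewrite /sin_compensated dotvNl sinN; ring.
rewrite /levy_im; under eq_Rintegral do rewrite o.
rewrite RintegralZl//; last exact: integ_sin_compensated.
rewrite dotvBl dotvNl (dotvC _ (- z)) dotvNl (dotvC z); lra.
Qed.

Lemma symmetry_of_isometry A : A \in unitmx -> (forall x, enorm (A *m x) = enorm x) ->
  meas_eq (image_meas A nu) nu -> symmetry_group mu A.
Proof.
move=> uA iA hnu; apply: (@symmetry_of_exponent _ (A *m gamma - gamma)) => // z.
- exact: levy_re_invariant.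
- exact: levy_im_isometry.
Qed.

End symmetries.

Section bounded_symmetries.
Context {R : realType}.
Local Notation V := 'cV[R]_2.
Variable nu : {measure set V -> \bar R}.
Hypothesis levy_nu : levy_measure nu.
Hypothesis nondeg : forall a : V, a != 0 -> nu [set x | dotv a x != 0] <> 0%E.

Lemma dotv2 (x y : V) : dotv x y = x 0 0 * y 0 0 + x 1 0 * y 1 0.
Proof.
rewrite /dotv !big_ord_recl big_ord0 addr0 (_ : lift ord0 ord0 = 1)//.
exact/val_inj.
Qed.

Let wt (x : V) : R := levy_weight x / enorm x ^+ 2.

Let wt0 x : 0 <= wt x.
Proof. by rewrite divr_ge0 ?levy_weight_ge0 ?sqr_ge0. Qed.

Let mwt : measurable_fun setT wt.
Proof.
apply: measurable_funM; first exact: measurable_levy_weight.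
rewrite (_ : (fun x : V => _) = (fun x => (enorm x `^ (-1)) ^+ 2)); last first.
  by apply/funext => x; rewrite powR_inv1 ?enorm_ge0// exprVn.
apply: measurable_funX.
exact: (measurableT_comp (measurable_powR (-1)) measurable_enorm).
Qed.

Let wt_dotv (w x : V) : dotv w x ^+ 2 * wt x <= enorm w ^+ 2 * levy_weight x.
Proof.
have [->|x0] := eqVneq x 0.
  by rewrite dotv0r expr0n mul0r mulr_ge0 ?sqr_ge0 ?levy_weight_ge0.
have x2 : 0 < enorm x ^+ 2 by rewrite exprn_gt0// enorm_gt0.
rewrite /wt mulrA ler_pdivrMr// [leRHS]mulrAC ler_wpM2r ?levy_weight_ge0//.
exact: sqr_dotv_le.
Qed.

Let form w := fun x : V => dotv w x ^+ 2 * wt x.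

Let form0 w x : 0 <= form w x.
Proof. by rewrite mulr_ge0 ?sqr_ge0. Qed.

Let mform w : measurable_fun setT (form w).
Proof. by apply: measurable_funM => //; apply: measurable_funX; exact: measurable_dotv. Qed.

Let iform w : nu.-integrable setT (EFin \o form w).
Proof.
apply: (@integ_le _ _ _ _ _ (fun x => enorm w ^+ 2 * levy_weight x)) => //.
  by move=> x; rewrite ger0_norm//; exact: wt_dotv.
exact/integZ/integ_levy_weight.
Qed.

Let Q w := \int[nu]_x form w x.

Let Q_gt0 w : w != 0 -> 0 < Q w.
Proof.
move=> w0; rewrite lt_neqAle eq_sym andbC Rintegral_ge0//=.
apply/eqP => Q0; apply: (nondeg w0).
have ei : (\int[nu]_x `|(form w x)%:E| = 0)%E.
  under eq_integral do rewrite gee0_abs ?lee_fin//.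
  rewrite -[LHS]fineK; first by have := Q0; rewrite /Q /Rintegral => ->.
  exact: (integrable_fin_num measurableT (iform w)).
have [N [mN N0 hN]] := (ae_eq_integral_abs nu measurableT
  ((measurable_EFinP _ _).2 (mform w))).1 ei.
apply: subset_measure0 N0 => //.
  rewrite (_ : mkset _ = setT `&` dotv w @^-1` [set~ 0]).
    by apply: measurable_dotv => //; exact: measurableC.
  by rewrite setTI; apply/seteqP; split => x /= /eqP.
move=> x /= wx; apply: hN => /= /(_ I) [] /eqP; rewrite mulf_eq0 sqrf_eq0 (negbTE wx)/=.
have x0 : x != 0 by apply: contra_neq wx => ->; rewrite dotv0r.
have x2 : 0 < enorm x ^+ 2 by rewrite exprn_gt0// enorm_gt0.
by rewrite /wt mulf_eq0 invr_eq0 (gt_eqF x2) orbF gt_eqF// lt_min ltr01.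
Qed.

Let Q_lower : exists2 q, 0 < q & forall w : V, enorm w = 1 -> q <= Q w.
Proof.
pose e (s t : R) : V := \col_i (if i == 0 then s else t).
have e0 s t : e s t 0 0 = s by rewrite mxE.
have e1 s t : e s t 1 0 = t by rewrite mxE.
pose a := Q (e 1 0); pose c := Q (e 0 1); pose b := (Q (e 1 1) - a - c) / 2.
have QE w : Q w = w 0 0 ^+ 2 * a + 2 * w 0 0 * w 1 0 * b + w 1 0 ^+ 2 * c.
  set s := w 0 0; set t := w 1 0.
  have -> : Q w = (s ^+ 2 - s * t) * a + (t ^+ 2 - s * t) * c + s * t * Q (e 1 1).
    rewrite /a /c /Q -!RintegralZl// -!RintegralD//; try exact: integZ.
      2: by apply: integD; exact: integZ.
    apply: eq_Rintegral => x _; rewrite /form !dotv2 !e0 !e1 /s /t; ring.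
  by rewrite /b; field.
have a0 : 0 < a.
  by apply: Q_gt0; apply/eqP => /colP/(_ 0); rewrite e0 mxE => /eqP; rewrite oner_eq0.
have c0 : 0 < c.
  by apply: Q_gt0; apply/eqP => /colP/(_ 1); rewrite e1 mxE => /eqP; rewrite oner_eq0.
have det0 : 0 < a * c - b ^+ 2.
  have : 0 < Q (e (- b) a).
    by apply: Q_gt0; apply/eqP => /colP/(_ 1); rewrite e1 mxE => /eqP; rewrite gt_eqF.
  rewrite QE e0 e1.
  have -> : (- b) ^+ 2 * a + 2 * - b * a * b + a ^+ 2 * c = a * (a * c - b ^+ 2) by ring.
  by rewrite pmulr_rgt0.
exists ((a * c - b ^+ 2) / (a + c)); first by rewrite divr_gt0// addr_gt0.
move=> w w1; rewrite ler_pdivrMr ?addr_gt0//.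
have : enorm w ^+ 2 = 1 by rewrite w1 expr1n.
rewrite sqr_enorm dotv2 QE; set s := w 0 0; set t := w 1 0 => st.
rewrite -subr_ge0.
have -> : (s ^+ 2 * a + 2 * s * t * b + t ^+ 2 * c) * (a + c) - (a * c - b ^+ 2) =
  (a * s + b * t) ^+ 2 + (b * s + c * t) ^+ 2 +
  (a * c - b ^+ 2) * (s * s + t * t - 1) by ring.
by rewrite st subrr mulr0 addr0 addr_ge0// sqr_ge0.
Qed.

Let trunc (y : R) : R := Num.min 1 (y ^+ 2).

Let trunc0 y : 0 <= trunc y. Proof. by rewrite le_min ler01 sqr_ge0. Qed.

Let mtrunc_dotv w : measurable_fun setT (fun x : V => trunc (dotv w x)).
Proof. by apply: measurable_minr => //; apply: measurable_funX; exact: measurable_dotv. Qed.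

Let le_trunc (y z : R) : y ^+ 2 <= z ^+ 2 -> trunc y <= trunc z.
Proof. by move=> yz; rewrite /trunc le_min ge_min lexx/= ge_min yz orbT. Qed.

Let trunc_weight (w x : V) : trunc (dotv w x) <= (1 + enorm w ^+ 2) * levy_weight x.
Proof.
have := sqr_dotv_le w x; have := sqr_ge0 (enorm w); have := sqr_ge0 (enorm x).
rewrite /trunc.
have [[x1 ->]|[x1 ->]] := levy_weightP x => h1 h2 h3.
  by rewrite ge_min; apply/orP; right; rewrite mulrDl mul1r; apply: (le_trans h3); lra.
by rewrite ge_min mulr1; apply/orP; left; lra.
Qed.

Let itrunc w : nu.-integrable setT (EFin \o (fun x => trunc (dotv w x))).
Proof.
apply: (@integ_le _ _ _ _ _ (fun x => (1 + enorm w ^+ 2) * levy_weight x)) => //.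
  by move=> x; rewrite ger0_norm// trunc_weight.
exact/integZ/integ_levy_weight.
Qed.

Let K w := \int[nu]_x trunc (dotv w x).

Let K_lower w : enorm w = 1 -> Q w <= K w.
Proof.
move=> w1; apply: le_Rintegral => // x _; rewrite /trunc le_min; apply/andP; split.
  by rewrite (le_trans (wt_dotv _ _))// w1 expr1n mul1r /levy_weight ge_min lexx.
rewrite /form ler_piMr ?sqr_ge0//.
have [->|x0] := eqVneq x 0; first by rewrite /wt enorm0 expr0n invr0 mulr0.
have x2 : 0 < enorm x ^+ 2 by rewrite exprn_gt0// enorm_gt0.
by rewrite /wt ler_pdivrMr// mul1r /levy_weight ge_min lexx orbT.
Qed.

Lemma bounded_symmetries : exists2 rho : R, 0 < rho & forall A : 'M[R]_2,
  meas_eq (image_meas A nu) nu ->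
  forall w : V, enorm w <= rho -> enorm (A^T *m w) <= 1.
Proof.
have [q q0 hq] := Q_lower.
have K1 w : 1 < enorm w -> q <= K w.
  move=> w1; have w0 : enorm w != 0 by rewrite gt_eqF// (lt_trans ltr01).
  have u1 : enorm ((enorm w)^-1 *: w) = 1.
    by rewrite enormZ ger0_norm ?invr_ge0 ?enorm_ge0// mulVf.
  apply: le_trans (hq _ u1) _; apply: le_trans (K_lower u1) _.
  apply: le_Rintegral => // x _; apply: le_trunc.
  rewrite dotvZl exprMn ler_piMl ?sqr_ge0// exprVn invf_le1 ?exprn_gt0//.
    by rewrite exprn_ege1// ltW.
  exact: lt_trans w1.
have [n hn] : exists n : nat, \int[nu]_x trunc (enorm x / n.+1%:R) < q.
  have : \int[nu]_x trunc (enorm x / n.+1%:R) @[n --> \oo] --> \int[nu]_(x in setT) (0 : R).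
    apply: (@cvg_Rintegral _ _ _ _ _ _ levy_weight) => //.
    + move=> n; apply: measurable_minr => //; apply: measurable_funX.
      by apply: measurable_funM => //; exact: measurable_enorm.
    + move=> x; apply: (@squeeze_cvgr _ _ _ _ (fun=> 0) (fun n => (enorm x / n.+1%:R) ^+ 2)).
      * by apply: nearW => n; rewrite trunc0 /trunc ge_min lexx orbT.
      * exact: cvg_cst.
      * have h : enorm x / n.+1%:R @[n --> \oo] --> 0.
          rewrite -[X in _ --> X](mulr0 (enorm x)); apply: cvgMr; exact: cvg_harmonic.
        by have := cvgM h h; rewrite mulr0; exact.
    + exact: integ_levy_weight.
    + move=> n x; rewrite ger0_norm// /trunc /levy_weight.
      rewrite le_min ge_min lexx/= ge_min; apply/orP; right.
      rewrite ler_pXn2r ?nnegrE ?divr_ge0 ?enorm_ge0// ler_pdivrMr//.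
      by rewrite ler_peMr ?enorm_ge0// ler1n.
  rewrite Rintegral_cst// mul0r => /cvgrPdist_lt/(_ _ q0)[n _ /(_ n (leqnn n))].
  rewrite /= sub0r normrN => h; exists n; exact: le_lt_trans (ler_norm _) h.
exists n.+1%:R^-1; first by rewrite invr_gt0.
move=> A hA w hw; rewrite leNgt; apply/negP => /K1; apply/negP; rewrite -ltNge.
apply: le_lt_trans hn.
have -> : K (A^T *m w) = K w.
  rewrite /K; under eq_Rintegral do rewrite -dotv_mulmx.
  apply: (@eq_dist_Rintegral _ _ _ _ _ _ _ nu nu (fun x => A *m x) id _ _ _
    (fun x => trunc (dotv w x))) => //.
  - exact: measurable_mulmx.
  - by under eq_fun do rewrite dotv_mulmx.
apply: le_Rintegral => //.
  apply: (integ_le _ _ (integ_levy_weight levy_nu)).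
    apply: measurable_minr => //; apply: measurable_funX.
    by apply: measurable_funM => //; exact: measurable_enorm.
  move=> x; rewrite ger0_norm// /trunc /levy_weight.
  rewrite le_min ge_min lexx/= ge_min; apply/orP; right.
  rewrite ler_pXn2r ?nnegrE ?divr_ge0 ?enorm_ge0// ler_pdivrMr//.
  by rewrite ler_peMr ?enorm_ge0// ler1n.
move=> x _; apply: le_trunc; apply: le_trans (sqr_dotv_le _ _) _.
rewrite [leRHS]exprMn mulrC ler_wpM2l ?sqr_ge0//.
by rewrite ler_pXn2r ?nnegrE ?enorm_ge0// invr_ge0.
Qed.

End bounded_symmetries.

(** * Exponentials of the Jordan forms *)

Section matrix_exponential.
Context {R : realType} {n : nat}.
Implicit Types A D : 'M[R]_n.+1.

Lemma cvg_mx (u : nat -> 'M[R]_n.+1) (L : 'M[R]_n.+1) :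
  (forall i j, u k i j @[k --> \oo] --> L i j) -> u @ \oo --> L.
Proof.
move=> h; apply/cvg_ballP => e e0.
have hp (p : 'I_n.+1 * 'I_n.+1) : \forall k \near \oo, ball (L p.1 p.2) e (u k p.1 p.2).
  by have /cvg_ballP/(_ _ e0) := h p.1 p.2.
have {}hp : \forall k \near \oo, forall p : 'I_n.+1 * 'I_n.+1,
    ball (L p.1 p.2) e (u k p.1 p.2) by apply: filter_forall; exact: hp.
apply: filterS hp => k hk; split => // i j.
exact: (hk (i, j)).
Qed.

Definition expmx_coef A m i j (k : nat) : R := (k`!%:R)^-1 * (A ^+ (k + m)) i j.

Lemma expmx_entry_bound A : exists2 M, 0 <= M & forall k i j, `|(A ^+ k) i j| <= M ^+ k.
Proof.
pose M := \sum_i \sum_j `|A i j|.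
have M0 : 0 <= M by apply: sumr_ge0 => i _; apply: sumr_ge0.
exists M => //; elim=> [|k ih] i j.
  by rewrite !expr0 mxE; case: (_ == _); rewrite ?normr1 ?normr0.
rewrite exprS mxE (le_trans (ler_norm_sum _ _ _))//.
rewrite exprS (@le_trans _ _ ((\sum_l `|A i l|) * M ^+ k))//.
  rewrite mulr_suml; apply: ler_sum => l _.
  by rewrite normrM ler_wpM2l.
rewrite ler_wpM2r ?exprn_ge0// /M [leRHS](bigD1 i)//= lerDl.
by apply: sumr_ge0 => l _; apply: sumr_ge0.
Qed.

Lemma is_cvg_expmx_coef A m i j x : cvgn (pseries (expmx_coef A m i j) x).
Proof.
have [M M0 hM] := expmx_entry_bound A.
apply: normed_cvg.
apply: (@series_le_cvg _ _ (fun k => M ^+ m * exp_coeff (M * `|x|) k)).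
- by move=> k; rewrite /= normr_ge0.
- by move=> k; rewrite mulr_ge0 ?exprn_ge0// exp_coeff_ge0// mulr_ge0.
- move=> k; rewrite /= /expmx_coef /exp_coeff/= !normrM normrX.
  rewrite ger0_norm ?invr_ge0// exprMn mulrA.
  rewrite [leRHS](_ : _ = (k`!%:R)^-1 * (M ^+ (k + m)) * `|x| ^+ k).
    by rewrite ler_wpM2r ?exprn_ge0// ler_wpM2l ?invr_ge0.
  by rewrite exprD; ring.
- rewrite (_ : series _ = M ^+ m *: series (exp_coeff (M * `|x|))).
    by apply: is_cvgZr; exact: is_cvg_series_exp_coeff.
  by apply/funext => k; rewrite /series/= -mulr_sumr.
Qed.

Lemma pseries_diffs_expmx_coef A m i j :
  pseries_diffs (expmx_coef A m i j) = expmx_coef A m.+1 i j.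
Proof.
apply/funext => k; rewrite /pseries_diffs /expmx_coef factS natrM invfM.
by rewrite !mulrA mulfV// mul1r addnS addSn.
Qed.

Definition expmx_fun A i j x : R := limn (pseries (expmx_coef A 0 i j) x).

Lemma expmxE A x i j : expmx (x *: A) i j = expmx_fun A i j x.
Proof.
suff : series (fun k => (k`!%:R)^-1 *: (x *: A) ^+ k) @ \oo -->
    \matrix_(i, j) expmx_fun A i j x.
  by move=> h; rewrite /expmx (cvg_lim _ h)// mxE.
apply: cvg_mx => {}i {}j; rewrite mxE.
rewrite (_ : (fun k => _) = pseries (expmx_coef A 0 i j) x).
  exact: is_cvg_expmx_coef.
apply/funext => k; rewrite /pseries /series/= summxE; apply: eq_bigr => l _.
by rewrite /expmx_coef addn0 exprZn !mxE mulrCA mulrC.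
Qed.

Lemma is_derive_expmx_fun A i j (x : R) :
  is_derive x 1 (expmx_fun A i j) ((A *m \matrix_(i, j) expmx_fun A i j x) i j).
Proof.
rewrite (_ : (A *m _) i j = limn (pseries (pseries_diffs (expmx_coef A 0 i j)) x)).
  apply: (@pseries_snd_diffs _ _ (`|x| + 1)).
  - exact: is_cvg_expmx_coef.
  - by rewrite pseries_diffs_expmx_coef; exact: is_cvg_expmx_coef.
  - by rewrite !pseries_diffs_expmx_coef; exact: is_cvg_expmx_coef.
  - by rewrite [ltRHS]ger0_norm ?addr_ge0// ltrDl.
rewrite pseries_diffs_expmx_coef; apply/esym/cvg_lim => //.
rewrite mxE.
rewrite (_ : pseries _ x = fun k => \sum_l A i l * pseries (expmx_coef A 0 l j) x k).
  apply: cvg_big => [|l _]; first exact: add_continuous.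
  rewrite mxE; apply: cvgMr; exact: is_cvg_expmx_coef.
apply/funext => k; rewrite /pseries /series/=.
under [RHS]eq_bigr do rewrite mulr_sumr.
rewrite exchange_big/=; apply: eq_bigr => q _.
rewrite /expmx_coef addn1 exprS mxE mulr_sumr mulr_suml addn0.
by apply: eq_bigr => l _; ring.
Qed.

Lemma expmx_ode_unique A (D : R -> 'M[R]_n.+1) :
  (forall (t : R) i j, is_derive t 1 (fun s => D s i j) (- (D t *m A) i j)) ->
  D 0 = 1%:M -> forall t, D t *m expmx (t *: A) = 1%:M.
Proof.
move=> hD D0 t.
pose S s := \matrix_(i, j) expmx_fun A i j s.
have SE s : expmx (s *: A) = S s by apply/matrixP => i j; rewrite expmxE mxE.
rewrite SE.
have S0 : S 0 = 1%:M.
  rewrite -SE scale0r /expmx; apply: cvg_lim => //.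
  apply: cvg_near_cst; near=> k.
  rewrite /series/= (_ : k = k.-1.+1); last by rewrite prednK//; near: k; exact: nbhs_infty_gt.
  rewrite big_nat_recl//= big1 ?addr0 ?expr0 ?invr1 ?scale1r//.
  by move=> l _; rewrite expr0n scaler0.
apply/matrixP => i j.
have dDS (s : R) : is_derive s 1 (fun s => (D s *m S s) i j) 0.
  rewrite (_ : (fun s => _) = \sum_l (fun s => D s i l * expmx_fun A l j s)); last first.
    by apply/funext => u; rewrite mxE fct_sumE; apply: eq_bigr => l _; rewrite mxE.
  have h l : is_derive s 1 (fun s => D s i l * expmx_fun A l j s)
      (D s i l * (A *m S s) l j - (D s *m A) i l * S s l j).
    have := is_deriveM (hD s i l) (is_derive_expmx_fun A l j s).
    move=> hh; apply: (is_derive_eq hh).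
    rewrite /GRing.scale/= [S s l j]mxE; ring.
  apply: (is_derive_eq (is_derive_sum (fun l => h l))); rewrite sumrB.
  have -> : \sum_l D s i l * (A *m S s) l j = (D s *m (A *m S s)) i j by rewrite mxE.
  have -> : \sum_l (D s *m A) i l * S s l j = ((D s *m A) *m S s) i j by rewrite mxE.
  by rewrite mulmxA subrr.
have := is_derive_0_is_cst t 0 dDS.
by rewrite S0 D0 mul1mx => ->.
Unshelve. all: by end_near. Qed.

End matrix_exponential.

Section planar_matrices.
Context {R : realType}.
Implicit Types (A : 'M[R]_2) (x : 'cV[R]_2).

Lemma ord2P (P : 'I_2 -> Prop) : P 0 -> P 1 -> forall i, P i.
Proof.
move=> p0 p1 [[|[|//]] h].
  by rewrite (_ : Ordinal h = 0)//; exact/val_inj.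
by rewrite (_ : Ordinal h = 1)//; exact/val_inj.
Qed.

Lemma mx2_entries (a b c d : R) :
  ((mx2 a b c d 0 0 = a) * (mx2 a b c d 0 1 = b) *
   (mx2 a b c d 1 0 = c) * (mx2 a b c d 1 1 = d))%type.
Proof. by rewrite /mx2 !mxE. Qed.

Lemma mx2_eta A : A = mx2 (A 0 0) (A 0 1) (A 1 0) (A 1 1).
Proof.
apply/matrixP => i j; move: i j; apply: ord2P; apply: ord2P; by rewrite mx2_entries.
Qed.

Lemma sum_ord2 (f : 'I_2 -> R) : \sum_i f i = f 0 + f 1.
Proof.
rewrite !big_ord_recl big_ord0 addr0 (_ : lift ord0 ord0 = 1)//.
exact/val_inj.
Qed.

Lemma mulmx2E A A' : A *m A' = mx2
  (A 0 0 * A' 0 0 + A 0 1 * A' 1 0) (A 0 0 * A' 0 1 + A 0 1 * A' 1 1)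
  (A 1 0 * A' 0 0 + A 1 1 * A' 1 0) (A 1 0 * A' 0 1 + A 1 1 * A' 1 1).
Proof.
apply/matrixP => i j; move: i j; apply: ord2P; apply: ord2P;
  by rewrite mx2_entries mxE sum_ord2.
Qed.

Lemma mulmx_col0 A x : (A *m x) 0 0 = A 0 0 * x 0 0 + A 0 1 * x 1 0.
Proof. by rewrite !mxE !sum_ord2. Qed.

Lemma mulmx_col1 A x : (A *m x) 1 0 = A 1 0 * x 0 0 + A 1 1 * x 1 0.
Proof. by rewrite !mxE !sum_ord2. Qed.

Lemma mx2_1 : 1%:M = mx2 1 0 0 1 :> 'M[R]_2.
Proof. by rewrite [LHS]mx2_eta !mxE. Qed.

Lemma mx2Z (k a b c d : R) : k *: mx2 a b c d = mx2 (k * a) (k * b) (k * c) (k * d).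
Proof. by rewrite [LHS]mx2_eta !mxE. Qed.

Lemma mx2_mul (a b c d a' b' c' d' : R) : mx2 a b c d *m mx2 a' b' c' d' =
  mx2 (a * a' + b * c') (a * b' + b * d') (c * a' + d * c') (c * b' + d * d').
Proof. by rewrite mulmx2E !mx2_entries. Qed.

Definition expanding_group (E : R -> 'M[R]_2) := [/\ E 0 = 1%:M,
  forall s t, E (s + t) = E s *m E t,
  forall i j, continuous (fun s => E s i j) &
  exists2 k : R, 0 < k & forall s x, 0 <= s ->
    expR (k * s) * dotv x x <= dotv (E s *m x) (E s *m x)].

Definition diag_flow (b1 b2 s : R) := mx2 (expR (b1 * s)) 0 0 (expR (b2 * s)).
Definition spiral_flow (b c s : R) := expR (b * s) *: rotmx (c * s).
Definition shear_flow (b s : R) := expR (b * s) *: mx2 1 0 s 1.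

Lemma powmx_of_ode (B : 'M[R]_2) (E : R -> 'M[R]_2) :
  E 0 = 1%:M -> (forall s t, E (s + t) = E s *m E t) ->
  (forall (t : R) i j, is_derive t 1 (fun s => E (- s) i j) (- (E (- t) *m B) i j)) ->
  (forall t, powmx t B = E (ln t)) /\ (forall i j, continuous (fun s => E s i j)).
Proof.
move=> E0 ED dE; split=> [t|i j].
  have := @expmx_ode_unique R 1 B (fun s => E (- s)) dE.
  rewrite oppr0 => /(_ E0 (ln t)) h.
  by rewrite /powmx -[LHS]mul1mx -E0 -(subrr (ln t)) ED -mulmxA h mulmx1.
have cD : continuous (fun s => E (- s) i j).
  move=> s; apply: differentiable_continuous.
  by apply/derivable1_diffP; have [] := dE s i j.
move=> s; rewrite (_ : (fun s => _) = (fun s => E (- s) i j) \o -%R); last first.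
  by apply/funext => u /=; rewrite opprK.
apply: continuous_comp; [exact: oppr_continuous|exact: cD].
Qed.

Lemma is_derive_scaleN (b t : R) : is_derive t 1 (fun s => b * - s) (- b).
Proof. by apply: is_derive_eq; rewrite /GRing.scale/=; ring. Qed.

Lemma is_derive_expRN (b t : R) :
  is_derive t 1 (fun s => expR (b * - s)) (- (expR (b * - t) * b)).
Proof.
apply: (is_derive_eq (is_derive1_comp (f := expR) (g := (fun s => b * - s))
  (x := t) (is_derive_expR _) (is_derive_scaleN b t))).
by rewrite mulrN.
Qed.

Lemma is_derive_cosN (b t : R) :
  is_derive t 1 (fun s => cos (b * - s)) (sin (b * - t) * b).
Proof.
apply: (is_derive_eq (is_derive1_comp (f := cos) (g := (fun s => b * - s))
  (x := t) (is_derive_cos _) (is_derive_scaleN b t))).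
by rewrite mulrNN.
Qed.

Lemma is_derive_sinN (b t : R) :
  is_derive t 1 (fun s => sin (b * - s)) (- (cos (b * - t) * b)).
Proof.
apply: (is_derive_eq (is_derive1_comp (f := sin) (g := (fun s => b * - s))
  (x := t) (is_derive_sin _) (is_derive_scaleN b t))).
by rewrite mulrN.
Qed.

Lemma is_derive_mulfun (f g : R -> R) (t df dg : R) :
  is_derive t 1 f df -> is_derive t 1 g dg ->
  is_derive t 1 (fun s => f s * g s) (f t * dg + df * g t).
Proof.
move=> hf hg; apply: (is_derive_eq (is_deriveM hf hg)).
by rewrite /GRing.scale/= [g t * _]mulrC.
Qed.

Lemma diag_flowP b1 b2 : 2^-1 < b1 -> 2^-1 < b2 ->
  expanding_group (diag_flow b1 b2) /\
  forall t, powmx t (mx2 b1 0 0 b2) = diag_flow b1 b2 (ln t).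
Proof.
move=> hb1 hb2.
have E0 : diag_flow b1 b2 0 = 1%:M by rewrite /diag_flow !mulr0 expR0 mx2_1.
have ED s t : diag_flow b1 b2 (s + t) = diag_flow b1 b2 s *m diag_flow b1 b2 t.
  by rewrite /diag_flow mx2_mul !mulr0 !mul0r !addr0 !add0r !mulrDr !expRD.
have [|h1 h2] := @powmx_of_ode (mx2 b1 0 0 b2) _ E0 ED.
  move=> t; rewrite /diag_flow mx2_mul !mulr0 !mul0r !addr0 !add0r.
  apply: ord2P; apply: ord2P; rewrite !mx2_entries.
  - rewrite (_ : (fun s => _) = fun s => expR (b1 * - s)); first exact: is_derive_expRN.
    by apply/funext => u; rewrite mx2_entries.
  - rewrite (_ : (fun s => _) = cst 0); first by rewrite oppr0; exact: is_derive_cst.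
    by apply/funext => u; rewrite mx2_entries.
  - rewrite (_ : (fun s => _) = cst 0); first by rewrite oppr0; exact: is_derive_cst.
    by apply/funext => u; rewrite mx2_entries.
  - rewrite (_ : (fun s => _) = fun s => expR (b2 * - s)); first exact: is_derive_expRN.
    by apply/funext => u; rewrite mx2_entries.
split => //; split => //.
exists 1 => // s x s0; rewrite !dotv2 !mulmx_col0 !mulmx_col1 !mx2_entries.
rewrite !mul0r addr0 add0r mul1r.
have e (b : R) : 2^-1 < b -> expR s <= expR (b * s) ^+ 2.
  move=> hb; rewrite -expRM_natl ler_expR mulrA ler_peMl//.
  by lra.
have := e _ hb1; have := e _ hb2.
have := sqr_ge0 (x 0 0); have := sqr_ge0 (x 1 0).
set u := expR (b1 * s); set v := expR (b2 * s); set y := x 0 0; set z := x 1 0.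
move=> hz hy hv hu.
have -> : u * y * (u * y) + v * z * (v * z) = u ^+ 2 * y ^+ 2 + v ^+ 2 * z ^+ 2 by ring.
by rewrite mulrDr -!expr2 lerD// ler_wpM2r.
Qed.

Lemma rotmxD (s t : R) : rotmx (s + t) = rotmx s *m rotmx t.
Proof.
by rewrite /rotmx mx2_mul cosD sinD; congr mx2; ring.
Qed.

Lemma rotmx0 : rotmx 0 = 1%:M :> 'M[R]_2.
Proof. by rewrite /rotmx cos0 sin0 oppr0 mx2_1. Qed.

Lemma dotv_rotmx s x : dotv (rotmx s *m x) (rotmx s *m x) = dotv x x.
Proof.
rewrite !dotv2 !mulmx_col0 !mulmx_col1 !mx2_entries.
have := cos2Dsin2 s; set c := cos s; set d := sin s; set y := x 0 0; set z := x 1 0.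
move=> h; transitivity ((c ^+ 2 + d ^+ 2) * (y * y + z * z)); first by ring.
by rewrite h mul1r.
Qed.

Lemma spiral_flowP b c : 2^-1 < b ->
  expanding_group (spiral_flow b c) /\
  forall t, powmx t (mx2 b (- c) c b) = spiral_flow b c (ln t).
Proof.
move=> hb.
have E0 : spiral_flow b c 0 = 1%:M.
  by rewrite /spiral_flow !mulr0 expR0 rotmx0 scale1r.
have ED s t : spiral_flow b c (s + t) = spiral_flow b c s *m spiral_flow b c t.
  rewrite /spiral_flow -scalemxAl -scalemxAr scalerA !mulrDr expRD.
  by rewrite rotmxD.
have [|h1 h2] := @powmx_of_ode (mx2 b (- c) c b) _ E0 ED.
  move=> t; rewrite /spiral_flow /rotmx mx2Z mx2_mul.
  apply: ord2P; apply: ord2P; rewrite !mx2_entries.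
  - rewrite (_ : (fun s => _) = fun s => expR (b * - s) * cos (c * - s)); last first.
      by apply/funext => u; rewrite mx2Z mx2_entries.
    apply: (is_derive_eq (is_derive_mulfun (is_derive_expRN b t) (is_derive_cosN c t))).
    by rewrite /=; ring.
  - rewrite (_ : (fun s => _) = fun s => - (expR (b * - s) * sin (c * - s))); last first.
      by apply/funext => u; rewrite mx2Z mx2_entries mulrN.
    apply: (is_derive_eq (is_deriveN (is_derive_mulfun (is_derive_expRN b t) (is_derive_sinN c t)))).
    by rewrite /=; ring.
  - rewrite (_ : (fun s => _) = fun s => expR (b * - s) * sin (c * - s)); last first.
      by apply/funext => u; rewrite mx2Z mx2_entries.
    apply: (is_derive_eq (is_derive_mulfun (is_derive_expRN b t) (is_derive_sinN c t))).
    by rewrite /=; ring.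
  - rewrite (_ : (fun s => _) = fun s => expR (b * - s) * cos (c * - s)); last first.
      by apply/funext => u; rewrite mx2Z mx2_entries.
    apply: (is_derive_eq (is_derive_mulfun (is_derive_expRN b t) (is_derive_cosN c t))).
    by rewrite /=; ring.
split => //; split => //.
exists 1 => // s x s0; rewrite /spiral_flow -scalemxAl dotvZl dotvZr dotv_rotmx.
rewrite mulrA ler_wpM2r ?dotv_ge0// -expRD ler_expR.
have : 0 <= (2 * b - 1) * s by rewrite mulr_ge0//; lra.
lra.
Qed.

Lemma shear_expanding (x y s : R) : 0 <= s ->
  x ^+ 2 + y ^+ 2 <= expR s * (x ^+ 2 + (y + s * x) ^+ 2).
Proof.
move=> s0; pose g (u : R) := expR u * (x ^+ 2 + (y + u * x) ^+ 2).
have dg (u : R) : is_derive u 1 g (expR u * (x + y + u * x) ^+ 2).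
  have d1 : is_derive u 1 (fun v : R => x ^+ 2 + (y + v * x) ^+ 2) (2 * (y + u * x) * x).
    by apply: is_derive_eq; rewrite /GRing.scale/=; ring.
  apply: (is_derive_eq (is_derive_mulfun (is_derive_expR u) d1)).
  by ring.
have [|c _] := @MVT_segment R g _ 0 s s0 (fun u _ => dg u).
  apply: continuous_subspaceT => u; apply: differentiable_continuous.
  by apply/derivable1_diffP; have [] := dg u.
rewrite subr0 {2}/g expR0 mul1r mul0r addr0 => /eqP; rewrite subr_eq => /eqP.
rewrite -/(g s) => ->; rewrite lerDr mulr_ge0// mulr_ge0 ?expR_ge0 ?sqr_ge0//.
Qed.

Lemma shear_flowP b : 2^-1 < b ->
  expanding_group (shear_flow b) /\
  forall t, powmx t (mx2 b 0 1 b) = shear_flow b (ln t).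
Proof.
move=> hb.
have E0 : shear_flow b 0 = 1%:M.
  by rewrite /shear_flow !mulr0 expR0 scale1r mx2_1.
have ED s t : shear_flow b (s + t) = shear_flow b s *m shear_flow b t.
  rewrite /shear_flow -scalemxAl -scalemxAr scalerA !mulrDr expRD mx2_mul.
  by congr (_ *: mx2 _ _ _ _); ring.
have [|h1 h2] := @powmx_of_ode (mx2 b 0 1 b) _ E0 ED.
  move=> t; rewrite /shear_flow mx2Z mx2_mul.
  apply: ord2P; apply: ord2P; rewrite !mx2_entries.
  - rewrite (_ : (fun s => _) = fun s => expR (b * - s)); last first.
      by apply/funext => u; rewrite mx2Z mx2_entries mulr1.
    apply: (is_derive_eq (is_derive_expRN b t)); by ring.
  - rewrite (_ : (fun s => _) = cst 0); last first.
      by apply/funext => u; rewrite mx2Z mx2_entries mulr0.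
    apply: (is_derive_eq (is_derive_cst _ _ _)); by ring.
  - rewrite (_ : (fun s => _) = fun s => expR (b * - s) * (1 * - s)); last first.
      by apply/funext => u; rewrite mx2Z mx2_entries mul1r.
    apply: (is_derive_eq (is_derive_mulfun (is_derive_expRN b t) (is_derive_scaleN 1 t))).
    by rewrite /=; ring.
  - rewrite (_ : (fun s => _) = fun s => expR (b * - s)); last first.
      by apply/funext => u; rewrite mx2Z mx2_entries mulr1.
    apply: (is_derive_eq (is_derive_expRN b t)); by ring.
split => //; split => //.
exists (2 * b - 1) => [|s x s0]; first by lra.
rewrite /shear_flow -scalemxAl dotvZl dotvZr mulrA -expRD.
rewrite (_ : b * s + b * s = (2 * b - 1) * s + s); last by ring.
rewrite expRD -mulrA ler_wpM2l ?expR_ge0//.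
rewrite !dotv2 !mulmx_col0 !mulmx_col1 !mx2_entries.
have := shear_expanding (x 0 0) (x 1 0) s0.
set y := x 0 0; set z := x 1 0 => h.
rewrite -!expr2 (le_trans h)// ler_wpM2l ?expR_ge0//.
by rewrite mul0r addr0 !mul1r [s * y + z]addrC.
Qed.

End planar_matrices.

(** * Polar coordinates *)

Section polar_coordinates.
Context {R : realType}.
Local Notation V := 'cV[R]_2.
Variable E : R -> 'M[R]_2.
Hypothesis expE : expanding_group E.

Lemma flow0 : E 0 = 1%:M. Proof. by case: expE. Qed.

Lemma flowD s t : E (s + t) = E s *m E t. Proof. by case: expE. Qed.

Lemma flowK s (x : V) : E (- s) *m (E s *m x) = x.
Proof. by rewrite mulmxA -flowD addNr flow0 mul1mx. Qed.

Lemma flowNK s (x : V) : E s *m (E (- s) *m x) = x.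
Proof. by rewrite mulmxA -flowD addrN flow0 mul1mx. Qed.

Lemma flow_eq0 s (x : V) : (E s *m x == 0) = (x == 0).
Proof.
apply/eqP/eqP => [h|->]; last by rewrite mulmx0.
by rewrite -(flowK s x) h mulmx0.
Qed.

Let N (s : R) (x : V) := dotv (E s *m x) (E s *m x).

Let N_lt s t x : x != 0 -> s < t -> N s x < N t x.
Proof.
move=> x0 st; have [_ _ _ [k k0 hk]] := expE.
have := hk (t - s) (E s *m x); rewrite subr_ge0 => /(_ (ltW st)).
rewrite mulmxA -flowD subrK -/(N t x) -/(N s x); apply: lt_le_trans.
have N0 : 0 < N s x by rewrite lt_neqAle eq_sym dotv_eq0 flow_eq0 x0 dotv_ge0.
by rewrite ltr_pMl// expR_gt1 mulr_gt0// subr_gt0.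
Qed.

Let N_le s t x : x != 0 -> (N s x <= N t x) = (s <= t).
Proof.
move=> x0; apply/idP/idP => [|]; last first.
  by rewrite le_eqVlt => /predU1P[->//|/(N_lt x0)/ltW].
by apply: contraTT; rewrite -!ltNge; exact: N_lt.
Qed.

Let N_continuous x : continuous (fun s => N s x).
Proof.
have [_ _ cE _] := expE.
have c i : continuous (fun s => (E s *m x) i 0).
  rewrite (_ : (fun s => _) = fun s => E s i 0 * x 0 0 + E s i 1 * x 1 0).
    by move=> s; apply: cvgD; (apply: cvgM; [exact: cE|exact: cvg_cst]).
  by apply/funext => s; rewrite mxE sum_ord2.
rewrite (_ : (fun s => _) = fun s => (E s *m x) 0 0 * (E s *m x) 0 0 +
  (E s *m x) 1 0 * (E s *m x) 1 0).
  by move=> s; apply: cvgD; apply: cvgM; exact: c.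
by apply/funext => s; rewrite /N dotv2.
Qed.

Let N_one x : x != 0 -> exists s, N (- s) x = 1.
Proof.
move=> x0; have [_ _ _ [k k0 hk]] := expE.
have xx : 0 < dotv x x by rewrite lt_neqAle eq_sym dotv_eq0 x0 dotv_ge0.
pose T := (dotv x x + (dotv x x)^-1) / k.
have T0 : 0 <= T by rewrite divr_ge0 ?addr_ge0 ?invr_ge0// ltW.
have kT : k * T = dotv x x + (dotv x x)^-1 by rewrite /T mulrC divfK// gt_eqF.
have hi : 1 <= N T x.
  apply: le_trans (hk _ _ T0); rewrite -ler_pdivrMr// mul1r.
  have := expR_ge1Dx (k * T); have : 0 < (dotv x x)^-1 by rewrite invr_gt0.
  by rewrite kT; move: xx; set a := dotv x x; set b := a^-1; set c := expR _; lra.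
have lo : N (- T) x <= 1.
  have := hk _ (E (- T) *m x) T0; rewrite flowNK -/(N (- T) x).
  have e0 := expR_gt0 (k * T); rewrite mulrC -ler_pdivlMr// => h.
  apply: le_trans h _; rewrite ler_pdivrMr// mul1r kT.
  have := expR_ge1Dx (dotv x x + (dotv x x)^-1).
  have : 0 < (dotv x x)^-1 by rewrite invr_gt0.
  by move: xx; set a := dotv x x; set b := a^-1; set c := expR _; lra.
have lohi : N (- T) x <= N T x by exact: le_trans hi.
have [||c _ hc] := @IVT R (fun s => N s x) (- T) T 1 _
  (continuous_subspaceT (@N_continuous x)).
- by rewrite ge0_cp.
- by rewrite (min_l lohi) (max_r lohi) lo hi.
by exists (- c); rewrite opprK.
Qed.

Definition polar_time (x : V) : R := xget 0 [set s | N (- s) x = 1].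

Definition polar_dir (x : V) : V := E (- polar_time x) *m x.

Let polar_timeP x : x != 0 -> N (- polar_time x) x = 1.
Proof. by move=> /N_one[s hs]; rewrite /polar_time; case: xgetP => [_ -> //|/(_ s)]. Qed.

Lemma polar_time_uniq x s : x != 0 -> N (- s) x = 1 -> polar_time x = s.
Proof.
move=> x0 hs; apply: oppr_inj; apply/eqP; rewrite eq_le.
by rewrite -(N_le _ (- s) x0) -(N_le (- s) _ x0) hs polar_timeP// lexx.
Qed.

Lemma polar_time_ge x r : x != 0 -> (r <= polar_time x) = (1 <= N (- r) x).
Proof. by move=> x0; rewrite -{1}(polar_timeP x0) N_le// lerN2. Qed.

Lemma polar_dir_sphere x : x != 0 -> sphere R 2 (polar_dir x).
Proof. by move=> x0; rewrite /sphere/= /enorm -/(N _ _) polar_timeP// sqrtr1. Qed.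

Lemma polarK x : E (polar_time x) *m polar_dir x = x.
Proof. exact: flowNK. Qed.

Lemma polar_sphere s u : sphere R 2 u ->
  E s *m u != 0 /\ polar_time (E s *m u) = s /\ polar_dir (E s *m u) = u.
Proof.
move=> hu; have uu : dotv u u = 1 by rewrite -sqr_enorm hu expr1n.
have u0 : u != 0 by rewrite -dotv_eq0 uu oner_eq0.
have Eu0 : E s *m u != 0 by rewrite flow_eq0.
have ts : polar_time (E s *m u) = s.
  by apply: polar_time_uniq => //; rewrite /N flowK.
by rewrite /polar_dir ts flowK.
Qed.

Definition polar_cone (r : R) (F : set V) : set V :=
  [set x | [/\ x != 0, r <= polar_time x & F (polar_dir x)]].

Lemma polar_coneE r F : F `<=` sphere R 2 ->
  polar_cone r F = [set x | exists s u, [/\ r <= s, F u & x = E s *m u]].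
Proof.
move=> FS; apply/seteqP; split => x /=.
  move=> [x0 rx Fx]; exists (polar_time x), (polar_dir x); split => //.
  by rewrite polarK.
move=> [s [u [rs Fu ->]]].
have [h0 [h1 h2]] := polar_sphere s (FS _ Fu).
by split => //; rewrite ?h1 ?h2.
Qed.

Lemma polar_cone_sphere r F : polar_cone r F = polar_cone r (F `&` sphere R 2).
Proof.
apply/seteqP; split => x [x0 rx].
  by move=> Fx; split => //; split => //; exact: polar_dir_sphere.
by move=> [Fx _]; split.
Qed.

Lemma preimage_flow_cone s r F :
  (fun x : V => E s *m x) @^-1` polar_cone r F = polar_cone (r - s) F.
Proof.
have h x : x != 0 -> polar_time (E s *m x) = polar_time x + s /\
    polar_dir (E s *m x) = polar_dir x.
  move=> x0; have e : polar_time (E s *m x) = polar_time x + s.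
    apply: polar_time_uniq; first by rewrite flow_eq0.
    by rewrite /N mulmxA -flowD opprD subrK; exact: polar_timeP.
  by rewrite /polar_dir e mulmxA -flowD opprD subrK.
apply/seteqP; split => x [] /=.
  rewrite flow_eq0 => x0; have [-> ->] := h x x0.
  by move=> ? ?; split => //; rewrite lerBlDr.
move=> x0; have [h1 h2] := h x x0 => rx Fx.
by split; rewrite ?flow_eq0 ?h1 ?h2// -lerBlDr.
Qed.

Lemma preimage_isometry_cone (A : 'M[R]_2) r F :
  (forall x : V, enorm (A *m x) = enorm x) -> (forall s, A *m E s = E s *m A) ->
  (fun x : V => A *m x) @^-1` polar_cone r F =
  polar_cone r ((fun x : V => A *m x) @^-1` F).
Proof.
move=> iA cA.
have A0 (x : V) : (A *m x == 0) = (x == 0).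
  by rewrite -(enorm_eq0 (A *m x)) iA enorm_eq0.
have h x : x != 0 -> polar_time (A *m x) = polar_time x /\
    polar_dir (A *m x) = A *m polar_dir x.
  move=> x0; have e : polar_time (A *m x) = polar_time x.
    apply: polar_time_uniq; first by rewrite A0.
    by rewrite /N mulmxA -cA -mulmxA -sqr_enorm iA sqr_enorm; exact: polar_timeP.
  by rewrite /polar_dir e mulmxA -cA -mulmxA.
apply/seteqP; split => x [] /=.
  by rewrite A0 => x0; have [-> ->] := h x x0.
by move=> x0; have [h1 h2] := h x x0 => rx Fx; split; rewrite ?A0 ?h1 ?h2.
Qed.

Let measurable_flow : measurable_fun setT (fun p : R * V => E p.1 *m p.2).
Proof.
have [_ _ cE _] := expE.
apply: measurable_fun_cV => i.
rewrite (_ : (fun _ => _) = fun p : R * V => E p.1 i 0 * p.2 0 0 + E p.1 i 1 * p.2 1 0).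
  have mE j : measurable_fun setT (fun p : R * V => E p.1 i j * p.2 j 0).
    apply: measurable_funM.
      exact: (measurableT_comp (continuous_measurable_fun (cE i j)) measurable_fst).
    exact: (measurableT_comp (measurable_coord j 0) measurable_snd).
  exact: measurable_funD (mE 0) (mE 1).
by apply/funext => p; rewrite mxE sum_ord2.
Qed.

Let polar_time0 : polar_time 0 = 0.
Proof.
rewrite /polar_time; case: xgetP => // s _ /=.
by rewrite /N mulmx0 dotv0l => /eqP; rewrite eq_sym oner_eq0.
Qed.

Let polar_dir0 : polar_dir 0 = 0. Proof. by rewrite /polar_dir mulmx0. Qed.

Let N_measurable s : measurable_fun setT (N s).
Proof.
rewrite (_ : N s = (fun x => enorm x ^+ 2) \o (fun x : V => E s *m x)); last first.
  by apply/funext => x /=; rewrite sqr_enorm.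
apply: (measurableT_comp _ (measurable_mulmx (E s))).
by apply: measurable_funX; exact: measurable_enorm.
Qed.

Lemma measurable_polar_time : measurable_fun setT polar_time.
Proof.
apply: (measurability _ (RGenCInfty.measurableE R)).
move=> _ [_ [r ->] <-]; rewrite setTI.
have mN : measurable (N (- r) @^-1` `[1, +oo[).
  by rewrite -[X in measurable X]setTI; exact: N_measurable.
have [r0|r0] := leP r 0.
  rewrite (_ : _ @^-1` _ = N (- r) @^-1` `[1, +oo[ `|` [set 0]).
    by apply: measurableU => //; exact: measurable_set0v.
  apply/seteqP; split => x /=; rewrite !in_itv/= !andbT.
    have [->|x0] := eqVneq x 0; first by right.
    by rewrite polar_time_ge//; left.
  have [->|x0] := eqVneq x 0; first by rewrite polar_time0.
  by rewrite polar_time_ge// => -[//|/eqP]; rewrite (negbTE x0).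
rewrite (_ : _ @^-1` _ = N (- r) @^-1` `[1, +oo[ `\` [set 0]).
  by apply: measurableD => //; exact: measurable_set0v.
apply/seteqP; split => x /=; rewrite !in_itv/= !andbT.
  have [->|x0] := eqVneq x 0; first by rewrite polar_time0 leNgt r0.
  by rewrite polar_time_ge// => h; split => //; apply/eqP.
by move=> [h /eqP x0]; rewrite polar_time_ge.
Qed.

Lemma measurable_polar_dir : measurable_fun setT polar_dir.
Proof.
apply: (measurableT_comp measurable_flow (f := fun p => E p.1 *m p.2)
  (g := fun x : V => (- polar_time x, x))).
by apply: measurable_fun_pair => //; apply: measurableT_comp => //; exact: measurable_polar_time.
Qed.

Lemma measurable_polar_cone r F : measurable F -> measurable (polar_cone r F).
Proof.
move=> mF; rewrite (_ : polar_cone r F = ~` [set 0] `&`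
    (polar_time @^-1` `[r, +oo[ `&` polar_dir @^-1` F)).
  apply: measurableI; first by apply: measurableC; exact: measurable_set0v.
  apply: measurableI; rewrite -[X in measurable X]setTI.
    exact: measurable_polar_time.
  exact: measurable_polar_dir.
apply/seteqP; split => x /=; rewrite in_itv/= andbT.
  by move=> [/eqP].
by move=> [/eqP x0 [? ?]].
Qed.

Lemma polar_unique (m1 m2 : {measure set V -> \bar R}) :
  m1 [set 0] = 0%E -> m2 [set 0] = 0%E ->
  (forall r F, measurable F -> m1 (polar_cone r F) = m2 (polar_cone r F)) ->
  (forall r, m1 (polar_cone r setT) < +oo)%E ->
  forall A, measurable A -> m1 A = m2 A.
Proof.
move=> m10 m20 m12 m1oo.
pose G : set (set V) := [set A | A = [set 0] \/
  exists r F, measurable F /\ A = polar_cone r F].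
have GC r F : measurable F -> G (polar_cone r F) by move=> mF; right; exists r, F.
have mG : measurable = <<s G >>.
  apply/seteqP; split; last first.
    apply: smallest_sub; first exact: sigma_algebra_measurable.
    move=> _ [->|[r [F [mF ->]]]]; first exact: measurable_set0v.
    exact: measurable_polar_cone.
  pose T' := g_sigma_algebraType G.
  have mGT (A : set T') : G A -> measurable A by exact: sub_sigma_algebra.
  have m0 : measurable ([set 0] : set T') by apply: mGT; left.
  have mt : measurable_fun setT (polar_time : T' -> R).
    apply: (measurability _ (RGenCInfty.measurableE R)).
    move=> _ [_ [r ->] <-]; rewrite setTI.
    rewrite (_ : _ @^-1` _ = polar_cone r setT `|` (if r <= 0 then [set 0] else set0)).
      apply: measurableU; first by apply: mGT; exact: GC.
      by case: ifP.
    apply/seteqP; split => x /=; rewrite in_itv/= andbT.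
      have [->|x0] := eqVneq x 0; first by rewrite polar_time0 => ->; right.
      by left.
    by case=> [[]//|]; case: ifP => // r0 ->; rewrite polar_time0.
  have md : measurable_fun setT (polar_dir : T' -> V).
    move=> _ F mF; rewrite setTI.
    rewrite (_ : _ @^-1` _ = \bigcup_(k : nat) polar_cone (- k%:R) F `|`
        (if `[< F 0 >] then [set 0] else set0)).
      apply: measurableU; last by case: ifP.
      by apply: bigcupT_measurable => k; apply: mGT; exact: GC.
    apply/seteqP; split => x /=.
      have [->|x0] := eqVneq x 0.
        by rewrite polar_dir0 => F0; right; case: asboolP.
      move=> Fx; left; exists (Num.bound `|polar_time x|) => //; split => //.
      rewrite lerNl (le_trans (ler_norm _))// normrN ltW//.
      by rewrite archi_boundP.
    by case=> [[k _ []]//|]; case: asboolP => // F0 ->; rewrite polar_dir0.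
  have mid : measurable_fun setT (id : T' -> V).
    rewrite (_ : id = fun x => E (polar_time x) *m polar_dir x); last first.
      by apply/funext => x; rewrite polarK.
    apply: (measurableT_comp measurable_flow (f := fun p => E p.1 *m p.2)
      (g := fun x : T' => (polar_time x, polar_dir x))).
    exact: measurable_fun_pair.
  by move=> A mA; have := mid measurableT _ mA; rewrite setTI preimage_id.
have I0 r F : [set 0] `&` polar_cone r F = set0.
  by apply/seteqP; split => x // [-> []]; rewrite eqxx.
have G0 : G set0.
  right; exists 0, set0; split => //.
  by apply/seteqP; split => x // [].
apply: (@measure_unique _ _ _ G
  (fun k => if k is k'.+1 then polar_cone (- k'%:R) setT else [set 0])) => //.
- move=> _ _ [->|[r [F [mF ->]]]] [->|[r' [F' [mF' ->]]]].
  + by rewrite setIid; left.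
  + by rewrite I0.
  + by rewrite setIC I0.
  + rewrite (_ : _ `&` _ = polar_cone (Num.max r r') (F `&` F')).
      by apply: GC; exact: measurableI.
    apply/seteqP; split => x /=.
      by move=> [[x0 ? ?] [_ ? ?]]; split => //; rewrite ge_max; apply/andP.
    by move=> [x0]; rewrite ge_max => /andP[? ?] [].
- by case=> [|k]; [left|exact: GC].
- apply/seteqP; split => x // _; have [->|x0] := eqVneq x 0; first by exists 0%N.
  exists (Num.bound `|polar_time x|).+1 => //; split => //.
  rewrite lerNl (le_trans (ler_norm _))// normrN ltW//.
      by rewrite archi_boundP.
- by move=> _ [->|[r [F [mF ->]]]]; [rewrite m10 m20|exact: m12].
- by case=> [|k]; [rewrite m10|exact: m1oo].
Qed.

End polar_coordinates.

Section inverse_scaling.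
Context {R : realType}.

Lemma rat_between (a b : R) : 0 <= a -> a < b ->
  exists p q : nat, a < p.+1%:R / q.+1%:R < b.
Proof.
move=> a0 ab; have [z] := rat_in_itvoo ab.
rewrite in_itv/= => /andP[az zb].
have z0 : 0 < z by rewrite -(ltr0q R) (le_lt_trans a0 az).
have nz : 0 < numq z by rewrite numq_gt0.
have dz := denq_gt0 z.
exists `|numq z|.-1%N, `|denq z|.-1%N.
rewrite !prednK ?absz_gt0 ?gt_eqF// !natr_absz !gtr0_norm//.
by move: az zb; rewrite /ratr => -> ->.
Qed.

Lemma inverse_scaling_exp (f : R -> R) (r : R) :
  (forall s t, s <= t -> f t <= f s) -> (forall s, 0 <= f s) ->
  (forall p q : nat, p.+1%:R / q.+1%:R * f (ln (p.+1%:R / q.+1%:R)) = f 0) ->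
  expR r * f r = f 0.
Proof.
move=> fmono f0 frat; have er := expR_gt0 r.
apply/eqP; rewrite eq_le; apply/andP; split; rewrite leNgt; apply/negP => h.
- have fr : 0 < f r.
    by rewrite -(pmulr_rgt0 _ er); exact: le_lt_trans h.
  have [||p [q /andP[h1 h2]]] := @rat_between (f 0 / f r) (expR r).
  + by rewrite divr_ge0.
  + by rewrite ltr_pdivrMr.
  have rho0 : 0 < p.+1%:R / q.+1%:R :> R by rewrite divr_gt0.
  move: h1; rewrite ltr_pdivrMr// -(frat p q) ltr_pM2l// ltNge => /negP; apply.
  by apply: fmono; rewrite -[leRHS]expRK ler_ln ?posrE// ltW.
- have [b eb bf] : exists2 b, expR r < b & b * f r <= f 0.
    have [fr|fr] := eqVneq (f r) 0.
      by exists (expR r + 1); rewrite ?ltrDl// fr mulr0.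
    have fr0 : 0 < f r by rewrite lt_neqAle eq_sym fr f0.
    exists (f 0 / f r); first by rewrite ltr_pdivlMr.
    by rewrite divfK.
  have [p [q /andP[h1 h2]]] := rat_between (ltW er) eb.
  have rho0 : 0 < p.+1%:R / q.+1%:R :> R by rewrite divr_gt0.
  have le1 : f (ln (p.+1%:R / q.+1%:R)) <= f r.
    by apply: fmono; rewrite -[leLHS]expRK ler_ln ?posrE// ltW.
  have : p.+1%:R / q.+1%:R * f r < f 0.
    have [fr|fr] := eqVneq (f r) 0.
      by rewrite fr mulr0; rewrite fr mulr0 in h.
    have fr0 : 0 < f r by rewrite lt_neqAle eq_sym fr f0.
    by apply: lt_le_trans bf; rewrite ltr_pM2r.
  by rewrite -(frat p q) ltr_pM2l// ltNge le1.
Qed.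

End inverse_scaling.

Section spectral.
Context {R : realType}.
Local Notation V := 'cV[R]_2.
Variables (B : 'M[R]_2) (E : R -> 'M[R]_2).
Hypothesis expE : expanding_group E.
Hypothesis powE : forall t : R, powmx t B = E (ln t).
Variables (nu : {measure set V -> \bar R})
  (lambda : {finite_measure set V -> \bar R}).
Hypothesis nu0 : nu [set 0] = 0%E.
Hypothesis specl : spectral_measure B nu lambda.
Hypothesis scal : forall (n : nat) A, measurable A ->
  ((n.+1%:R)%:E * nu A = nu ((fun x => (E (ln n.+1%:R) *m x)%R) @^-1` A))%E.
Implicit Types (A : 'M[R]_2) (F : set V).

Let mpre A F : measurable F -> measurable ((fun x : V => A *m x) @^-1` F).
Proof. by move=> mF; rewrite -[X in measurable X]setTI; exact: measurable_mulmx. Qed.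

Lemma spectral_cone F : measurable F -> lambda F = nu (polar_cone E 0 F).
Proof.
move=> mF; have mS := @measurable_sphere R 2.
rewrite polar_cone_sphere//.
have -> : lambda F = lambda (F `&` sphere R 2).
  rewrite -{1}(setUIDK F (sphere R 2)) measureU//; last first.
  - by apply/seteqP; split => x // [[_ ?] [_ ?]].
  - exact: measurableD.
  - exact: measurableI.
  rewrite [X in (_ + X)%E](_ : _ = 0%E) ?adde0//.
  apply: subset_measure0 specl.1 => //; first exact: measurableD.
  exact: measurableC.
have [_ ->//] := specl; last exact: measurableI.
rewrite polar_coneE//; congr (nu _); apply/seteqP; split => x /=.
  move=> [t [u [t1 Fu ->]]]; exists (ln t), u; split => //.
    by rewrite ln_ge0.
  by rewrite powE.
move=> [s [u [s0 Fu ->]]]; exists (expR s), u; split => //.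
  by rewrite -expR0 ler_expR.
by rewrite powE expRK.
Qed.

Lemma cone_scaling r F : measurable F ->
  nu (polar_cone E r F) = ((expR (- r))%:E * lambda F)%E.
Proof.
move=> mF; rewrite spectral_cone//.
pose N s := nu (polar_cone E s F).
have mC s : measurable (polar_cone E s F) by exact: measurable_polar_cone.
have Nn n s : N (s - ln n.+1%:R) = ((n.+1%:R)%:E * N s)%E.
  by rewrite /N scal// preimage_flow_cone.
have N0 : N 0 \is a fin_num by rewrite /N -spectral_cone//; exact: fin_num_measure.
have mono s t : s <= t -> (N t <= N s)%E.
  move=> st; apply: le_measure; rewrite ?inE//.
  by move=> x [x0 tx Fx]; split => //; exact: le_trans tx.
have Nln n : N (ln n.+1%:R) = ((n.+1%:R^-1)%:E * N 0%R)%E.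
  have := Nn n (ln n.+1%:R); rewrite subrr => ->.
  by rewrite muleA -EFinM mulVf// mul1e.
have Nrat p q : N (ln (p.+1%:R / q.+1%:R)) = ((q.+1%:R / p.+1%:R)%:E * N 0%R)%E.
  by rewrite ln_div ?posrE// Nn Nln muleA -EFinM.
pose f s := fine (N s).
have Nfin s : N s \is a fin_num.
  have [k hk] : exists k : nat, - ln k.+1%:R <= s.
    exists (Num.bound (expR (- s))); rewrite lerNl -[leLHS]expRK ler_ln ?posrE ?expR_gt0//.
    rewrite (le_trans (ltW (archi_boundP (expR_ge0 _))))// ler_nat//.
  rewrite ge0_fin_numE// (le_lt_trans (mono _ _ hk))//.
  rewrite -[X in N X]sub0r Nn -(fineK N0) -EFinM ltry//.
have fmono s t : s <= t -> f t <= f s.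
  by move=> st; rewrite -lee_fin !fineK//; exact: mono.
have frat p q : f (ln (p.+1%:R / q.+1%:R)) = (q.+1%:R / p.+1%:R) * f 0.
  by rewrite /f Nrat fineM.
have f0 s : 0 <= f s by rewrite fine_ge0.
suff : f r = expR (- r) * f 0.
  by move=> h; rewrite -/(N r) -/(N 0) -(fineK (Nfin r)) -(fineK N0) -/(f r) -/(f 0) h EFinM.
have er0 : expR r != 0 by rewrite gt_eqF// expR_gt0.
rewrite expRN; apply: (mulfI er0); rewrite mulrA divff// mul1r.
apply: inverse_scaling_exp => //.
move=> p q; rewrite frat mulrA mulf_div [p.+1%:R * _]mulrC divff ?mul1r//.
Qed.

Let MT A : {mfun V >-> V} := MeasurableFun.Pack (MeasurableFun.Class
  (isMeasurableFun.Build _ _ _ _ (fun x : V => A *m x) (measurable_mulmx A))).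

Lemma flow_scaling s F : measurable F ->
  nu ((fun x => E s *m x) @^-1` F) = ((expR s)%:E * nu F)%E.
Proof.
move=> mF.
have es : 0 <= expR s by exact: expR_ge0.
apply: (@polar_unique _ _ expE (pushforward nu (MT (E s))) (mscale (NngNum es) nu)) => //.
- transitivity (nu ((fun x : V => E s *m x) @^-1` [set 0])); first by [].
  rewrite (_ : _ @^-1` _ = [set 0])//; apply/seteqP.
  by split => x /= => [/eqP|->]; rewrite ?mulmx0// (flow_eq0 expE) => /eqP.
- by transitivity ((expR s)%:E * nu [set 0%R])%E => //; rewrite nu0 mule0.
- move=> r G mG; transitivity (nu ((fun x : V => E s *m x) @^-1` polar_cone E r G)) => //.
  transitivity ((expR s)%:E * nu (polar_cone E r G))%E => //.
  rewrite preimage_flow_cone// !cone_scaling//.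
  by rewrite muleA -EFinM -expRD opprB.
- move=> r.
  rewrite -[X in (X < _)%E]/(nu ((fun x : V => E s *m x) @^-1` polar_cone E r setT)).
  rewrite preimage_flow_cone// cone_scaling//.
  have lf := fin_num_measure lambda _ (measurableT : measurable [set: V]).
  by rewrite -(fineK lf) -EFinM ltry.
Qed.

Lemma symmetry_of_spectral A : A \in unitmx -> (forall x : V, enorm (A *m x) = enorm x) ->
  (forall s, A *m E s = E s *m A) ->
  meas_eq (image_meas A lambda) lambda -> meas_eq (image_meas A nu) nu.
Proof.
move=> uA iA cA hl F mF.
apply: (@polar_unique _ _ expE (pushforward nu (MT A)) nu) => //.
- transitivity (nu ((fun x : V => A *m x) @^-1` [set 0])); first by [].
  rewrite (_ : _ @^-1` _ = [set 0])//; apply/seteqP.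
  split => x /= => [Ax0|->]; rewrite ?mulmx0//.
  by rewrite -(mulKmx uA x) Ax0 mulmx0.
- move=> r G mG; transitivity (nu ((fun x : V => A *m x) @^-1` polar_cone E r G)) => //.
  rewrite preimage_isometry_cone// !cone_scaling//; last exact: mpre.
  by have := hl _ mG; rewrite /image_meas /pushforward => ->.
- move=> r.
  rewrite -[X in (X < _)%E]/(nu ((fun x : V => A *m x) @^-1` polar_cone E r setT)).
  rewrite preimage_isometry_cone// preimage_setT cone_scaling//.
  have lf := fin_num_measure lambda _ (measurableT : measurable [set: V]).
  by rewrite -(fineK lf) -EFinM ltry.
Qed.

Lemma spectral_of_symmetry A : (forall x : V, enorm (A *m x) = enorm x) ->
  (forall s, A *m E s = E s *m A) ->
  meas_eq (image_meas A nu) nu -> meas_eq (image_meas A lambda) lambda.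
Proof.
move=> iA cA hn F mF; rewrite /image_meas /pushforward !spectral_cone//; last exact: mpre.
rewrite -preimage_isometry_cone//.
by apply: hn; exact: measurable_polar_cone.
Qed.

Lemma symmetry_conj_flow A s : meas_eq (image_meas A nu) nu ->
  meas_eq (image_meas (E (- s) *m A *m E s) nu) nu.
Proof.
move=> hA F mF; rewrite /image_meas /pushforward.
pose F' := (fun y : V => E (- s) *m y) @^-1` F.
have mF' : measurable F' by exact: mpre.
have -> : (fun x : V => E (- s) *m A *m E s *m x) @^-1` F =
    (fun x => E s *m x) @^-1` ((fun x => A *m x) @^-1` F').
  by apply/seteqP; split => x /=; rewrite /F'/= !mulmxA.
rewrite flow_scaling; last exact: mpre.
rewrite [X in (_ * X)%E](hA _ mF') flow_scaling//.
by rewrite muleA -EFinM -expRD subrr expR0 mul1e.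
Qed.

End spectral.

Section symmetry_monoid.
Context {R : realType} {d : nat} (m : {measure set 'cV[R]_d -> \bar R}).
Implicit Types A : 'M[R]_d.

Let mpre A (F : set 'cV[R]_d) : measurable F -> measurable ((fun x => A *m x) @^-1` F).
Proof. by move=> mF; rewrite -[X in measurable X]setTI; exact: measurable_mulmx. Qed.

Lemma image_meas_mul A A' : meas_eq (image_meas A m) m ->
  meas_eq (image_meas A' m) m -> meas_eq (image_meas (A *m A') m) m.
Proof.
move=> h h' F mF; rewrite -[RHS](h _ mF) -[RHS](h' _ (mpre A mF)).
by rewrite /image_meas /pushforward; congr (m _); apply/seteqP; split => x /=; rewrite mulmxA.
Qed.

Lemma image_meas_inv A : A \in unitmx -> meas_eq (image_meas A m) m ->
  meas_eq (image_meas (invmx A) m) m.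
Proof.
move=> uA h F mF; rewrite -[LHS](h _ (mpre (invmx A) mF)).
by rewrite /image_meas /pushforward; congr (m _); apply/seteqP; split => x /=; rewrite mulKmx.
Qed.

End symmetry_monoid.

Section nondegeneracy.
Context {R : realType} {d : nat}.
Local Notation V := 'cV[R]_d.
Variables (mu nu : {measure set V -> \bar R}) (gamma : V).
Hypothesis mu1 : mu setT = 1%E.
Hypothesis levy_mu : levy_triplet mu gamma 0 nu.

Lemma Rintegral_null (f : V -> R) (N : set V) : measurable_fun setT f ->
  measurable N -> nu N = 0%E -> (forall x, ~ N x -> f x = 0) ->
  \int[nu]_x f x = 0.
Proof.
move=> mf mN N0 fN; rewrite -[RHS](mul0r (fine (nu setT))) -Rintegral_cst//.
rewrite /Rintegral; congr fine; apply: ae_eq_integral => //.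
  exact/measurable_EFinP.
exists N; split => // x /= h; apply: contrapT => /fN fx; apply: h => _ /=.
by rewrite fx.
Qed.

Lemma full_nondegenerate (a : V) : full mu -> a != 0 ->
  nu [set x | dotv a x != 0] <> 0%E.
Proof.
move=> fullmu a0 nua.
have levy_nu : levy_measure nu by case: levy_mu.
have mN : measurable [set x : V | dotv a x != 0].
  rewrite (_ : mkset _ = setT `&` dotv a @^-1` [set~ 0]).
    by apply: measurable_dotv => //; exact: measurableC.
  by rewrite setTI; apply/seteqP; split => x /= /eqP.
have az s x : ~ [set x : V | dotv a x != 0] x -> dotv (s *: a) x = 0.
  by move=> /= /negP; rewrite negbK dotvZl => /eqP ->; rewrite mulr0.
have re0 s : levy_re nu (s *: a) = 0.
  apply: (Rintegral_null _ mN nua).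
    by apply: measurable_funB => //; exact: measurable_cos_dotv.
  by move=> x /(az s) ->; rewrite cos0 subrr.
have im0 s : levy_im nu gamma (s *: a) = s * dotv gamma a.
  rewrite /levy_im dotvZr (Rintegral_null _ mN nua) ?addr0//.
    exact: measurable_sin_compensated.
  by move=> x /(az s) h; rewrite /sin_compensated h sin0 mul0r subrr.
pose c := dotv gamma a.
have muT : (mu setT < +oo)%E by rewrite mu1 ltry.
pose g s (x : V) := 1 - cos (s * (dotv a x - c)).
have gE s x : cos (s * (dotv a x - c)) =
    cos (s * c) * cos (dotv (s *: a) x) + sin (s * c) * sin (dotv (s *: a) x).
  by rewrite dotvZl mulrBr cosB; ring.
have mg s : measurable_fun setT (g s).
  apply: measurable_funB => //; under eq_fun do rewrite gE.
  apply: measurable_funD; apply: measurable_funM => //.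
    exact: measurable_cos_dotv.
  exact: measurable_sin_dotv.
have g0 s x : 0 <= g s x by exact: subr_cos_ge0.
have ig s : \int[mu]_x g s x = 0.
  have [ic is_] := @charfun_integrable R d _ V mu id (s *: a) muT (@measurable_id _ V setT).
  rewrite /g; under eq_Rintegral do rewrite gE.
  rewrite RintegralB//; last 2 first.
  - exact: integ_cst.
  - by apply: integD; exact: integZ.
  rewrite RintegralD//; try exact: integZ.
  rewrite !RintegralZl// Rintegral_cst// mu1 mulr1.
  have [-> ->] := levy_khintchine (s *: a) levy_mu.
  by rewrite re0 im0 -/c expR0 !mul1r -!expr2 cos2Dsin2 subrr.
have aeg s : {ae mu, forall x, g s x = 0}.
  have mgE : measurable_fun setT (EFin \o g s) by exact/measurable_EFinP.
  have e0 : (\int[mu]_x `|(EFin \o g s) x| = 0)%E.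
    under eq_integral do rewrite /= ger0_norm//.
    rewrite -[LHS]fineK; first by have := ig s; rewrite /Rintegral => ->.
    apply: integrable_fin_num => //.
    apply: (@integ_le _ _ _ _ _ (fun=> 2)) => //; last exact: integ_cst.
    by move=> x; rewrite ger0_norm//; exact: subr_cos_le2.
  have := (ae_eq_integral_abs mu measurableT mgE).1 e0.
  by apply: filterS => x /(_ I) /= [].
have ae_all : {ae mu, forall x (n : nat), g n.+1%:R^-1 x = 0}.
  by apply: ae_foralln => n; exact: aeg.
apply: (fullmu a c a0).
have [N [mN' N0 hN]] := ae_all.
apply: subset_measure0 N0 => //.
  rewrite (_ : ~` _ = setT `&` dotv a @^-1` [set~ c]); last by rewrite setTI.
  by apply: measurable_dotv => //; exact: measurableC.
move=> x /= xc; apply: hN => /= h; apply: xc.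
apply/eqP; rewrite -subr_eq0; apply/negP => /negP y0.
set y := dotv a x - c in y0 h.
have yk : y / n.+1%:R @[n --> \oo] --> 0.
  by rewrite -[X in _ --> X](mulr0 y); apply: cvgMr; exact: cvg_harmonic.
have [k _ /(_ k (leqnn k)) hk] := (cvgrPdist_lt _ _).1 yk _ (@pi_gt0 R).
move: hk; rewrite /= sub0r normrN => hk.
have := h k; rewrite /g -/y mulrC; set w := y / k.+1%:R in hk *.
have w0 : 0 < `|w| by rewrite normr_gt0 mulf_neq0// invr_eq0.
have -> : cos w = cos `|w| by case: ger0P => _; rewrite ?cosN.
apply/eqP; rewrite gt_eqF// subr_gt0 -[ltRHS]cos0 ltr_cos// in_itv/= ?lexx ?pi_ge0//.
by rewrite normr_ge0 ltW.
Qed.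

End nondegeneracy.

Section operator_stable_scaling.
Context {R : realType} {d : nat}.
Local Notation V := 'cV[R]_d.+1.
Context {disp} {Omega : measurableType disp} (P : probability Omega R).
Variables (X : R -> {RV P >-> V}) (B : 'M[R]_d.+1) (gamma : V).
Variable nu : {measure set V -> \bar R}.
Hypothesis levyX : levy_process X.
Hypothesis stableX : operator_stable X B.
Hypothesis levy_mu : levy_triplet (distribution P (X 1)) gamma 0 nu.

Lemma operator_stable_levy (n : nat) F : powmx n.+1%:R B \in unitmx -> measurable F ->
  ((n.+1%:R)%:E * nu F = nu ((fun x => (powmx n.+1%:R B *m x)%R) @^-1` F))%E.
Proof.
move=> uB mF; have [b hb] := stableX.2 n.+1%:R (ltr0Sn _ _).
have PT : (P setT < +oo)%E by rewrite probability_setT ltry.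
have muT : (distribution P (X 1) setT < +oo)%E by rewrite probability_setT ltry.
have mX t := measurable_funPT (X t).
have law z : \int[P]_w cos (dotv z (X 1 w)) =
      expR (levy_re nu z) * cos (levy_im nu gamma z) /\
    \int[P]_w sin (dotv z (X 1 w)) =
      expR (levy_re nu z) * sin (levy_im nu gamma z).
  have [<- <-] := levy_khintchine z levy_mu.
  have [ic is_] := charfun_integrable z PT (mX 1).
  split; rewrite /Rintegral; congr fine; apply/esym; apply: integral_distribution => //.
    by apply/measurable_EFinP; exact: measurable_cos_dotv.
  by apply/measurable_EFinP; exact: measurable_sin_dotv.
apply: (@levy_scaling_dist _ _ _ _ _ muT levy_mu _ _ P (X n.+1%:R) _ b n.+1%:R) => //.
- by move=> z; have [h1 h2] := law z; have [] := charfun_levy_process levyX h1 h2 n.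
- by move=> z; have [h1 h2] := law z; have [] := charfun_levy_process levyX h1 h2 n.
Qed.

End operator_stable_scaling.

(** * Bounded matrix groups *)

Section boundedness.
Context {R : realType}.
Implicit Types (x M : R).

Lemma bounded_expR_eq0 x M : (forall t, `|x| * expR t <= M) -> x = 0.
Proof.
move=> h; apply/eqP; rewrite -normr_eq0; apply/negP => /negP x0.
have x1 : 0 < `|x| by rewrite lt_neqAle eq_sym x0 normr_ge0.
have := h (M / `|x|); apply/negP; rewrite -ltNge.
rewrite (@lt_le_trans _ _ (`|x| * (1 + M / `|x|)))//.
  by rewrite mulrDr mulr1 mulrCA divff ?mulr1// ltrDr.
by rewrite ler_pM2l// expR_ge1Dx.
Qed.

Lemma bounded_affine_eq0 x y M : (forall t, `|y + x * t| <= M) -> x = 0.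
Proof.
move=> h; apply/eqP/negP => /negP x0.
have M0 : 0 <= M by exact: le_trans (h 0).
have := h ((M + 1 + `|y|) / x); rewrite mulrC divfK//; apply/negP; rewrite -ltNge.
have := ler_norm (y + (M + 1 + `|y|)); have := ler_norm (- y); rewrite normrN.
lra.
Qed.

Lemma bounded_expn_le1 x M : (forall n, `|x| ^+ n <= M) -> `|x| <= 1.
Proof.
move=> h; rewrite leNgt; apply/negP => x1.
have x0 : 0 < `|x| by exact: lt_trans x1.
have l0 : 0 < ln `|x| by rewrite ln_gt0.
pose n := Num.bound (`|M| / ln `|x|).
have hn : `|M| / ln `|x| < n%:R by rewrite archi_boundP// divr_ge0// ltW.
have := h n; apply/negP; rewrite -ltNge.
rewrite -[X in X ^+ n]lnK ?posrE// -expRM_natl.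
rewrite (lt_le_trans _ (expR_ge1Dx _))//.
move: hn; rewrite ltr_pdivrMr// => hn.
by rewrite (le_lt_trans (ler_norm M))// (lt_trans hn)// ltrDr.
Qed.

Lemma normr1_sign x : `|x| = 1 -> x = 1 \/ x = -1.
Proof.
by case: (ger0P x) => _ h; [left|right; rewrite -h opprK].
Qed.

End boundedness.

Section planar_angles.
Context {R : realType}.
Implicit Types (x : 'cV[R]_2) (A : 'M[R]_2).

Lemma polar_angle (a b : R) : a ^+ 2 + b ^+ 2 = 1 ->
  exists2 t : R, 0 <= t < 2 * pi & cos t = a /\ sin t = b.
Proof.
move=> ab; have a1 : -1 <= a <= 1.
  rewrite -ler_norml -(ler_pXn2r (_ : 0 < 2)%N) ?nnegrE// expr1n real_normK ?num_real//.
  by rewrite -ab lerDl sqr_ge0.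
have sq : 1 - a ^+ 2 = b ^+ 2 by rewrite -ab; ring.
have pi0 := @pi_gt0 R.
have [b0|b0] := leP 0 b.
  exists (acos a); last by rewrite acosK// sin_acos// sq sqrtr_sqr ger0_norm.
  by rewrite acos_ge0//= (le_lt_trans (acos_lepi a1))//; lra.
exists (2 * pi - acos a).
  apply/andP; split; first by have := acos_lepi a1; lra.
  rewrite ltrBlDr ltrDl acos_gt0//; case/andP: a1 => -> a1/=.
  rewrite lt_neqAle a1 andbT; apply/eqP => a1'.
  by move: sq; rewrite a1' expr1n subrr => /esym/eqP; rewrite sqrf_eq0 lt_eqF.
have e : 2 * pi - acos a = - acos a + pi *+ 2 by rewrite mulr2n; ring.
rewrite e cosD2pi sinD2pi cosN sinN acosK// sin_acos// sq sqrtr_sqr.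
by rewrite ltr0_norm// opprK.
Qed.

Lemma rotmxN s : (rotmx s)^T = rotmx (- s) :> 'M[R]_2.
Proof. by rewrite [LHS]mx2_eta !mxE /= /rotmx cosN sinN opprK. Qed.

Lemma rotmx_unit (s : R) : rotmx s \in unitmx.
Proof.
by have [] := @mulmx1_unit R 2 (rotmx s) (rotmx (- s)); rewrite -?rotmxD ?subrr ?rotmx0.
Qed.

Lemma enorm_eq (x y : 'cV[R]_2) : dotv x x = dotv y y -> enorm x = enorm y.
Proof. by rewrite /enorm => ->. Qed.

Lemma enorm_rotmx s x : enorm (rotmx s *m x) = enorm x.
Proof. by apply: enorm_eq; exact: dotv_rotmx. Qed.

Lemma rotmx_transitive (x y : 'cV[R]_2) : enorm x = enorm y -> exists s, y = rotmx s *m x.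
Proof.
have [->|x0] := eqVneq x 0.
  rewrite enorm0 => /esym/eqP; rewrite enorm_eq0 => /eqP ->.
  by exists 0; rewrite mulmx0.
move=> xy; have r0 : enorm x != 0 by rewrite enorm_eq0.
have unit_angle (z : 'cV[R]_2) : enorm z = enorm x -> exists t, z = enorm x *: (\col_i (if i == 0 then cos t else sin t)).
  move=> zx; have [|t _ [ct st]] := @polar_angle (z 0 0 / enorm x) (z 1 0 / enorm x).
    rewrite !expr_div_n -mulrDl.
    have -> : z 0 0 ^+ 2 + z 1 0 ^+ 2 = enorm x ^+ 2.
      by rewrite -zx sqr_enorm dotv2 !expr2.
    by rewrite divff// expf_neq0.
  exists t; apply/colP; apply: ord2P; rewrite !mxE/= ?ct ?st mulrC divfK//.
have [s hs] := unit_angle x erefl; have [t ht] := unit_angle y (esym xy).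
exists (t - s); rewrite [in RHS]hs [LHS]ht -scalemxAr; congr (_ *: _).
apply/colP; apply: ord2P.
  rewrite mulmx_col0 /rotmx !mx2_entries !mxE/=.
  by rewrite mulNr -cosD subrK.
rewrite mulmx_col1 /rotmx !mx2_entries !mxE/=.
by rewrite -sinD subrK.
Qed.

Lemma isometry_O2 A : (forall x, enorm (A *m x) = enorm x) -> O2 A.
Proof.
move=> iA.
have d x : dotv (A *m x) (A *m x) = dotv x x by rewrite -!sqr_enorm iA.
pose e (s t : R) : 'cV[R]_2 := \col_i (if i == 0 then s else t).
have := d (e 1 0); have := d (e 0 1); have := d (e 1 1).
rewrite !dotv2 !mulmx_col0 !mulmx_col1 !mxE/= !(mulr0, mulr1, addr0, add0r).
set a := A 0 0; set b := A 0 1; set c := A 1 0; set f := A 1 1.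
move=> h11 h01 h10.
have h0 : a * b + c * f = 0 by lra.
have [|t ht [ct st]] := @polar_angle a c; first by rewrite !expr2.
pose k := a * f - b * c.
have k2 : k ^+ 2 = 1.
  transitivity ((a * a + c * c) * (b * b + f * f) - (a * b + c * f) ^+ 2).
    by rewrite /k; ring.
  by rewrite h10 h01 h0; ring.
have bE : b = - k * c.
  transitivity ((a * a + c * c) * b - a * (a * b + c * f)).
    by rewrite h10 h0; ring.
  by rewrite /k; ring.
have fE : f = k * a.
  transitivity ((a * a + c * c) * f - c * (a * b + c * f)).
    by rewrite h10 h0; ring.
  by rewrite /k; ring.
have : (k - 1) * (k + 1) = 0.
  by transitivity (k ^+ 2 - 1); [ring|rewrite k2 subrr].
move/eqP; rewrite mulf_eq0 => /orP[|] /eqP k1.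
- left; exists t => //; rewrite /rotmx ct st [RHS]mx2_eta -/a -/b -/c -/f bE fE.
  by rewrite (_ : k = 1) ?mulN1r ?mul1r//; lra.
- right; exists t => //; rewrite /reflmx ct st [RHS]mx2_eta -/a -/b -/c -/f bE fE.
  by rewrite (_ : k = -1) ?opprK ?mulN1r ?mul1r//; lra.
Qed.

Lemma SO2_rotmx s : SO2 (rotmx s : 'M[R]_2).
Proof.
have [|t ht [ct st]] := @polar_angle (cos s) (sin s); first exact: cos2Dsin2.
by exists t => //; rewrite /rotmx ct st.
Qed.

Lemma reflmx_rotmx s t : reflmx s *m rotmx t = rotmx (- t) *m reflmx s :> 'M[R]_2.
Proof.
by rewrite /reflmx /rotmx !mx2_mul cosN sinN; congr mx2; ring.
Qed.

Lemma reflmx_sqr s : reflmx s *m reflmx s = 1%:M :> 'M[R]_2.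
Proof.
have h := cos2Dsin2 s.
rewrite /reflmx mx2_mul mx2_1; congr mx2; try (by ring);
  rewrite -[RHS]h; ring.
Qed.

Lemma enorm_reflmx s x : enorm (reflmx s *m x) = enorm x.
Proof.
apply: enorm_eq; rewrite dotv_mulmx mulmxA.
have -> : (reflmx s)^T = reflmx s :> 'M[R]_2.
  by rewrite [LHS]mx2_eta !mxE.
by rewrite reflmx_sqr mul1mx.
Qed.

End planar_angles.

Section bounded_groups.
Context {R : realType}.
Variable G : set 'M[R]_2.
Hypothesis unitG : forall A, G A -> A \in unitmx.
Hypothesis mulG : forall A A', G A -> G A' -> G (A *m A').
Hypothesis invG : forall A, G A -> G (invmx A).
Hypothesis boundG : exists M, forall A, G A -> forall i j, `|A i j| <= M.

Let expG A n : G A -> G (A ^+ n.+1).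
Proof. by move=> hA; elim: n => [|n ih]; [rewrite expr1|rewrite exprS; exact: mulG]. Qed.

Lemma bounded_group_diag (b1 b2 : R) : b1 != b2 ->
  (forall A s, G A -> G (diag_flow b1 b2 (- s) *m A *m diag_flow b1 b2 s)) ->
  forall A, G A -> dihedral2 A.
Proof.
move=> b12 conjG; have [M hM] := boundG.
have step A : G A -> [/\ A = mx2 (A 0 0) 0 0 (A 1 1), `|A 0 0| <= 1 & `|A 1 1| <= 1].
  move=> hA; have b21 : b2 - b1 != 0 by rewrite subr_eq0 eq_sym.
  have cE s : diag_flow b1 b2 (- s) *m A *m diag_flow b1 b2 s =
      mx2 (A 0 0) (A 0 1 * expR ((b2 - b1) * s)) (A 1 0 * expR ((b1 - b2) * s)) (A 1 1).
    have e1 b : expR (b * - s) * expR (b * s) = 1 :> R.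
      by rewrite -expRD mulrN addNr expR0.
    have e2 b b' : expR ((b - b') * s) = expR (b' * - s) * expR (b * s).
      by rewrite -expRD; congr expR; ring.
    rewrite [in LHS](mx2_eta A) /diag_flow !mx2_mul !e2.
    rewrite !(mulr0, mul0r, addr0, add0r).
    congr mx2; try ring; by rewrite mulrAC e1 mul1r.
  have h01 : A 0 1 = 0.
    apply: (@bounded_expR_eq0 _ _ M) => t.
    have := hM _ (conjG _ (t / (b2 - b1)) hA) 0 1; rewrite cE mx2_entries.
    by rewrite (mulrC (b2 - b1)) divfK// normrM (ger0_norm (expR_ge0 _)).
  have h10 : A 1 0 = 0.
    apply: (@bounded_expR_eq0 _ _ M) => t.
    have := hM _ (conjG _ (- t / (b2 - b1)) hA) 1 0; rewrite cE mx2_entries.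
    rewrite (_ : (b1 - b2) * _ = t) ?normrM ?(ger0_norm (expR_ge0 _))//.
    by field; rewrite b21.
  have eA : A = mx2 (A 0 0) 0 0 (A 1 1) by rewrite {1}(mx2_eta A) h01 h10.
  have pA n : A ^+ n = mx2 (A 0 0 ^+ n) 0 0 (A 1 1 ^+ n).
    elim: n => [|n ih]; first by rewrite !expr0 -mx2_1.
    rewrite exprS ih {1}eA -[LHS]/(_ *m _) mx2_mul !(mulr0, mul0r, addr0, add0r).
    by rewrite -!exprS.
  have M1 n : `|A 0 0| ^+ n <= Num.max M 1 /\ `|A 1 1| ^+ n <= Num.max M 1.
    case: n => [|n]; first by rewrite !expr0 le_max lexx orbT.
    have hn := hM _ (expG n hA); rewrite -!normrX !le_max.
    by have := hn 0 0; have := hn 1 1; rewrite pA !mx2_entries => -> ->.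
  split => //; apply: bounded_expn_le1 => n; [exact: (M1 n).1|exact: (M1 n).2].
move=> A hA; have [eA a1 d1] := step _ hA.
have [eV a1' d1'] := step _ (invG hA).
have : invmx A *m A = 1%:M by rewrite mulVmx// unitG.
have V01 : invmx A 0 1 = 0 by rewrite eV mx2_entries.
have V10 : invmx A 1 0 = 0 by rewrite eV mx2_entries.
rewrite mulmx2E mx2_1 V01 V10 => /matrixP e.
have /(congr1 Num.norm) e0 : invmx A 0 0 * A 0 0 = 1.
  by have := e 0 0; rewrite !mx2_entries mul0r addr0.
have /(congr1 Num.norm) e1 : invmx A 1 1 * A 1 1 = 1.
  by have := e 1 1; rewrite !mx2_entries mul0r add0r.
rewrite !normrM normr1 in e0 e1.
have n0 : `|A 0 0| = 1.
  apply/eqP; rewrite eq_le a1/= -e0; exact: ler_piMl.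
have n1 : `|A 1 1| = 1.
  apply/eqP; rewrite eq_le d1/= -e1; exact: ler_piMl.
have r0 : reflmx 0 = mx2 1 0 0 (-1) :> 'M[R]_2 by rewrite /reflmx cos0 sin0.
have oppmx2 (a b c d : R) : - mx2 a b c d = mx2 (- a) (- b) (- c) (- d).
  by rewrite -scaleN1r mx2Z !mulN1r.
rewrite /dihedral2/= r0 mx2_1 !oppmx2 oppr0 opprK eA.
by case: (normr1_sign n0) => ->; case: (normr1_sign n1) => ->;
  [constructor 1|constructor 2|constructor 4|constructor 3].
Qed.

Lemma bounded_group_shear (b : R) :
  (forall A s, G A -> G (shear_flow b (- s) *m A *m shear_flow b s)) ->
  forall A, G A -> A = 1%:M \/ A = - 1%:M.
Proof.
move=> conjG; have [M hM] := boundG.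
have step A : G A -> A = mx2 (A 0 0) 0 (A 1 0) (A 0 0) /\ `|A 0 0| <= 1.
  move=> hA.
  have cE s : shear_flow b (- s) *m A *m shear_flow b s =
      mx2 (A 0 0 + A 0 1 * s) (A 0 1)
        (A 1 0 + (A 1 1 - A 0 0) * s - A 0 1 * s * s) (A 1 1 - A 0 1 * s).
    rewrite [in LHS](mx2_eta A) /shear_flow -!scalemxAl -!scalemxAr scalerA.
    rewrite -expRD mulrN addNr expR0 scale1r !mx2_mul; congr mx2; ring.
  have h01 : A 0 1 = 0.
    apply: (@bounded_affine_eq0 _ _ (A 0 0) M) => t.
    by have := hM _ (conjG _ t hA) 0 0; rewrite cE mx2_entries.
  have h11 : A 1 1 = A 0 0.
    apply/eqP; rewrite -subr_eq0; apply/eqP.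
    apply: (@bounded_affine_eq0 _ _ (A 1 0) M) => t.
    by have := hM _ (conjG _ t hA) 1 0; rewrite cE mx2_entries h01 !mul0r subr0.
  have eA : A = mx2 (A 0 0) 0 (A 1 0) (A 0 0) by rewrite {1}(mx2_eta A) h01 h11.
  split => //.
  have pA n : (A ^+ n) 0 0 = A 0 0 ^+ n /\ (A ^+ n) 0 1 = 0.
    elim: n => [|n [ih1 ih2]]; first by rewrite !expr0 -[1]/(1%:M) mx2_1 !mx2_entries.
    have -> : A ^+ n.+1 = A ^+ n *m A by rewrite exprSr.
    rewrite mulmx2E !mx2_entries ih1 ih2 h01.
    by rewrite !mul0r !addr0 mulr0 exprSr.
  apply: (@bounded_expn_le1 _ _ (Num.max M 1)) => -[|n].
    by rewrite expr0 le_max lexx orbT.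
  by rewrite -normrX -(pA n.+1).1 le_max (hM _ (expG n hA)).
move=> A hA; have [eA a1] := step _ hA; have [eV a1'] := step _ (invG hA).
have : invmx A *m A = 1%:M by rewrite mulVmx// unitG.
have V01 : invmx A 0 1 = 0 by rewrite eV mx2_entries.
rewrite mulmx2E mx2_1 V01 => /matrixP e.
have /(congr1 Num.norm) e0 : invmx A 0 0 * A 0 0 = 1.
  by have := e 0 0; rewrite !mx2_entries mul0r addr0.
rewrite normrM normr1 in e0.
have n0 : `|A 0 0| = 1.
  apply/eqP; rewrite eq_le a1/= -e0; exact: ler_piMl.
have a0 : A 0 0 ^+ 2 = 1 by rewrite -[LHS]real_normK ?num_real// n0 expr1n.
have cE n : (A ^+ (2 * n)) = mx2 1 0 (2 * A 0 0 * A 1 0 * n%:R) 1.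
  elim: n => [|n ih]; first by rewrite muln0 expr0 mulr0 -mx2_1.
  rewrite mulnS exprD ih -[LHS]/(_ *m _).
  have -> : A ^+ 2 = mx2 1 0 (2 * A 0 0 * A 1 0) 1.
    rewrite expr2 -[LHS]/(_ *m _) {1 2}eA mx2_mul !(mulr0, mul0r, addr0, add0r) -expr2 a0.
    by congr mx2; ring.
  by rewrite mx2_mul -[n.+1%:R]natr1; congr mx2; ring.
have c0 : A 1 0 = 0.
  have aN : 2 * A 0 0 != 0.
    by rewrite mulf_neq0// -normr_eq0 n0 oner_eq0.
  apply/eqP/negP => /negP c0.
  have p0 : 0 < `|2 * A 0 0 * A 1 0| by rewrite normr_gt0 mulf_neq0.
  have M0 : 0 <= M by exact: le_trans (hM _ hA 0 0).
  pose n := Num.bound (M / `|2 * A 0 0 * A 1 0|).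
  have hn : M / `|2 * A 0 0 * A 1 0| < n%:R by rewrite archi_boundP// divr_ge0.
  have n1 : (0 < n)%N.
    by rewrite -(ltr_nat R); apply: le_lt_trans hn; rewrite divr_ge0.
  have G2 : G (A ^+ (2 * n)).
    by rewrite (_ : (2 * n)%N = (2 * n).-1.+1) ?prednK ?muln_gt0//; exact: expG.
  have := hM _ G2 1 0; rewrite cE mx2_entries normrM normr_nat; apply/negP.
  by rewrite -ltNge mulrC -ltr_pdivrMr.
rewrite eA c0; have oppmx2 (a' b' c d : R) : - mx2 a' b' c d = mx2 (- a') (- b') (- c) (- d).
  by rewrite -scaleN1r mx2Z !mulN1r.
by rewrite oppmx2 oppr0; case: (normr1_sign n0) => ->; [left|right].
Qed.

(* If R_t A u = |A u| u then R_(-t) A R_t A is in the group again, and it maps u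
   to a vector of norm |A u| ^ 2; iterating bounds |A u| by 1. *)
Lemma bounded_group_rotation :
  (forall A s, G A -> G (rotmx (- s) *m A *m rotmx s)) ->
  forall A, G A -> forall x : 'cV[R]_2, enorm (A *m x) = enorm x.
Proof.
move=> conjG; have [M hM] := boundG.
have sq A (u : 'cV[R]_2) : G A -> enorm u = 1 ->
    exists2 A', G A' & enorm (A' *m u) = enorm (A *m u) ^+ 2.
  move=> hA u1; set r := enorm (A *m u).
  have [|s hs] := @rotmx_transitive R (A *m u) (r *: u).
    by rewrite enormZ u1 mulr1 ger0_norm// enorm_ge0.
  exists ((rotmx (- s) *m A *m rotmx s) *m A); first by apply: mulG => //; exact: conjG.
  rewrite -!mulmxA -hs enorm_rotmx -scalemxAr enormZ ger0_norm ?enorm_ge0//.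
have iter A (u : 'cV[R]_2) k : G A -> enorm u = 1 ->
    exists2 A', G A' & enorm (A' *m u) = enorm (A *m u) ^+ (2 ^ k).
  move=> hA u1; elim: k => [|k [A' hA' e]]; first by exists A.
  have [A'' hA'' e'] := sq A' u hA' u1; exists A'' => //.
  by rewrite e' e -exprM expnSr.
have bd (u : 'cV[R]_2) : enorm u = 1 -> exists N, forall A, G A -> enorm (A *m u) <= N.
  move=> u1; pose K := M * `|u 0 0| + M * `|u 1 0|.
  exists (Num.sqrt (K ^+ 2 + K ^+ 2)) => A hA; rewrite /enorm ler_sqrt; last first.
    by rewrite addr_ge0 ?sqr_ge0.
  have row (i : 'I_2) : `|A i 0 * u 0 0 + A i 1 * u 1 0| <= K.
    by rewrite (le_trans (ler_normD _ _))// !normrM lerD// ler_wpM2r// hM.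
  have sqr_le (y : R) : `|y| <= K -> y * y <= K ^+ 2.
    move=> yK; rewrite -expr2 -real_normK ?num_real// ler_pXn2r ?nnegrE//.
    exact: le_trans yK.
  by rewrite dotv2 !mulmx_col0 !mulmx_col1 lerD// sqr_le.
have le1 A u : G A -> enorm u = 1 -> enorm (A *m u) <= 1.
  move=> hA u1; have [N hN] := bd u u1.
  rewrite -[leLHS]ger0_norm ?enorm_ge0//; apply: (@bounded_expn_le1 _ _ (Num.max N 1)) => n.
  rewrite ger0_norm ?enorm_ge0// le_max.
  have [r1|r1] := leP (enorm (A *m u)) 1.
    by rewrite exprn_ile1 ?enorm_ge0// orbT.
  have [A' hA' e] := iter A u n hA u1.
  apply/orP; left; apply: le_trans (hN _ hA'); rewrite e.
  by apply: ler_weXn2l; [exact: ltW|apply: ltnW; exact: ltn_expl].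
have le A x : G A -> enorm (A *m x) <= enorm x.
  move=> hA; have [->|x0] := eqVneq x 0; first by rewrite mulmx0.
  have n0 : 0 < enorm x by rewrite enorm_gt0.
  have := le1 A ((enorm x)^-1 *: x) hA.
  rewrite -scalemxAr !enormZ ger0_norm ?invr_ge0 ?enorm_ge0// mulVf ?gt_eqF//.
  by move=> /(_ erefl); rewrite mulrC ler_pdivrMr// mul1r.
move=> A hA x; apply/eqP; rewrite eq_le le//=.
rewrite -{1}(mulKmx (unitG hA) x); apply: le; exact: invG.
Qed.

End bounded_groups.

Section closed_subgroups.
Context {R : realType}.

Lemma closed_subgroup_cyclic (T : set R) (p t0 : R) :
  (forall s t, T s -> T t -> T (s - t)) ->
  (forall t, (forall e, 0 < e -> exists2 s, T s & `|t - s| < e) -> T t) ->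
  0 < p -> T p -> ~ T t0 ->
  exists2 n : nat, (1 <= n)%N & forall t, T t <-> exists k : int, t = k%:~R * (p / n%:R).
Proof.
move=> subT closedT p0 Tp nTt0.
have T0 : T 0 by rewrite -(subrr p); exact: subT.
have TN t : T t -> T (- t) by move=> ht; rewrite -sub0r; exact: subT.
have Tnat t (k : nat) : T t -> T (k%:R * t).
  move=> ht; elim: k => [|k ih]; first by rewrite mul0r.
  have -> : k.+1%:R * t = k%:R * t - - t by rewrite opprK -natr1 mulrDl mul1r.
  by apply: subT => //; exact: TN.
have Tint t (k : int) : T t -> T (k%:~R * t).
  move=> ht; case: k => k; first exact: Tnat.
  by rewrite NegzE mulrNz mulNr; apply: TN; exact: Tnat.
have floor_rem (t a : R) : 0 < a -> 0 <= t - (Num.floor (t / a))%:~R * a < a.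
  move=> a0; have /andP[h1 h2] := floor_itv (t / a).
  rewrite subr_ge0 -ler_pdivlMr// h1/= ltrBlDr.
  by move: h2; rewrite intrD ltr_pdivrMr// mulrDl mul1r addrC.
pose P := [set t | T t /\ 0 < t].
have hP : has_inf P by split; [exists p|exists 0 => t [_ /ltW]].
pose a := inf P.
have lb t : T t -> 0 < t -> a <= t by move=> ht t0'; apply: ge_inf; [case: hP|].
have a0 : 0 <= a by apply: lb_le_inf; [exists p|move=> t [_ /ltW]].
have {}a0 : 0 < a.
  rewrite lt_neqAle a0 andbT; apply/eqP => ae; apply: nTt0; apply: closedT => e e0.
  have [t [Tt t0' te]] : exists2 t, P t & t < a + e by exact: inf_adherent.
  have /andP[h1 h2] := floor_rem t0 t t0'.
  exists ((Num.floor (t0 / t))%:~R * t); first exact: Tint.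
  by rewrite ger0_norm// (lt_trans h2)// (lt_le_trans te)// -ae add0r.
have Pa : T a.
  have [t [Tt t0' ta]] : exists2 t, P t & t < a + a by exact: inf_adherent.
  have [->//|tna] := eqVneq a t.
  have at_ : a < t by rewrite lt_neqAle tna lb.
  have [s [Ts s0 sta]] : exists2 s, P s & s < a + (t - a).
    by apply: inf_adherent => //; rewrite subr_gt0.
  have st : 0 < t - s by rewrite subr_gt0 (lt_le_trans sta)// addrC subrK.
  have := lb _ (subT _ _ Tt Ts) st; have := lb _ Ts s0; lra.
have mult t : T t -> t = (Num.floor (t / a))%:~R * a.
  move=> Tt; have /andP[h1 h2] := floor_rem t a a0.
  apply/eqP; rewrite -subr_eq0; apply/negP => /negP h3.
  have h4 : 0 < t - (Num.floor (t / a))%:~R * a by rewrite lt_neqAle eq_sym h3.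
  have := lb _ (subT _ _ Tt (Tint _ (Num.floor (t / a)) Pa)) h4.
  by rewrite leNgt h2.
have [m mE] : exists m : nat, p = m%:R * a.
  have := mult _ Tp; case: (Num.floor _) => k e; first by exists k.
  have := p0; rewrite e NegzE mulrNz mulNr oppr_gt0 ltNge mulr_ge0//; exact: ltW.
have m1 : (1 <= m)%N.
  by rewrite lt0n; apply/eqP => m0; move: p0; rewrite mE m0 mul0r ltxx.
have aE : p / m%:R = a by rewrite mE mulrC mulKf// pnatr_eq0 -lt0n.
exists m => // t; rewrite aE; split; first by move=> /mult e; eexists; exact: e.
by move=> [k ->]; exact: Tint.
Qed.

End closed_subgroups.

(** * Symmetry groups *)

Section symmetry_groups.
Context {R : realType}.
Local Notation V := 'cV[R]_2.

Lemma normr_coord_le (x : V) i : `|x i 0| <= enorm x.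
Proof.
rewrite -(ler_pXn2r (_ : 0 < 2)%N) ?nnegrE ?enorm_ge0// real_normK ?num_real//.
rewrite sqr_enorm dotv2; move: i; apply: ord2P.
  by rewrite expr2 lerDl -expr2 sqr_ge0.
by rewrite [leRHS]addrC expr2 lerDl -expr2 sqr_ge0.
Qed.

Lemma bounded_strict_symmetries (m : {measure set V -> \bar R}) : levy_measure m ->
  (forall a : V, a != 0 -> m [set x | dotv a x != 0] <> 0%E) ->
  exists M, forall A, strict_symmetry_group m A -> forall i j, `|A i j| <= M.
Proof.
move=> levy_m nondeg; have [rho rho0 h] := bounded_symmetries levy_m nondeg.
exists rho^-1 => A [_ hA] i j.
pose w : V := rho *: \col_k (k == i)%:R.
have wrho : enorm w <= rho.
  have e1 (k : 'I_2) : enorm (\col_l (l == k)%:R : V) = 1.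
    move: k; apply: ord2P; rewrite /enorm dotv2 !mxE/=.
      by rewrite !(mulr0, mulr1, addr0, add0r) sqrtr1.
    by rewrite !(mulr0, mulr1, addr0, add0r) sqrtr1.
  by rewrite enormZ e1 mulr1 gtr0_norm.
have := le_trans (normr_coord_le (A^T *m w) j) (h A hA w wrho).
rewrite /w -scalemxAr mxE mxE (bigD1 i)//= big1 => [|k ki]; last first.
  by rewrite !mxE (negbTE ki) mulr0.
by rewrite !mxE eqxx mulr1 addr0 normrM (gtr0_norm rho0) -ler_pdivlMl// mulr1.
Qed.

Lemma strict_symmetry_mul (m : {measure set V -> \bar R}) A A' :
  strict_symmetry_group m A -> strict_symmetry_group m A' ->
  strict_symmetry_group m (A *m A').
Proof.
move=> [uA hA] [uA' hA']; split; first by rewrite unitmx_mul uA uA'.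
exact: image_meas_mul.
Qed.

Lemma strict_symmetry_inv (m : {measure set V -> \bar R}) A :
  strict_symmetry_group m A -> strict_symmetry_group m (invmx A).
Proof.
by move=> [uA hA]; split; [rewrite unitmx_inv|exact: image_meas_inv].
Qed.

Variables (B : 'M[R]_2) (E : R -> 'M[R]_2).
Hypothesis expE : expanding_group E.
Hypothesis powE : forall t : R, powmx t B = E (ln t).
Variables (mu nu : {measure set V -> \bar R}) (gamma : V).
Variable lambda : {finite_measure set V -> \bar R}.
Hypothesis mu1 : mu setT = 1%E.
Hypothesis fullmu : full mu.
Hypothesis levy_mu : levy_triplet mu gamma 0 nu.
Hypothesis specl : spectral_measure B nu lambda.
Hypothesis scal : forall (n : nat) A, measurable A ->
  ((n.+1%:R)%:E * nu A = nu ((fun x => (E (ln n.+1%:R) *m x)%R) @^-1` A))%E.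

Let muT : (mu setT < +oo)%E. Proof. by rewrite mu1 ltry. Qed.
Let levy_nu : levy_measure nu. Proof. by case: levy_mu. Qed.
Let nu0 : nu [set 0] = 0%E. Proof. by case: levy_nu. Qed.

Let G := strict_symmetry_group nu.
Let S0 := strict_symmetry_group lambda.

Let sub_G A : symmetry_group mu A -> G A.
Proof. by move=> h; split; [case: h|exact: (symmetry_levy_measure muT levy_mu h)]. Qed.

Let iso_sym A : G A -> (forall x, enorm (A *m x) = enorm x) -> symmetry_group mu A.
Proof. by move=> [uA hA] iA; exact: (symmetry_of_isometry muT levy_mu uA iA hA). Qed.

Let boundG : exists M, forall A, G A -> forall i j, `|A i j| <= M.
Proof.
apply: bounded_strict_symmetries => // a a0.
exact: (full_nondegenerate mu1 levy_mu fullmu a0).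
Qed.

Let conjG A s : G A -> G (E (- s) *m A *m E s).
Proof.
move=> [uA hA]; split; last exact: (symmetry_conj_flow expE powE nu0 specl scal s hA).
have uE t : E t \in unitmx.
  by have [] := @mulmx1_unit R 2 (E t) (E (- t)); rewrite -?(flowD expE) ?subrr ?(flow0 expE).
by rewrite !unitmx_mul uA !uE.
Qed.

Let G_S0 A : (forall x, enorm (A *m x) = enorm x) ->
  (forall s, A *m E s = E s *m A) -> G A <-> S0 A.
Proof.
move=> iA cA; split => -[uA hA]; split => //.
  exact: (spectral_of_symmetry expE powE specl).
exact: (symmetry_of_spectral expE powE nu0 specl scal).
Qed.

Let symE (K : set 'M[R]_2) : (forall A, G A -> K A) ->
  (forall A, K A -> forall x, enorm (A *m x) = enorm x) ->
  (forall A, K A -> forall s, A *m E s = E s *m A) ->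
  symmetry_group mu = S0 `&` K.
Proof.
move=> GK iK cK; apply/seteqP; split => A.
  move=> /sub_G hA; have hK := GK _ hA; split => //.
  by apply/(G_S0 (iK _ hK) (cK _ hK)).
move=> [hS hK]; apply: iso_sym; last exact: iK.
by apply/(G_S0 (iK _ hK) (cK _ hK)).
Qed.

Lemma oppmx2 (a b c d : R) : - mx2 a b c d = mx2 (- a) (- b) (- c) (- d).
Proof. by rewrite -scaleN1r mx2Z !mulN1r. Qed.

Lemma symmetry_diag b1 b2 : b1 != b2 -> E = diag_flow b1 b2 ->
  symmetry_group mu = S0 `&` dihedral2.
Proof.
move=> b12 EE; have dih A : dihedral2 A -> exists e f : R,
    [/\ A = mx2 e 0 0 f, e ^+ 2 = 1 & f ^+ 2 = 1].
  have r0 : reflmx 0 = mx2 1 0 0 (-1) :> 'M[R]_2 by rewrite /reflmx cos0 sin0.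
  rewrite /dihedral2/= r0 mx2_1 !oppmx2 oppr0 opprK.
  by case=> ->; do 2 eexists; split; try reflexivity; rewrite ?sqrrN expr1n.
apply: symE.
- apply: (@bounded_group_diag R G _ _ _ boundG b1 b2 b12).
  + by move=> A [].
  + exact: strict_symmetry_mul.
  + exact: strict_symmetry_inv.
  + by move=> A s; rewrite -EE; exact: conjG.
- move=> A /dih[e [f [-> e1 f1]]] x; apply: enorm_eq.
  rewrite !dotv2 !mulmx_col0 !mulmx_col1 !mx2_entries.
  transitivity (e ^+ 2 * (x 0 0 * x 0 0) + f ^+ 2 * (x 1 0 * x 1 0)); first by ring.
  by rewrite e1 f1 !mul1r.
- move=> A /dih[e [f [-> _ _]]] s; rewrite EE /diag_flow !mx2_mul.
  by congr mx2; ring.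
Qed.

Lemma cyclic_rot2P (A : 'M[R]_2) : cyclic_rot 2 A <-> A = 1%:M \/ A = - 1%:M.
Proof.
have r1 : rotmx pi = - 1%:M :> 'M[R]_2.
  by rewrite /rotmx cospi sinpi mx2_1 oppmx2 oppr0.
split.
  move=> [[|[|//]] _ <-]; [left|right].
    by rewrite mulr0 mul0r rotmx0.
  by rewrite mulr1 mulrAC divff// mul1r.
case=> ->; [exists 0%N|exists 1%N] => //.
  by rewrite mulr0 mul0r rotmx0.
by rewrite mulr1 mulrAC divff// mul1r.
Qed.

Lemma symmetry_shear b : E = shear_flow b ->
  symmetry_group mu = S0 `&` cyclic_rot 2.
Proof.
move=> EE; apply: symE.
- move=> A hA; apply/cyclic_rot2P; move: A hA.
  apply: (@bounded_group_shear R G _ _ _ boundG b).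
  + by move=> A [].
  + exact: strict_symmetry_mul.
  + exact: strict_symmetry_inv.
  + by move=> A s; rewrite -EE; exact: conjG.
- move=> A /cyclic_rot2P[] -> x; rewrite ?mulNmx mul1mx//.
  by rewrite -scaleN1r enormZ normrN1 mul1r.
- by move=> A /cyclic_rot2P[] -> s; rewrite ?mulNmx ?mulmxN mul1mx mulmx1.
Qed.

Section spiral.
Variables b c : R.
Hypothesis c0 : c != 0.
Hypothesis EE : E = spiral_flow b c.

Let conjG_rot A s : G A -> G (rotmx (- s) *m A *m rotmx s).
Proof.
move=> /(conjG (s / c)); rewrite EE /spiral_flow -!scalemxAl -!scalemxAr scalerA.
by rewrite -expRD mulrN addNr expR0 scale1r mulrN [c * _]mulrC divfK.
Qed.

Let G_isometry A : G A -> forall x, enorm (A *m x) = enorm x.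
Proof.
move: A; apply: (@bounded_group_rotation R G _ _ _ boundG) => //.
- by move=> A [].
- exact: strict_symmetry_mul.
- exact: strict_symmetry_inv.
Qed.

Let rot_commute t s : rotmx t *m E s = E s *m rotmx t.
Proof. by rewrite EE /spiral_flow -scalemxAl -scalemxAr -!rotmxD addrC. Qed.

Let rot_G_S0 t : G (rotmx t) <-> S0 (rotmx t).
Proof. by apply: G_S0; [move=> x; exact: enorm_rotmx|exact: rot_commute]. Qed.

Let T := [set t : R | S0 (rotmx t)].

Let T_all_sym : (forall t, T t) -> symmetry_group mu = O2.
Proof.
move=> hT; have Grot t : G (rotmx t) by apply/rot_G_S0; exact: hT.
apply/seteqP; split => A; first by move=> /sub_G/G_isometry; exact: isometry_O2.
case=> -[t _ <-].
  by apply: iso_sym => // x; exact: enorm_rotmx.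
have sT : (reflmx t)^T = reflmx t :> 'M[R]_2 by rewrite [LHS]mx2_eta !mxE.
have uF : (reflmx t : 'M[R]_2) \in unitmx.
  by have [] := mulmx1_unit (reflmx_sqr t).
apply: (@symmetry_of_exponent R 2 mu nu gamma muT levy_mu _ (reflmx t *m gamma - gamma)) => // z.
- rewrite sT; have [|s ->] := @rotmx_transitive R z (reflmx t *m z).
    by rewrite enorm_reflmx.
  have [_ hs] := Grot (- s).
  by rewrite -(levy_re_invariant levy_mu z hs) rotmxN opprK.
- have hN : meas_eq (image_meas (- 1%:M) nu) nu.
    have [_] := Grot pi; rewrite (_ : rotmx pi = - 1%:M)//.
    by rewrite /rotmx cospi sinpi mx2_1 oppmx2 oppr0.
  rewrite !(levy_im_symmetric levy_mu _ hN) dotv_mulmx trmxK dotvBl; ring.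
Qed.

Let S0_rot_Rintegral (f : V -> R) t : (forall s, T s) -> measurable_fun setT f ->
  (forall x, `|f x| <= 1) ->
  \int[lambda]_x f (rotmx t *m x) = \int[lambda]_x f x.
Proof.
move=> hT mf f1; have [_ h] := hT t.
have lT : (lambda setT < +oo)%E.
  by rewrite -ge0_fin_numE//; exact: (fin_num_measure lambda _ measurableT).
have mr : measurable_fun setT (fun x : V => rotmx t *m x) by exact: measurable_mulmx.
apply: (@eq_dist_Rintegral _ _ _ _ _ _ _ lambda lambda
  (fun x => rotmx t *m x) id) => //.
- apply: (@integ_le _ _ _ _ _ (fun=> 1)) => //; last exact: integ_cst.
  exact: (measurableT_comp mf mr).
- by apply: (@integ_le _ _ _ _ _ (fun=> 1)) => //; exact: integ_cst.
Qed.

Let T_all_reflmx t : (forall s, T s) -> S0 (reflmx t).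
Proof.
move=> hT; have [uF _] := mulmx1_unit (reflmx_sqr t).
have sT : (reflmx t)^T = reflmx t :> 'M[R]_2 by rewrite [LHS]mx2_eta !mxE.
have lT : (lambda setT < +oo)%E.
  by rewrite -ge0_fin_numE//; exact: (fin_num_measure lambda _ measurableT).
split => // F mF; rewrite /image_meas /pushforward.
have red (g : R -> R) z :
    measurable_fun setT (fun x : V => g (dotv z x)) -> (forall y, `|g y| <= 1) ->
    \int[lambda]_x g (dotv z (reflmx t *m x)) = \int[lambda]_x g (dotv z x).
  move=> mg g1; have [|s hs] := @rotmx_transitive R z (reflmx t *m z).
    by rewrite enorm_reflmx.
  rewrite -(S0_rot_Rintegral (- s) hT mg) => [|x]; last exact: g1.
  by apply: eq_Rintegral => x _; rewrite !dotv_mulmx sT hs rotmxN opprK.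
apply: (@fourier_unique _ _ _ _ _ _ lambda lambda (fun x => reflmx t *m x) id) => //.
- exact: measurable_mulmx.
- move=> z; apply: (red cos z) => //; first exact: measurable_cos_dotv.
  by move=> y; rewrite ler_norml cos_geN1 cos_le1.
- move=> z; apply: (red sin z) => //; first exact: measurable_sin_dotv.
  by move=> y; rewrite ler_norml sin_geN1 sin_le1.
Qed.

Let levy_lambda : levy_measure lambda.
Proof.
split.
  apply: subset_measure0 specl.1 => //; first exact: measurable_set0v.
    by apply: measurableC; exact: measurable_sphere.
  by move=> x -> /=; rewrite /sphere/= enorm0 => /eqP; rewrite eq_sym oner_eq0.
have lT := fin_num_measure lambda _ (measurableT : measurable [set: V]).
apply: (@le_lt_trans _ _ (\int[lambda]_x (cst 1%:E x))%E); last first.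
  by rewrite integral_cst// mul1e -ge0_fin_numE.
apply: ge0_le_integral => //.
- by move=> x _; rewrite lee_fin levy_weight_ge0.
- by apply/measurable_EFinP; exact: measurable_levy_weight.
- by move=> x _; rewrite lee_fin ge_min lexx.
Qed.

Let nondeg_lambda : (forall s, T s) ->
  forall a : V, a != 0 -> lambda [set x | dotv a x != 0] <> 0%E.
Proof.
move=> hT a a0 la.
have mN (z : V) : measurable [set x : V | dotv z x != 0].
  rewrite (_ : mkset _ = setT `&` dotv z @^-1` [set~ 0]).
    by apply: measurable_dotv => //; exact: measurableC.
  by rewrite setTI; apply/seteqP; split => x /= /eqP.
have rotE s : rotmx s *m a != 0 by rewrite -enorm_eq0 enorm_rotmx enorm_eq0.
have lrot s : lambda [set x | dotv (rotmx s *m a) x != 0] = 0%E.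
  have [_ h] := hT (- s); rewrite -[RHS]la -[RHS](h _ (mN a)).
  congr (lambda _); apply/seteqP; split => x /=.
    by rewrite dotv_mulmx rotmxN opprK.
  by rewrite dotv_mulmx rotmxN opprK.
pose a' := rotmx (pi / 2) *m a.
have mn0 : measurable [set x : V | x != 0].
  rewrite (_ : mkset _ = ~` [set 0]); first by apply: measurableC; exact: measurable_set0v.
  by apply/seteqP; split => x /= /eqP.
have l0 : lambda [set x : V | x != 0] = 0%E.
  have l1 := la; have l2 := lrot (pi / 2).
  have : lambda ([set x | dotv a x != 0] `|` [set x | dotv a' x != 0]) = 0%E.
    by apply: null_set_setU.
  apply: subset_measure0 => //; first exact: measurableU.
  move=> x /= x0; apply: contrapT => /not_orP[/negP + /negP].
  rewrite !negbK /a' /rotmx => /eqP h1 /eqP.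
  rewrite !dotv2 !mulmx_col0 !mulmx_col1 !mx2_entries cos_pihalf sin_pihalf.
  rewrite dotv2 in h1 => h2.
  have aa : 0 < dotv a a by rewrite lt_neqAle eq_sym dotv_eq0 a0 dotv_ge0.
  rewrite dotv2 in aa.
  have coord0 y : (a 0 0 * a 0 0 + a 1 0 * a 1 0) * y = 0 -> y = 0.
    by move/eqP; rewrite mulf_eq0 gt_eqF//= => /eqP.
  move: x0; apply/negP; rewrite negbK; apply/eqP/colP; apply: ord2P; rewrite mxE; apply: coord0.
    transitivity (a 0 0 * (a 0 0 * x 0 0 + a 1 0 * x 1 0) -
      a 1 0 * ((0 * a 0 0 + -1 * a 1 0) * x 0 0 + (1 * a 0 0 + 0 * a 1 0) * x 1 0)).
      by ring.
    by rewrite h1 h2; ring.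
  transitivity (a 1 0 * (a 0 0 * x 0 0 + a 1 0 * x 1 0) +
    a 0 0 * ((0 * a 0 0 + -1 * a 1 0) * x 0 0 + (1 * a 0 0 + 0 * a 1 0) * x 1 0)).
    by ring.
  by rewrite h1 h2; ring.
have lz F : measurable F -> (lambda F = 0)%E.
  move=> mF; have mz := @measurable_set0v R 2.
  rewrite -(setUIDK F [set 0]) measureU//; last first.
  - by apply/seteqP; split => x // [[_ ?] [_ ?]].
  - exact: measurableD.
  - exact: measurableI.
  rewrite (subset_measure0 _ _ _ levy_lambda.1)//; last exact: measurableI.
  rewrite add0e (subset_measure0 _ _ _ l0)//.
  - exact: measurableD.
  - by move=> x [_ /eqP].
apply: (full_nondegenerate mu1 levy_mu fullmu a0).
apply: (@polar_unique R E expE nu mzero) => //.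
- move=> r F mF; rewrite (cone_scaling expE powE specl scal)//.
  by rewrite lz// mule0.
- by move=> r; rewrite (cone_scaling expE powE specl scal)// lz// mule0.
Qed.

Let T_all_O2 : (forall s, T s) -> S0 = O2.
Proof.
move=> hT; apply/seteqP; split => [A hA|A [[t _ <-]|[t _ <-]]].
- apply: isometry_O2; move: A hA.
  have [M hM] := bounded_strict_symmetries levy_lambda (nondeg_lambda hT).
  apply: (@bounded_group_rotation R S0) => //.
  + by move=> A [].
  + exact: strict_symmetry_mul.
  + exact: strict_symmetry_inv.
  + by exists M.
  + by move=> A s hA; exact: (strict_symmetry_mul (strict_symmetry_mul (hT (- s)) hA) (hT s)).
- exact: hT.
- exact: T_all_reflmx.
Qed.

Let T_sub s t : T s -> T t -> T (s - t).
Proof.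
move=> hs ht; rewrite /T/= rotmxD; apply: strict_symmetry_mul => //.
have := strict_symmetry_inv ht; congr strict_symmetry_group.
rewrite -[RHS]mul1mx -(mulVmx (rotmx_unit t)) -mulmxA -rotmxD subrr rotmx0.
by rewrite mulmx1.
Qed.

Let T_closed t :
  (forall e, 0 < e -> exists2 s, T s & `|t - s| < e) -> T t.
Proof.
move=> h; split; first exact: rotmx_unit.
have /choice[u hu] : forall n : nat, exists s, T s /\ `|t - s| < n.+1%:R^-1.
  by move=> n; have [|s hs ts] := h n.+1%:R^-1; [rewrite invr_gt0|exists s].
have ut : u n @[n --> \oo] --> t.
  apply/cvgrPdist_lt => e e0; near=> n.
  apply: lt_trans (hu n).2 _; near: n.
  exact: (near_infty_natSinv_lt (PosNum e0)).
have lT : (lambda setT < +oo)%E.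
  by rewrite -ge0_fin_numE//; exact: (fin_num_measure lambda _ measurableT).
have mr s : measurable_fun setT (fun x : V => rotmx s *m x) by exact: measurable_mulmx.
have lim (g : R -> R) z : continuous g -> (forall y, `|g y| <= 1) ->
    measurable_fun setT (fun x : V => g (dotv z x)) ->
    \int[lambda]_x g (dotv z (rotmx t *m x)) = \int[lambda]_x g (dotv z x).
  move=> cg g1 mg; apply/esym.
  have e n : \int[lambda]_x g (dotv z (rotmx (u n) *m x)) = \int[lambda]_x g (dotv z x).
    have [[_ hn] _] := hu n.
    apply: (@eq_dist_Rintegral _ _ _ _ _ _ _ lambda lambda
      (fun x => rotmx (u n) *m x) id _ _ _ (fun x => g (dotv z x))) => //.
    - apply: (@integ_le _ _ _ _ _ (fun=> 1)) => //; last exact: integ_cst.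
      exact: (measurableT_comp mg (mr (u n))).
    - by apply: (@integ_le _ _ _ _ _ (fun=> 1)) => //; exact: integ_cst.
  have c1 : \int[lambda]_x g (dotv z (rotmx (u n) *m x)) @[n --> \oo] -->
      \int[lambda]_x g (dotv z (rotmx t *m x)).
    apply: (@cvg_Rintegral _ _ _ _ _ _ (fun=> 1)) => //; last exact: integ_cst.
      by move=> n; exact: (measurableT_comp mg (mr (u n))).
    move=> x; apply: cvg_comp; last exact: cg.
    rewrite dotv2 !mulmx_col0 !mulmx_col1 /rotmx !mx2_entries.
    under eq_cvg do rewrite dotv2 !mulmx_col0 !mulmx_col1 /rotmx !mx2_entries.
    have cc : cos (u n) @[n --> \oo] --> cos t.
      by apply: cvg_comp ut _; exact: continuous_cos.
    have cs : sin (u n) @[n --> \oo] --> sin t.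
      by apply: cvg_comp ut _; exact: continuous_sin.
    by apply: cvgD; apply: cvgMr; apply: cvgD; apply: cvgMl => //; exact: cvgN.
  move: c1; rewrite (funext e) => c1.
  by have := cvg_unique _ (cvg_cst _) c1; apply.
move=> F mF; rewrite /image_meas /pushforward.
apply: (@fourier_unique _ _ _ _ _ _ lambda lambda (fun x => rotmx t *m x) id) => //.
- move=> z; apply: (lim cos z); [exact: continuous_cos| |exact: measurable_cos_dotv].
  by move=> y; rewrite ler_norml cos_geN1 cos_le1.
- move=> z; apply: (lim sin z); [exact: continuous_sin| |exact: measurable_sin_dotv].
  by move=> y; rewrite ler_norml sin_geN1 sin_le1.
Unshelve. all: by end_near. Qed.

Let rotmxD2pi (s : R) : rotmx (s + 2 * pi) = rotmx s :> 'M[R]_2.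
Proof. by rewrite /rotmx mulr_natl cosD2pi sinD2pi. Qed.

Lemma symmetry_spiral :
  (exists n : nat, [/\ (1 <= n)%N, symmetry_group mu = S0 `&` SO2 &
     S0 `&` SO2 = cyclic_rot n]) \/
  (symmetry_group mu = S0 /\ S0 = O2).
Proof.
have [hT|/existsNP[t0 nT]] := pselect (forall t, T t).
  by right; rewrite T_all_sym// T_all_O2.
left.
have G_SO2 A : G A -> SO2 A.
  move=> hA; have [//|[t _ At]] := isometry_O2 (G_isometry hA).
  exfalso; apply: nT; apply/rot_G_S0; rewrite -At in hA.
  have := strict_symmetry_mul hA (conjG_rot (t0 / 2) hA).
  rewrite !mulmxA reflmx_rotmx opprK -mulmxA -mulmxA (mulmxA (reflmx t)) reflmx_sqr mul1mx.
  by rewrite -rotmxD -splitr.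
have symS0 : symmetry_group mu = S0 `&` SO2.
  apply: symE => [//|A [t _ <-] x|A [t _ <-] s]; first exact: enorm_rotmx.
  exact: rot_commute.
have pi2 : 0 < 2 * pi :> R by rewrite mulr_gt0// pi_gt0.
have T2pi : T (2 * pi).
  rewrite /T/= -[2 * pi]add0r rotmxD2pi rotmx0; split; first exact: unitmx1.
  move=> F mF; rewrite /image_meas /pushforward; congr (lambda _).
  by apply/seteqP; split => x /=; rewrite mul1mx.
have [n n1 hn] := closed_subgroup_cyclic T_sub T_closed pi2 T2pi nT.
exists n; split => //.
have n0 : 0 < n%:R :> R by rewrite ltr0n.
apply/seteqP; split => A.
  move=> [+ [t /andP[t0' t2] At]]; rewrite -At => /hn[k kt].
  have p0 : 0 < 2 * pi / n%:R :> R by rewrite divr_gt0.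
  have k0 : 0 <= k.
    by move: t0'; rewrite kt pmulr_lge0// ler0z.
  exists `|k|%N; last first.
    by congr rotmx; rewrite kt natr_absz ger0_norm//; ring.
  move: t2; rewrite kt mulrCA -[ltRHS]mulr1 ltr_pM2l// ltr_pdivrMr// mul1r.
  by rewrite /= -(ltr_nat R) natr_absz ger0_norm.
move=> [k kn <-]; split; last exact: SO2_rotmx.
by apply/hn; exists k%:Z; rewrite mulrAC mulrC.
Qed.


End spiral.
End symmetry_groups.

Unset Implicit Arguments.

Theorem theorem5p3 (R : realType) (disp : measure_display)
    (Omega : measurableType disp) (P : probability Omega R)
    (X : R -> {RV P >-> 'cV[R]_2}) (B : 'M[R]_2) (gamma : 'cV[R]_2)
    (nu : {measure set 'cV[R]_2 -> \bar R})
    (lambda : {finite_measure set 'cV[R]_2 -> \bar R}) :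
  let mu := distribution P (X 1) in
  levy_process X ->
  operator_stable X B ->
  full mu ->
  levy_triplet mu gamma 0 nu ->
  jordan_form B ->
  spectral_measure B nu lambda ->
  [/\ jordan1 B ->
        symmetry_group mu = strict_symmetry_group lambda `&` dihedral2,
      jordan2 B ->
        (exists n : nat, [/\ (1 <= n)%N,
           symmetry_group mu = strict_symmetry_group lambda `&` SO2 &
           strict_symmetry_group lambda `&` SO2 = cyclic_rot n]) \/
        (symmetry_group mu = strict_symmetry_group lambda /\
         strict_symmetry_group lambda = O2)
    & jordan3 B ->
        symmetry_group mu = strict_symmetry_group lambda `&` cyclic_rot 2].
Proof.
move=> mu levyX stableX fullmu levy_mu _ specl.
have mu1 : distribution P (X 1) setT = 1%E by rewrite probability_setT.
have scal (E : R -> 'M[R]_2) : expanding_group E -> (forall t, powmx t B = E (ln t)) ->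
    forall (n : nat) A, measurable A ->
    ((n.+1%:R)%:E * nu A = nu ((fun x => (E (ln n.+1%:R) *m x)%R) @^-1` A))%E.
  move=> expE powE n A mA; rewrite -powE.
  apply: (operator_stable_levy levyX stableX levy_mu _ mA); rewrite powE.
  by have [] := @mulmx1_unit R 2 (E (ln n.+1%:R)) (E (- ln n.+1%:R));
    rewrite -?(flowD expE) ?subrr ?(flow0 expE).
split.
- move=> [b1 [b2 [hb1 hb2 b12 BE]]].
  have [expE powE] := diag_flowP hb1 hb2; rewrite -BE in powE.
  exact: (symmetry_diag expE powE mu1 fullmu levy_mu specl (scal _ expE powE) b12 erefl).
- move=> [b [c [hb c0 BE]]].
  have [expE powE] := spiral_flowP c hb; rewrite -BE in powE.
  exact: (symmetry_spiral expE powE mu1 fullmu levy_mu specl (scal _ expE powE) c0 erefl).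
- move=> [b [hb BE]].
  have [expE powE] := shear_flowP hb; rewrite -BE in powE.
  exact: (symmetry_shear expE powE mu1 fullmu levy_mu specl (scal _ expE powE) erefl).
Qed.
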